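(* Let $n\in\mathbb N$, $\mathcal X=\{-1,1\}^n$, let $k\in\mathbb R^{n\times n}$ be a matrix with $k_{ii}=0$ for all $i$ (no assumption is made on the sign of $k$), and let $\beta\in(0,\infty)$. Let $H(x)=-\sum_{i,j=1}^nk_{ij}x_ix_j$, let $\pi_\beta(x)=\frac1{Z_\beta}\exp(-\beta H(x))$ with $Z_\beta$ the normalizing constant, and consider the Glauber dynamics, i.e. the continuous time Markov chain on $\mathcal X$ with rates $$Q_\beta(x,y)=\begin{cases}\sqrt{\pi_\beta(y)/\pi_\beta(x)}\,, & \text{if } x \text{ and } y \text{ differ in exactly one coordinate},\\ 0\,,&\text{else.}\end{cases}$$ Assume that $$\varepsilon(\beta):=\max_i\sum_{j:\,j\ne i}\exp\Big(2\beta\sum_{m\ne i,j}\big(|k_{im}|+|k_{jm}|\big)\Big)\Big(e^{4\beta|k_{ij}|}-1\Big)\ \le\ 1.$$ Then the Glauber dynamics satisfies $\mathrm{Ric}(\mathcal X,Q_\beta,\pi_\beta)\ge\big(1-\varepsilon(\beta)\big)2c_*$, where $c_*=\min\{Q_\beta(x,y): x,y\in\mathcal X \text{ differ in exactly one coordinate}\}$ is the minimal transition rate.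
   Context: Entropic Ricci curvature. Let $\mathcal X$ be a finite set, $Q:\mathcal X\times\mathcal X\to[0,\infty)$ irreducible transition rates with $Q(x,x)=0$, reversible with respect to the strictly positive probability measure $\pi$: $Q(x,y)\pi(x)=Q(y,x)\pi(y)$. Let $\mathscr P(\mathcal X)=\{\rho\in[0,\infty)^{\mathcal X}:\sum_x\rho(x)\pi(x)=1\}$ and $\theta(s,t)=\int_0^1 s^\alpha t^{1-\alpha}\,d\alpha$. For $\rho_0,\rho_1\in\mathscr P(\mathcal X)$ define $$\mathcal W(\rho_0,\rho_1)^2=\inf_{\rho,\psi}\ \frac12\int_0^1\sum_{x,y\in\mathcal X}(\psi_t(x)-\psi_t(y))^2\,\theta(\rho_t(x),\rho_t(y))\,Q(x,y)\pi(x)\,dt,$$ the infimum running over all sufficiently regular curves $\rho:[0,1]\to\mathscr P(\mathcal X)$, $\psi:[0,1]\to\mathbb R^{\mathcal X}$ with $\frac{d}{dt}\rho_t(x)+\sum_{y}(\psi_t(y)-\psi_t(x))\theta(\rho_t(x),\rho_t(y))Q(x,y)=0$ for all $x$, and with $\rho|_{t=0}=\rho_0$, $\rho|_{t=1}=\rho_1$. This is a distance. The entropy is $\mathcal H(\rho)=\sum_x\pi(x)\rho(x)\log\rho(x)$. A constant speed geodesic is a curve $(\rho_t)_{t\in[0,1]}$ in $\mathscr P(\mathcal X)$ with $\mathcal W(\rho_s,\rho_t)=|s-t|\mathcal W(\rho_0,\rho_1)$ for all $s,t\in[0,1]$. One writes $\mathrm{Ric}(\mathcal X,Q,\pi)\ge\kappa$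 if for every constant speed geodesic and all $t\in[0,1]$, $$\mathcal H(\rho_t)\le(1-t)\mathcal H(\rho_0)+t\mathcal H(\rho_1)-\frac\kappa2t(1-t)\mathcal W(\rho_0,\rho_1)^2.$$
   Formalization: The matrix k is additionally assumed symmetric (k_ij = k_ji) and n ≥ 1; without symmetry the claim fails, e.g. k_{i1}=K for i ≥ 2, all other entries 0, e^{4βK}=2, n large. *)

(* Defs.v *)
From HB Require Import structures.
From mathcomp Require Import all_boot all_order all_algebra.
From mathcomp Require Import all_classical all_reals all_analysis.

Set Implicit Arguments.
Unset Strict Implicit.
Unset Printing Implicit Defensive.

Import Order.TTheory GRing.Theory Num.Theory.
Import numFieldNormedType.Exports.

Local Open Scope classical_set_scope.
Local Open Scope ring_scope.

Section EntropicRicci.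
Context {R : realType} {X : finType}.
Implicit Types (Q : X -> X -> R) (pi : X -> R).

(* Densities with respect to pi. *)
Definition density pi : set (X -> R) :=
  [set rho | (forall x, 0 <= rho x) /\ \sum_x rho x * pi x = 1].

(* Logarithmic mean.  powR has 0 `^ 0 = 1, which only affects the endpoints of
   the interval of integration. *)
Definition theta (s t : R) : R :=
  \int[lebesgue_measure]_(a in `[0, 1]) (s `^ a * t `^ (1 - a)).

(* Admissible pairs (rho, psi) between rho0 and rho1.  The regularity is: rho
   continuous on [0, 1] and C^1 on the open interval, psi Borel measurable. *)
Definition admissible Q pi (rho0 rho1 : X -> R) (rho psi : R -> X -> R) : Prop :=
  [/\ rho 0 = rho0 /\ rho 1 = rho1,
      forall t : R, 0 <= t <= 1 -> density pi (rho t),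
      forall x : X, [/\ {within `[0, 1], continuous (rho^~ x)},
        forall t : R, 0 < t < 1 -> derivable (rho^~ x) t 1 &
        forall t : R, 0 < t < 1 ->
          {for t, continuous ((rho^~ x)^`())%classic}],
      forall x : X, measurable_fun (`[0, 1] : set R) (psi^~ x) &
      forall (x : X) (t : R), 0 < t < 1 ->
        ((rho^~ x)^`())%classic t
        + \sum_y (psi t y - psi t x) * theta (rho t x) (rho t y) * Q x y = 0].

Definition action Q pi (rho psi : R -> X -> R) : \bar R :=
  ((2^-1)%:E * \int[lebesgue_measure]_(t in `[0%R, 1%R])
    (\sum_x \sum_y (psi t x - psi t y) ^+ 2
       * theta (rho t x) (rho t y) * Q x y * pi x)%:E)%E.

Definition W Q pi (rho0 rho1 : X -> R) : \bar R :=
  sqrte (ereal_inf [set a | exists rho psi,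
    admissible Q pi rho0 rho1 rho psi /\ a = action Q pi rho psi]).

(* The convention 0 log 0 = 0 holds since ln vanishes at 0. *)
Definition entropy pi (rho : X -> R) : R := \sum_x pi x * rho x * ln (rho x).

Definition constant_speed_geodesic Q pi (rho : R -> X -> R) : Prop :=
  (forall t : R, 0 <= t <= 1 -> density pi (rho t)) /\
  (forall s t : R, 0 <= s <= 1 -> 0 <= t <= 1 ->
    W Q pi (rho s) (rho t) = (`|s - t|%:E * W Q pi (rho 0%R) (rho 1%R))%E).

Definition Ric_ge Q pi (kappa : R) : Prop :=
  forall rho, constant_speed_geodesic Q pi rho ->
  forall t : R, 0 <= t <= 1 ->
    ((entropy pi (rho t))%:E <=
       ((1 - t) * entropy pi (rho 0%R) + t * entropy pi (rho 1%R))%:E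
       - (kappa / 2 * t * (1 - t))%:E * W Q pi (rho 0%R) (rho 1%R) ^+ 2)%E.

End EntropicRicci.

Section Glauber.
Context {R : realType} {n : nat}.
Implicit Types (k : 'M[R]_n) (beta : R).

(* {-1, 1}^n: a boolean b stands for the spin (-1)^b. *)
Definition config (n : nat) : finType := {ffun 'I_n -> bool}.

Definition spin (x : config n) (i : 'I_n) : R := (-1) ^+ x i.

Definition differ_in_one (x y : config n) : bool :=
  #|[set i | x i != y i]%SET| == 1%N.

Definition hamiltonian k (x : config n) : R :=
  - \sum_i \sum_j k i j * spin x i * spin x j.

Definition partition_function k beta : R :=
  \sum_x expR (- beta * hamiltonian k x).

Definition gibbs k beta (x : config n) : R :=
  (partition_function k beta)^-1 * expR (- beta * hamiltonian k x).

Definition glauber k beta (x y : config n) : R :=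
  if differ_in_one x y then Num.sqrt (gibbs k beta y / gibbs k beta x) else 0.

(* All the terms of the maximum are nonnegative, so that for n > 0 the neutral
   value 0 does not contribute. *)
Definition eps k beta : R :=
  \big[Num.max/0]_i \sum_(j | j != i)
    (expR (2 * beta * \sum_(m | (m != i) && (m != j)) (`|k i m| + `|k j m|))
     * (expR (4 * beta * `|k i j|) - 1)).

(* The infimum of a finite set, nonempty for n > 0, hence a minimum. *)
Definition min_rate k beta : R :=
  inf [set q | exists x y, differ_in_one x y /\ q = glauber k beta x y].

End Glauber.

(* Main.v *)
Require Import Defs.
From mathcomp Require Import all_boot all_order all_algebra.
From mathcomp Require Import ring lra.
From mathcomp Require Import all_classical all_reals all_analysis measurable_realfun.

Set Implicit Arguments.
Unset Strict Implicit.
Unset Printing Implicit Defensive.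

Import Order.TTheory GRing.Theory Num.Theory.
Import numFieldNormedType.Exports.
Local Open Scope classical_set_scope.
Local Open Scope ring_scope.

(** A tangent vector v at rho is measured through the dual of the Dirichlet form
    A(rho; phi, phi) weighted by the logarithmic mean, so that the continuity
    equation never has to be solved at densities with zeros.

    Bochner's inequality B >= kappa A on positive densities gives the gradient
    estimate A(rho; P_t psi) <= e^(-2 kappa t) A(P_t rho; psi) for the heat
    semigroup P.  Dually, P contracts tangent vectors.  Letting P act for time h t
    on the point of parameter t of an almost optimal curve from r0 to r1 yields
    the evolution variational inequality
      W(r0, P_h r1)^2 <= e^(-kappa h) W(r0, r1)^2 - 2 h (H(P_h r1) - H(r0)).
    Applied to an intermediate point of a geodesic from both of its ends, together
    with the triangle inequality and h -> 0, it gives the convexity of H; no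
    regularity of the geodesic is needed.

    For spin flips, B is a sum over pairs of flips (i, j) with coefficients
    sqrt (pi(x^i) pi(x^j)).  The smaller of the two values of this coefficient on
    the square spanned by i and j contributes a nonnegative term.  The excess over
    it sums to at most eps(beta) pi(x) and is absorbed by the diagonal terms, which
    are at least 2 A.  Hence kappa = 2 (1 - eps(beta)), and the minimal rate is at
    most 1 because Q(x, y) Q(y, x) = 1. *)

(** * Calculus of one real variable *)

(** The mean [theta] degenerates at 0 and an admissible pair carries only a measurable potential, so
    neither the logarithm of the density nor the potential can be manipulated along a given curve.
    Bounds of the form [dual_le] survive every operation performed on curves: averaging in time and
    mixing of densities, because [dirichlet] is concave in the density; the heat flow, by duality;
    reversal and concatenation, by scaling. The positivity needed to recover a potential is bought
    by mixing in the constant density 1 with a weight that vanishes at both ends.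

    Convexity comes from an exact cancellation: for a point at distances s w and (1 - s) w from the
    ends, (s w)^2 / s + ((1 - s) w)^2 / (1 - s) = w^2, so that after division by h only the
    contraction rate and the entropies remain.

    The square roots in the rates make pi(x) Q(x, x^i) Q(x, x^j) equal to sqrt (pi(x^i) pi(x^j)),
    which is constant in the absence of interaction. The curvature is supplied by the diagonal pairs
    i = j, where the constant rests on the logarithmic mean dominating the geometric mean. *)

Section RealDerivatives.
Context {R : realType}.
Implicit Types f g : R -> R.

Lemma is_derive_lam_cst (x c : R) : is_derive x (1 : R) (fun=> c) 0.
Proof. exact: is_derive_cst. Qed.

Lemma is_derive_lam_id (x : R) : is_derive x (1 : R) (fun t : R => t) 1.
Proof. exact: is_derive_id. Qed.

Lemma is_derive_lamD f g (x a b : R) : is_derive x 1 f a ->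
  is_derive x 1 g b -> is_derive x 1 (fun t => f t + g t) (a + b).
Proof. by move=> hf hg; exact: is_deriveD. Qed.

Lemma is_derive_lamN f (x a : R) : is_derive x 1 f a ->
  is_derive x 1 (fun t => - f t) (- a).
Proof. by move=> hf; exact: is_deriveN. Qed.

Lemma is_derive_lamM f g (x a b : R) : is_derive x 1 f a ->
  is_derive x 1 g b -> is_derive x 1 (fun t => f t * g t) (a * g x + f x * b).
Proof.
move=> hf hg; apply: (is_derive_eq (is_deriveM hf hg)).
by rewrite /GRing.scale /=; ring.
Qed.

Lemma is_derive_lamX f n (x a : R) : is_derive x 1 f a ->
  is_derive x 1 (fun t => f t ^+ n) (n%:R * f x ^+ n.-1 * a).
Proof.
move=> hf; apply: (is_derive_eq _ _); last exact: erefl.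
have -> : (fun t => f t ^+ n) = f ^+ n by apply/funext => t; rewrite fctE.
exact: is_deriveX.
Qed.

Lemma is_derive_lam_comp f g (x a b : R) : is_derive (g x) 1 f a ->
  is_derive x 1 g b -> is_derive x 1 (fun t => f (g t)) (a * b).
Proof. by move=> hf hg; exact: (is_derive1_comp hf hg). Qed.

Lemma is_derive_lam_expR f (x a : R) : is_derive x 1 f a ->
  is_derive x 1 (fun t => expR (f t)) (expR (f x) * a).
Proof. by move=> hf; apply: is_derive_lam_comp. Qed.

Lemma is_derive_lam_ln f (x a : R) : 0 < f x -> is_derive x 1 f a ->
  is_derive x 1 (fun t => ln (f t)) ((f x)^-1 * a).
Proof. by move=> h hf; apply: is_derive_lam_comp => //; exact: is_derive1_ln. Qed.

Lemma is_derive_lam_sum (I : Type) (r : seq I) (P : pred I) (f : I -> R -> R)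
    (x : R) (d : I -> R) : (forall i, is_derive x 1 (f i) (d i)) ->
  is_derive x 1 (fun t => \sum_(i <- r | P i) f i t) (\sum_(i <- r | P i) d i).
Proof.
move=> h; elim: r => [|i r ih].
  rewrite big_nil; under [X in is_derive _ _ X]eq_fun do rewrite big_nil.
  exact: is_derive_lam_cst.
rewrite big_cons; under [X in is_derive _ _ X]eq_fun do rewrite big_cons.
by case: ifP => _ //; exact: is_derive_lamD.
Qed.

Lemma is_derive_cvg f (x a : R) : is_derive x 1 f a -> f t @[t --> x] --> f x.
Proof.
by case=> /derivable1_diffP/differentiable_continuous.
Qed.

Lemma is_derive_slopeP f (x a : R) : is_derive x 1 f a <->
  h^-1 * (f (h + x) - f x) @[h --> (0 : R)^'] --> a.
Proof.
have E : (fun h : R => h^-1 *: ((f \o shift x) (h *: 1) - f x)) =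
         (fun h => h^-1 * (f (h + x) - f x)).
  by apply/funext => h; rewrite /shift /= /GRing.scale /= mulr1.
split=> [[]|h]; first by rewrite /derivable /derive E => h <-.
have h' : h0^-1 *: ((f \o shift x) (h0 *: 1) - f x) @[h0 --> (0 : R)^'] --> a by rewrite E.
split; first by apply/cvg_ex; exists a.
exact: (cvg_lim _ h').
Qed.

(** Used in place of differentiation under the integral sign: explicit lower and upper bounds that
    touch at one point with equal slopes determine the derivative there. *)
Lemma is_derive_squeeze f (l u : R -> R) (x a : R) : is_derive x 1 l a ->
  is_derive x 1 u a -> (forall t, l t <= f t <= u t) -> l x = u x -> is_derive x 1 f a.
Proof.
move=> dl du lfu lux.
have fx : f x = l x by have := lfu x; rewrite -lux => /le_anti.
suff dg : is_derive x 1 (fun t => f t - l t) 0.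
  have -> : f = (fun t => (f t - l t) + l t) by apply/funext => t; rewrite subrK.
  by have := is_derive_lamD dg dl; rewrite add0r.
apply/is_derive_slopeP; apply/norm_cvg0P.
have du' : is_derive x 1 (fun t => u t - l t) 0.
  by have := is_derive_lamD du (is_derive_lamN dl); rewrite subrr.
move/is_derive_slopeP/cvg_norm: du'; rewrite normr0; apply: squeeze_cvgr; last exact: cvg_cst.
near=> h; rewrite normr_ge0 /= !normrM ler_wpM2l// fx lux !subrr !subr0.
have /andP[h1 h2] := lfu (h + x).
by rewrite !ger0_norm ?subr_ge0// ?(le_trans h1 h2)// lerB.
Unshelve. all: by end_near. Qed.

Lemma near_is_derive f g (x a : R) : (\forall t \near x, f t = g t) ->
  is_derive x 1 f a -> is_derive x 1 g a.
Proof. exact: near_eq_is_derive. Qed.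

End RealDerivatives.

(* Typeclass resolution would solve the premises with the instances of the
   library, whose derivatives are stated with [*:]. *)
Ltac deriv1 := first
  [ notypeclasses refine (is_derive_lam_cst _ _)
  | notypeclasses refine (is_derive_lam_id _)
  | match goal with
    | H : is_derive _ _ _ _ |- _ => notypeclasses refine H
    | H : forall s, is_derive s _ _ _ |- _ => notypeclasses refine (H _)
    | H : forall i s, is_derive s _ _ _ |- _ => notypeclasses refine (H _ _)
    | H : forall s i j, is_derive s _ _ _ |- _ => notypeclasses refine (H _ _ _)
    end
  | notypeclasses refine (is_derive_lamD _ _)
  | notypeclasses refine (is_derive_lamN _)
  | notypeclasses refine (is_derive_lamX _ _)
  | notypeclasses refine (is_derive_lamM _ _)
  | notypeclasses refine (is_derive_lam_expR _)
  | notypeclasses refine (is_derive_lam_ln _ _)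
  | notypeclasses refine (is_derive_lam_sum _ _ _); intro ].

Ltac deriv := notypeclasses refine (is_derive_eq _ _); [repeat deriv1|rewrite /=].

Section Monotone.
Context {R : realType}.
Implicit Types f g : R -> R.

Lemma within_itv_cvg f (a b : R) : (forall t : R, a <= t <= b -> f x @[x --> t] --> f t) ->
  {within `[a, b], continuous f}.
Proof.
move=> h; apply: continuous_in_subspaceT => t /set_mem /=.
by rewrite in_itv /= => /h.
Qed.

Lemma is_derive_ge0_le f (df : R -> R) (a b : R) : a <= b ->
  {within `[a, b], continuous f} ->
  (forall t : R, a < t < b -> is_derive t 1 f (df t)) ->
  (forall t : R, a < t < b -> 0 <= df t) -> f a <= f b.
Proof.
rewrite le_eqVlt => /predU1P[-> //|ab] fc fd d0.
have fd' x : x \in `]a, b[ -> is_derive x 1 f (df x) by rewrite in_itv => /fd.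
have [c cab /eqP] := MVT ab fd' fc.
rewrite subr_eq => /eqP ->; rewrite lerDr mulr_ge0 ?subr_ge0 ?(ltW ab)//.
by apply: d0; move: cab; rewrite in_itv.
Qed.

Lemma is_derive_ge0_homo f (df : R -> R) : (forall t : R, is_derive t 1 f (df t)) ->
  (forall t : R, 0 <= df t) -> {homo f : x y / x <= y}.
Proof.
move=> fd d0 a b ab; apply: (@is_derive_ge0_le f df) => //.
by apply: within_itv_cvg => t _; exact: is_derive_cvg.
Qed.

Lemma is_derive0_eq f (a b : R) : (forall t : R, is_derive t 1 f 0) -> f a = f b.
Proof.
move=> fd; wlog ab : a b / a <= b.
  by move=> h; have [/h //|/ltW/h] := leP a b.
apply/eqP; rewrite eq_le; apply/andP; split.
  exact: (@is_derive_ge0_homo f (fun=> 0)).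
rewrite -lerN2; apply: (@is_derive_ge0_homo (fun t => - f t) (fun=> 0)) => // t.
by deriv; rewrite oppr0.
Qed.

End Monotone.

Section Primitives.
Context {R : realType}.
Implicit Types f g : R -> R.
Local Notation mu := (@lebesgue_measure R).

Lemma continuous_itv_integrable f (a b : R) :
  (forall t : R, a <= t <= b -> f x @[x --> t] --> f t) ->
  mu.-integrable `[a, b] (EFin \o f).
Proof.
move=> h; apply: continuous_compact_integrable; first exact: segment_compact.
exact: within_itv_cvg.
Qed.

Lemma cvg_lam_comp (T : Type) (F : set_system T) (f : T -> R) g (a b : R) :
  f x @[x --> F] --> a -> g y @[y --> a] --> b -> g (f x) @[x --> F] --> b.
Proof. by move=> hf hg; apply: cvg_comp hf hg. Qed.

(** Composition with [clamp a b] extends a function on [a, b] by constants to the whole line, so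
    that continuity at the ends needs no one-sided version. *)
Definition clamp (a b x : R) := Num.min (Num.max x a) b.

Lemma clamp_cvg (a b t : R) : clamp a b x @[x --> t] --> clamp a b t.
Proof.
rewrite /clamp minr_absE maxr_absE.
under [X in X @ _]eq_fun do rewrite minr_absE maxr_absE.
have h : (x + a + `|x - a|) / 2 @[x --> t] --> (t + a + `|t - a|) / 2.
  apply: cvgM; last exact: cvg_cst.
  apply: cvgD; first by apply: cvgD; [exact: cvg_id|exact: cvg_cst].
  by apply: cvg_norm; apply: cvgB; [exact: cvg_id|exact: cvg_cst].
apply: cvgM; last exact: cvg_cst.
apply: cvgB; first by apply: cvgD; [exact: h|exact: cvg_cst].
by apply: cvg_norm; apply: cvgB; [exact: h|exact: cvg_cst].
Qed.

Lemma clamp_itv (a b x : R) : a <= b -> a <= clamp a b x <= b.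
Proof.
by move=> ab; rewrite /clamp le_min le_max lexx orbT ab /= ge_min lexx orbT.
Qed.

Lemma clamp_id (a b x : R) : a <= x <= b -> clamp a b x = x.
Proof. by case/andP => ax xb; rewrite /clamp (max_idPl ax) (min_idPl xb). Qed.

Lemma clamp_le (a b x : R) : a <= b -> x <= a -> clamp a b x = a.
Proof. by move=> ab xa; rewrite /clamp (max_idPr xa) (min_idPl ab). Qed.

Lemma clamp_ge (a b x : R) : a <= b -> b <= x -> clamp a b x = b.
Proof.
by move=> ab bx; rewrite /clamp (max_idPl (le_trans ab bx)) (min_idPr bx).
Qed.

(** The left end of the domain of integration moves with [t], so that one formula covers the whole
    line; subtracting the integral up to 0 from the same left end removes the dependence on it. *)
Lemma primitive_exists f : (forall t : R, f x @[x --> t] --> f t) ->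
  exists F : R -> R, forall t : R, is_derive t 1 F (f t).
Proof.
move=> fc.
have fi (a b : R) : mu.-integrable `[a, b] (EFin \o f).
  by apply: continuous_itv_integrable.
pose G N t : R := \int[mu]_(x in `[- N, t]) f x.
have GE (N M t : R) : - N <= - M -> - M <= t ->
    \int[mu]_(x in `](- M), t]) f x = G N t - G N (- M).
  move=> NM Mt; rewrite /G (@Rintegral_itvB R f (BLeft (- N)) (BRight t) (- M)) //.
pose M (t : R) := `|t| + 1.
pose F t : R := \int[mu]_(x in `](- M t), t]) f x - \int[mu]_(x in `](- M t), 0]) f x.
have FE (N t : R) : M t <= N -> F t = G N t - G N 0.
  move=> tN; rewrite /F !(GE N) ?lerN2//; first by ring.
    by rewrite oppr_le0 addr_ge0.
  by rewrite lerNl /M; have := ler_norm (- t); rewrite normrN; lra.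
exists F => t.
apply: (@near_is_derive _ (fun s => G (M t + 1) s - G (M t + 1) 0)).
  have : \forall s \near t, `|t - s| < 1 by exact: (nbhsx_ballx t (1 : R) ltr01).
  apply: filterS => s hs; rewrite -FE // /M.
  have := ler_distD t s 0; rewrite !subr0 (distrC s); move: (ltW hs); lra.
have tb : - (M t + 1) < t by rewrite ltrNl /M; have := ler_norm (- t); rewrite normrN; lra.
have [||dG eG] := @continuous_FTC1 R f (BLeft (- (M t + 1))) t (t + 1) _ (fi _ _) _ (fc t).
- by rewrite ltrDl.
- by [].
have dG' : is_derive t 1 (G (M t + 1)) (f t).
  by split; [exact: dG|rewrite -derive1E; exact: eG].
by deriv; rewrite addr0.
Qed.

Lemma integral_primitive f (F : R -> R) (a b : R) : a <= b ->
  (forall t : R, f x @[x --> t] --> f t) -> (forall t : R, is_derive t 1 F (f t)) ->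
  (\int[mu]_(x in `[a, b]) (f x)%:E)%E = (F b - F a)%:E.
Proof.
move=> ab fc Fd; have Fc t : F x @[x --> t] --> F t by exact: is_derive_cvg.
move: ab; rewrite le_eqVlt => /predU1P[<-|ab].
  by rewrite set_itv1 integral_set1 subrr.
rewrite (@continuous_FTC2 R f F a b ab) //.
- by apply: within_itv_cvg.
- split; first by move=> x _; have [] := Fd x.
    by apply: cvg_at_right_filter.
  by apply: cvg_at_left_filter.
- by move=> x _; rewrite derive1E; have [] := Fd x.
Qed.

Lemma is_derive_le f g (df dg : R -> R) (a b : R) : a <= b ->
  {within `[a, b], continuous f} -> {within `[a, b], continuous g} ->
  (forall t : R, a < t < b -> is_derive t 1 f (df t)) ->
  (forall t : R, a < t < b -> is_derive t 1 g (dg t)) ->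
  (forall t : R, a < t < b -> df t <= dg t) -> f b - f a <= g b - g a.
Proof.
move=> ab fc gc fd gd d0.
have gf : g a - f a <= g b - f b.
  apply: (@is_derive_ge0_le R (fun t => g t - f t) (fun t => dg t - df t)) => //.
  - move=> x; apply: cvgB; [exact: gc|exact: fc].
  - by move=> t /[dup] /fd ? /gd ?; deriv.
  - by move=> t /d0; rewrite subr_ge0.
lra.
Qed.

(** The integrand is controlled only inside the interval and may blow up at its ends, whereas [S] is
    continuous up to them. The bound is proved on compact subintervals and passes to their union by
    monotone convergence. *)
Lemma integral_le_primitive (a S dS : R -> R) :
  (forall t : R, 0 < t < 1 -> a x @[x --> t] --> a t) ->
  (forall t : R, 0 < t < 1 -> 0 <= a t) ->
  {within `[0, 1], continuous S} ->
  (forall t : R, 0 < t < 1 -> is_derive t 1 S (dS t)) ->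
  (forall t : R, 0 < t < 1 -> a t <= dS t) ->
  (\int[mu]_(x in `]0%R, 1%R[) (a x)%:E <= (S 1 - S 0)%:E)%E.
Proof.
move=> ac a0 Sc Sd aS.
have dS0 (t : R) : 0 < t < 1 -> 0 <= dS t by move=> ht; apply: le_trans (aS _ ht); exact: a0.
have Sh (s t : R) : 0 <= s -> s <= t -> t <= 1 -> S s <= S t.
  move=> s0 st t1; apply: (@is_derive_ge0_le R S dS) => //.
  - by apply: continuous_subspaceW Sc; apply: subset_itv; rewrite bnd_simp.
  - by move=> x hx; apply: Sd; lra.
  - by move=> x hx; apply: dS0; lra.
(* The shift by 3 makes even the first interval nondegenerate, since 1/3 < 1 - 1/3. *)
pose D (n : nat) : set R := `[n.+3%:R^-1, 1 - n.+3%:R^-1]%classic.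
have n3 (n : nat) : 0 < (n.+3%:R^-1 : R) <= 3^-1.
  by rewrite invr_gt0 ltr0n lef_pV2 ?posrE ?ltr0n// ler_nat.
have DU : \bigcup_n D n = `]0%R, 1%R[%classic.
  apply/seteqP; split => [x [n _]|x]; rewrite /D /= !in_itv /=.
    by move=> hx; move: (n3 n) hx; move: (n.+3%:R^-1) => y; lra.
  move=> /andP[x0 x1].
  have m0 : 0 < Num.min x (1 - x) by rewrite lt_min x0 subr_gt0.
  have im0 : 0 <= (Num.min x (1 - x))^-1 by rewrite invr_ge0 ltW.
  pose n := Num.Def.archi_bound (Num.min x (1 - x))^-1.
  have : n.+3%:R^-1 < Num.min x (1 - x).
    rewrite -[ltRHS]invrK ltf_pV2 ?posrE ?invr_gt0 ?ltr0n//.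
    by apply: lt_le_trans (archi_boundP im0) _; rewrite ler_nat -addn3 leq_addr.
  rewrite lt_min => /andP[h1 h2]; exists n => //=.
  by rewrite /D /= in_itv /=; move: (n.+3%:R^-1) h1 h2 => y; lra.
have am : measurable_fun (`]0%R, 1%R[%classic : set R) a.
  apply: open_continuous_measurable_fun; first exact: interval_open.
  by move=> x /set_mem /=; rewrite in_itv => /ac.
have hlim : (\int[mu]_(x in D n) (a x)%:E)%E @[n --> \oo] -->
    (\int[mu]_(x in \bigcup_n D n) (a x)%:E)%E.
  apply: ge0_nondecreasing_set_cvg_integral => [n m nm|n|n|n x].
  - apply/subsetPset; apply: subset_itv; rewrite bnd_simp ?lerB//.
      by rewrite lef_pV2 ?posrE ?ltr0n// ler_nat !ltnS.
    by rewrite lef_pV2 ?posrE ?ltr0n// ler_nat !ltnS.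
  - exact: measurable_itv.
  - apply/measurable_EFinP; apply: measurable_funS am => //.
    by rewrite -DU; exact: bigcup_sup.
  - rewrite /D /= in_itv /= lee_fin => hx; apply: a0; move: (n3 n) hx; move: (n.+3%:R^-1) => y; lra.
rewrite -DU -(cvg_lim _ hlim) //; apply: lime_le; first by apply/cvg_ex; eexists; exact: hlim.
apply: nearW => n.
have [h1 h2] : 0 < (n.+3%:R^-1 : R) /\ n.+3%:R^-1 < 1 - (n.+3%:R^-1 : R).
  by move: (n3 n); move: (n.+3%:R^-1) => y; lra.
rewrite /D; move: (n.+3%:R^-1) h1 h2 => s s0 s1.
(* Extending [a] by constants outside the compact interval makes it continuous everywhere, hence
   gives it a primitive. *)
pose c := clamp s (1 - s).
have cc (t : R) : (a \o c) x @[x --> t] --> (a \o c) t.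
  suff ha : a x @[x --> c t] --> a (c t).
    exact: (cvg_lam_comp (@clamp_cvg s (1 - s) t) ha).
  by apply: ac; have := clamp_itv t (ltW s1); rewrite -/c; lra.
have [F Fd] := primitive_exists cc.
have -> : (\int[mu]_(x in `[s, (1 - s)%R]) (a x)%:E)%E = (F (1 - s) - F s)%:E.
  rewrite -(integral_primitive (ltW s1) cc Fd); apply: eq_integral => x.
  rewrite inE /= in_itv /= => /andP[sx xs].
  by rewrite /c /= clamp_id // sx.
have Fm : F (1 - s) - F s <= S (1 - s) - S s.
  apply: (@is_derive_le F S (a \o c) dS _ _ (ltW s1)).
  - by apply: within_itv_cvg => t _; exact: is_derive_cvg.
  - by apply: continuous_subspaceW Sc; apply: subset_itv; rewrite bnd_simp; lra.
  - by move=> t ht; apply: Sd; lra.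
  - by move=> t ht; rewrite /c /= clamp_id; [apply: aS|]; lra.
rewrite lee_fin; apply: le_trans Fm _; apply: lerB; apply: Sh; lra.
Qed.

End Primitives.

(** * The logarithmic mean *)

Section ExponentialMoments.
Context {R : realType}.
Implicit Types r : R.
Local Notation mu := (@lebesgue_measure R).
Local Notation "'I' f" := (\int[mu]_(x in `[0, 1]) f x) (at level 10, f at level 8).

Let I_primitive (f F : R -> R) : (forall t : R, f x @[x --> t] --> f t) ->
  (forall t : R, is_derive t 1 F (f t)) -> I f = F 1 - F 0.
Proof.
by move=> fc Fd; rewrite /Rintegral (integral_primitive ler01 fc Fd).
Qed.

Let leI (f g : R -> R) : (forall t : R, f x @[x --> t] --> f t) ->
  (forall t : R, g x @[x --> t] --> g t) ->
  (forall t, 0 <= t <= 1 -> f t <= g t) -> I f <= I g.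
Proof.
move=> fc gc fg; apply: le_Rintegral => //.
- by apply: continuous_itv_integrable => t _; exact: fc.
- by apply: continuous_itv_integrable => t _; exact: gc.
Qed.

Let ID (f g : R -> R) : (forall t : R, f x @[x --> t] --> f t) ->
  (forall t : R, g x @[x --> t] --> g t) ->
  I (fun x => f x + g x) = I f + I g.
Proof.
move=> fc gc; apply: RintegralD => //.
- by apply: continuous_itv_integrable => t _; exact: fc.
- by apply: continuous_itv_integrable => t _; exact: gc.
Qed.

Let IZ (c : R) (f : R -> R) : (forall t : R, f x @[x --> t] --> f t) ->
  I (fun x => c * f x) = c * I f.
Proof.
move=> fc; apply: RintegralZl => //.
by apply: continuous_itv_integrable => t _; exact: fc.
Qed.

(** The logarithmic mean of e^r and 1. As [theta] is homogeneous of degree one, it reduces to this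
    function of one variable; [expm1] is its derivative. *)
Definition expm r := I (fun x => expR (x * r)).
Definition expm1 r := I (fun x => x * expR (x * r)).

Let e0c r (t : R) : expR (x * r) @[x --> t] --> expR (t * r).
Proof.
by apply: (@is_derive_cvg _ (fun x => expR (x * r))); deriv.
Qed.

Let e1c r (t : R) : x * expR (x * r) @[x --> t] --> t * expR (t * r).
Proof. by apply: cvgM; [exact: cvg_id|exact: e0c]. Qed.

Lemma expmE r : r * expm r = expR r - 1.
Proof.
have Fd (t : R) : is_derive t 1 (fun x => expR (x * r)) (r * expR (t * r)).
  by deriv; ring.
have fc (t : R) : r * expR (x * r) @[x --> t] --> r * expR (t * r).
  by apply: cvgM; [exact: cvg_cst|exact: e0c].
rewrite /expm -IZ; last exact: e0c.
by rewrite (I_primitive fc Fd) mul1r mul0r expR0.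
Qed.

Lemma expm1E r : r * expm1 r = expR r - expm r.
Proof.
have Fd (t : R) : is_derive t 1 (fun x => x * expR (x * r))
    (r * (t * expR (t * r)) + expR (t * r)) by deriv; ring.
have gc (t : R) : r * (x * expR (x * r)) @[x --> t] --> r * (t * expR (t * r)).
  by apply: cvgM; [exact: cvg_cst|exact: e1c].
have fc (t : R) : r * (x * expR (x * r)) + expR (x * r) @[x --> t] -->
    r * (t * expR (t * r)) + expR (t * r) by apply: cvgD; [exact: gc|exact: e0c].
apply/eqP; rewrite eq_sym subr_eq eq_sym; apply/eqP.
rewrite /expm1 -IZ; last exact: e1c.
rewrite -ID; [|exact: gc|exact: e0c].
by rewrite (I_primitive fc Fd) mul1r mul0r subr0 mul1r.
Qed.

Lemma expm_0 : expm 0 = 1.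
Proof.
have Fd (t : R) : is_derive t 1 (fun x => x) (expR (t * 0)).
  by deriv; rewrite mulr0 expR0.
by rewrite /expm (I_primitive (@e0c 0) Fd) subr0.
Qed.

Lemma expm1_0 : expm1 0 = 2^-1.
Proof.
have Fd (t : R) : is_derive t 1 (fun x => 2^-1 * (x * x)) (t * expR (t * 0)).
  by deriv; rewrite mulr0 expR0; field.
by rewrite /expm1 (I_primitive (@e1c 0) Fd) !mulr1 mul0r mulr0 subr0.
Qed.

Lemma expm_ge_tangent r r' : expm r + expm1 r * (r' - r) <= expm r'.
Proof.
rewrite mulrC /expm1 -IZ; last exact: e1c.
rewrite -ID; [|exact: e0c|by move=> t; apply: cvgM; [exact: cvg_cst|exact: e1c]].
apply: leI; [|exact: e0c|].
  by move=> t; apply: cvgD; [exact: e0c|apply: cvgM; [exact: cvg_cst|exact: e1c]].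
move=> t _; have -> : t * r' = t * r + t * (r' - r) by ring.
rewrite expRD; have := expR_ge1Dx (t * (r' - r)); have := expR_gt0 (t * r).
move: (expR _) (expR _) => a b; nra.
Qed.

(** Integrates e^(t y) <= t e^y + 1 - t. In the variable e^r it says that [expm] lies below its
    tangent line, which is the concavity of the logarithmic mean. *)
Lemma expm_le_tangent r r' : expm r' <= expm1 r * expR (r' - r) + (expm r - expm1 r).
Proof.
have -> : expm1 r * expR (r' - r) + (expm r - expm1 r) =
    expm r + (expR (r' - r) - 1) * expm1 r by ring.
rewrite /expm1 -IZ; last exact: e1c.
rewrite -ID; [|exact: e0c|by move=> t; apply: cvgM; [exact: cvg_cst|exact: e1c]].
apply: leI; [exact: e0c| |].
  by move=> t; apply: cvgD; [exact: e0c|apply: cvgM; [exact: cvg_cst|exact: e1c]].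
move=> t t01; have -> : t * r' = t * r + t * (r' - r) by ring.
have h : expR (t * (r' - r)) <= t * expR (r' - r) + (1 - t).
  move: (r' - r) => x.
  (* Convexity of the exponential: its tangent at t x is evaluated at x and at 0, and the two
     inequalities are added with weights t and 1 - t. *)
  have h1 : expR (t * x) * (1 + (1 - t) * x) <= expR x.
    have {3}-> : x = t * x + (1 - t) * x by ring.
    by rewrite expRD ler_wpM2l ?expR_ge0// expR_ge1Dx.
  have h0 : expR (t * x) * (1 - t * x) <= 1.
    rewrite -[leRHS](expRxMexpNx_1 (t * x)) ler_wpM2l ?expR_ge0//.
    exact: expR_ge1Dx.
  move: t01 h1 h0; move: (expR (t * x)) (expR x) => a b /andP[t0 t1] h1 h0.
  have := ler_wpM2l t0 h1; have := ler_wpM2l (_ : 0 <= 1 - t) h0.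
  by rewrite subr_ge0 => /(_ t1); lra.
rewrite [expR (t * r + _)]expRD; have := ler_wpM2l (expR_ge0 (t * r)) h.
move: (expR (t * r)) (expR (t * (r' - r))) (expR (r' - r)) => a b c h'; lra.
Qed.

Lemma is_derive_expm r : is_derive r 1 expm (expm1 r).
Proof.
pose lo (s : R) := expm r + expm1 r * (s - r).
pose up (s : R) := expm1 r * expR (s - r) + (expm r - expm1 r).
have dlo : is_derive r 1 lo (expm1 r) by rewrite /lo; deriv; ring.
have dup : is_derive r 1 up (expm1 r) by rewrite /up; deriv; rewrite subrr expR0; ring.
have tangents t : lo t <= expm t <= up t by rewrite expm_ge_tangent expm_le_tangent.
have touch : lo r = up r by rewrite /lo /up subrr expR0; ring.
exact: (is_derive_squeeze dlo dup tangents touch).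
Qed.

Lemma expm1_ge0 r : 0 <= expm1 r.
Proof.
apply: fine_ge0; apply: integral_ge0 => t; rewrite /= in_itv /= => /andP[t0 _].
by rewrite lee_fin mulr_ge0 ?expR_ge0.
Qed.

(** This is the substitution x -> 1 - x, that is, the symmetry of the logarithmic mean. For nonzero
    r both sides multiplied by r^2 equal e^r - 1 - r. *)
Lemma expm1N r : expR r * expm1 (- r) = expm r - expm1 r.
Proof.
have [->|r0] := eqVneq r 0; first by rewrite oppr0 expR0 expm_0 expm1_0; field.
have ee : expR r * expR (- r) = 1 := expRxMexpNx_1 r.
have e1 := expm1E r; have e1' := expm1E (- r); have e0 := expmE r; have e0' := expmE (- r).
apply: (mulfI r0); apply: (mulfI r0).
move: (expR r) (expR (- r)) (expm r) (expm (- r)) (expm1 r) (expm1 (- r)) ee e1 e1' e0 e0'.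
move=> a b X X' Y Y' ee e1 e1' e0 e0'.
transitivity (a - 1 - r).
  have k1 : r * a * (- r * Y') = r * a * (b - X') by rewrite e1'.
  have k2 : a * (- r * X') = a * b - a by rewrite e0'; ring.
  have k3 : r * (a * b) = r by rewrite ee mulr1.
  by lra.
have k1 : r * (r * X) = r * (a - 1) by rewrite e0.
have k2 : r * (r * Y) = r * (a - X) by rewrite e1.
by lra.
Qed.

Lemma expm_sqr r : expm1 r + expR r * (expm r - expm1 r) = expm r ^+ 2.
Proof.
have [->|r0] := eqVneq r 0; first by rewrite expR0 expm_0; ring.
apply: (mulfI r0).
have e1 := expm1E r; have e0 := expmE r.
have -> : r * (expm1 r + expR r * (expm r - expm1 r)) =
  r * expm1 r + expR r * (r * expm r - r * expm1 r) by ring.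
have -> : r * expm r ^+ 2 = (r * expm r) * expm r by ring.
by rewrite e1 e0; ring.
Qed.

(** Jensen's inequality: the tangent of the exponential at r / 2 has a linear part that integrates
    to 0 over [0, 1]. It says that the geometric mean is at most the logarithmic mean. *)
Lemma expm_ge_half r : expR r <= expm r ^+ 2.
Proof.
have h : expR (r / 2) <= expm r.
  pose f x := expR (r / 2) * (1 + r * (x - 2^-1)).
  have fc (t : R) : f x @[x --> t] --> f t.
    by apply: (@is_derive_cvg _ f); rewrite /f; deriv.
  have Fd (t : R) : is_derive t 1
      (fun x => expR (r / 2) * (x + r * (2^-1 * (x * x) - 2^-1 * x))) (f t).
    by rewrite /f; deriv; field.
  have <- : I f = expR (r / 2) by rewrite (I_primitive fc Fd); field.
  apply: leI => // t _.
  rewrite /f; have -> : t * r = r / 2 + r * (t - 2^-1) by field.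
  by rewrite expRD ler_wpM2l ?expR_ge0 // expR_ge1Dx.
have {1}-> : r = r / 2 + r / 2 by field.
by rewrite expRD -expr2 lerXn2r // nnegrE ?expR_ge0 // (le_trans _ h) ?expR_ge0.
Qed.

End ExponentialMoments.

Section LogarithmicMean.
Context {R : realType}.
Implicit Types a b s t : R.

(** The partial derivative of [theta] in its first argument; by symmetry [theta1 b a] is the one in
    the second argument. *)
Definition theta1 a b : R := expm1 (ln a - ln b) * b / a.

Lemma theta_expm a b : 0 < a -> 0 < b -> theta a b = b * expm (ln a - ln b).
Proof.
move=> a0 b0; rewrite /theta /expm -RintegralZl //; last first.
  apply: continuous_itv_integrable => t _.
  by apply: (@is_derive_cvg _ (fun x => expR (x * (ln a - ln b)))); deriv.
apply: eq_Rintegral => x _; rewrite /powR !gt_eqF // -expRD.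
have -> : x * ln a + (1 - x) * ln b = ln b + x * (ln a - ln b) by ring.
by rewrite expRD lnK.
Qed.

Lemma measurable_theta_integrand s t (D : set R) : measurable_fun D
  (fun a => (s `^ a * t `^ (1 - a))%:E).
Proof.
apply/measurable_EFinP; apply: measurable_funTS; apply: measurable_funM.
  exact: measurable_powRr.
apply: measurableT_comp; first exact: measurable_powRr.
by apply: measurable_funB.
Qed.

Lemma theta0l t : theta 0 t = 0.
Proof.
rewrite /theta /Rintegral -integral_itv_obnd_cbnd; last exact: measurable_theta_integrand.
rewrite (eq_integral (fun=> 0%E)) ?integral0 // => x.
rewrite inE /= in_itv /= => /andP[x0 _].
by rewrite powR0 ?gt_eqF // mul0r.
Qed.

Lemma theta0r t : theta t 0 = 0.
Proof.
rewrite /theta /Rintegral -integral_itv_bndo_bndc; last exact: measurable_theta_integrand.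
rewrite (eq_integral (fun=> 0%E)) ?integral0 // => x.
rewrite inE /= in_itv /= => /andP[_ x1].
by rewrite powR0 ?mulr0 // subr_eq0 gt_eqF.
Qed.

Lemma theta_mul_ln a b : 0 < a -> 0 < b -> theta a b * (ln a - ln b) = a - b.
Proof.
move=> a0 b0; rewrite theta_expm // mulrAC -mulrA expmE expRD expRN !lnK // mulrBr.
by field; rewrite gt_eqF.
Qed.

Lemma theta1_sym a b : 0 < a -> 0 < b ->
  theta1 b a = expm (ln a - ln b) - expm1 (ln a - ln b).
Proof.
move=> a0 b0; rewrite -expm1N opprB /theta1 expRD expRN !lnK //.
by ring.
Qed.

(** Euler's identity for a function homogeneous of degree one. *)
Lemma thetaE a b : 0 < a -> 0 < b -> theta a b = theta1 a b * a + theta1 b a * b.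
Proof.
move=> a0 b0; rewrite (theta1_sym a0 b0) theta_expm // /theta1.
by field; rewrite gt_eqF.
Qed.

Lemma theta_sym s t : 0 <= s -> 0 <= t -> theta s t = theta t s.
Proof.
rewrite le_eqVlt => /predU1P[<-|s0]; first by rewrite theta0l theta0r.
rewrite le_eqVlt => /predU1P[<-|t0]; first by rewrite theta0l theta0r.
by rewrite !thetaE // addrC.
Qed.

Lemma theta_ge0 s t : 0 <= theta s t.
Proof.
by apply: fine_ge0; apply: integral_ge0 => x _; rewrite lee_fin mulr_ge0 ?powR_ge0.
Qed.

Lemma theta1_ge0 a b : 0 <= a -> 0 <= b -> 0 <= theta1 a b.
Proof. by move=> a0 b0; rewrite /theta1 divr_ge0 // mulr_ge0 // expm1_ge0. Qed.

Lemma theta_sqr_ge a b : 0 < a -> 0 < b -> a * b <= theta a b ^+ 2.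
Proof.
move=> a0 b0; have := expm_ge_half (ln a - ln b).
rewrite theta_expm // expRD expRN !lnK // exprMn => h.
have := ler_wpM2l (sqr_ge0 b) h.
by have -> : b ^+ 2 * (a / b) = a * b by field; rewrite gt_eqF.
Qed.

Lemma theta_gt0 a b : 0 < a -> 0 < b -> 0 < theta a b.
Proof.
move=> a0 b0; rewrite lt_neqAle theta_ge0 andbT eq_sym; apply/negP => /eqP h.
by have := theta_sqr_ge a0 b0; rewrite h expr0n /= leNgt mulr_gt0.
Qed.

(** Differentiating (a - b) / (ln a - ln b) in both arguments, the terms 1 / (ln a - ln b) cancel
    and (a - b)^2 / (a b (ln a - ln b)^2) remains. *)
Lemma theta1_add a b : 0 < a -> 0 < b ->
  (theta1 a b + theta1 b a) * (a * b) = theta a b ^+ 2.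
Proof.
move=> a0 b0; rewrite (theta1_sym a0 b0) theta_expm // /theta1 exprMn -expm_sqr.
rewrite expRD expRN !lnK //.
by field; rewrite !gt_eqF.
Qed.

(** Concavity: by Euler's identity the tangent plane at (a, b) has no constant term. The arguments s
    and t may vanish, which makes the bound usable at densities with zeros. *)
Lemma theta_le_tangent a b s t : 0 < a -> 0 < b -> 0 <= s -> 0 <= t ->
  theta s t <= theta1 a b * s + theta1 b a * t.
Proof.
move=> a0 b0; rewrite le_eqVlt => /predU1P[<-|s0] t0.
  by rewrite theta0l mulr0 add0r mulr_ge0 // theta1_ge0 // ltW.
move: t0; rewrite le_eqVlt => /predU1P[<-|t0].
  by rewrite theta0r mulr0 addr0 mulr_ge0 // ?theta1_ge0 // ltW.
rewrite theta_expm // (theta1_sym a0 b0) /theta1.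
have := ler_wpM2l (ltW t0) (expm_le_tangent (ln a - ln b) (ln s - ln t)).
have -> : ln s - ln t - (ln a - ln b) = ln s + (- ln t) + (- ln a + ln b) by ring.
rewrite !expRD !expRN !lnK // => /le_trans; apply; rewrite le_eqVlt; apply/orP; left.
by apply/eqP; field; rewrite !gt_eqF.
Qed.

Lemma is_derive_theta (f g : R -> R) (x df dg : R) : 0 < f x -> 0 < g x ->
  is_derive x 1 f df -> is_derive x 1 g dg ->
  is_derive x 1 (fun t => theta (f t) (g t))
    (theta1 (f x) (g x) * df + theta1 (g x) (f x) * dg).
Proof.
move=> fx gx fd gd.
apply: (@near_is_derive _ (fun t => g t * expm (ln (f t) - ln (g t)))).
  have hf := is_derive_cvg fd; have hg := is_derive_cvg gd.
  have : \forall t \near x, 0 < f t by exact: (cvgr_gt _ hf _ fx).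
  have : \forall t \near x, 0 < g t by exact: (cvgr_gt _ hg _ gx).
  by apply: filterS2 => t h1 h2; rewrite theta_expm.
have hc : is_derive x 1 (fun t => expm (ln (f t) - ln (g t)))
    (expm1 (ln (f x) - ln (g x)) * ((f x)^-1 * df - (g x)^-1 * dg)).
  apply: is_derive_lam_comp; first exact: is_derive_expm.
  by deriv.
by deriv; rewrite (theta1_sym fx gx) /theta1; field; rewrite !gt_eqF.
Qed.

(** Gives the continuity of [theta] on the axis s = 0: the slope in t can be made arbitrarily small
    at the price of a large slope in s. *)
Lemma theta_le_linear (e : R) : 0 < e ->
  exists2 K : R, 0 <= K & forall s t, 0 <= s -> 0 <= t -> theta s t <= K * s + e * t.
Proof.
move=> e0; pose M := expR e^-1; have M0 : 0 < M := expR_gt0 _.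
(* The bound is the tangent plane at (1, M). Since ln M = 1 / e, the value at (M, 1) is (M - 1) e,
   and Euler's identity bounds the slope [theta1 M 1] by e. *)
exists (theta1 1 M) => [|s t s0 t0]; first by rewrite theta1_ge0 // ltW.
apply: le_trans (theta_le_tangent ltr01 M0 s0 t0) _.
rewrite lerD2l ler_wpM2r //.
have h := theta_mul_ln M0 ltr01; rewrite ln1 subr0 expRK in h.
have : theta M 1 = (M - 1) * e by rewrite -h; field; rewrite gt_eqF.
rewrite thetaE // mulr1 => h2.
have := theta1_ge0 ler01 (ltW M0); move: h2.
move: (theta1 M 1) (theta1 1 M) => p q h2 q0.
rewrite -(ler_pM2r M0); nra.
Qed.

Lemma theta_cvg (T : Type) (F : set_system T) (FF : Filter F) (f g : T -> R) a b :
  f x @[x --> F] --> a -> g x @[x --> F] --> b ->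
  (forall x, 0 <= f x) -> (forall x, 0 <= g x) -> 0 <= a -> 0 <= b ->
  theta (f x) (g x) @[x --> F] --> theta a b.
Proof.
wlog : f g a b / (a == 0) || (b != 0).
  move=> h fa gb f0 g0 a0 b0.
  case: (boolP ((a == 0) || (b != 0))) => ab; first exact: h.
  rewrite theta_sym //.
  under [X in X @ _]eq_fun do rewrite theta_sym //.
  by apply: h => //; move: ab; rewrite negb_or negbK => /andP[_ ->].
move=> ab fa gb f0 g0 a0 b0.
have [a00|an0] := eqVneq a 0.
  rewrite a00 theta0l in fa *; apply/cvgr0Pnorm_lt => e e0.
  have e20 : 0 < e / (2 * (b + 1)) by rewrite divr_gt0 // mulr_gt0 //; lra.
  have [K K0 hK] := theta_le_linear e20.
  have Kf : K * f x @[x --> F] --> K * 0 by apply: cvgM => //; exact: cvg_cst.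
  rewrite mulr0 in Kf.
  have h1 : \forall x \near F, K * f x < e / 2 by apply: (cvgr_lt _ Kf); rewrite divr_gt0.
  have h2 : \forall x \near F, g x < b + 1 by apply: (cvgr_lt _ gb); rewrite ltrDl.
  apply: filterS2 h1 h2 => x h1 h2; rewrite ger0_norm ?theta_ge0 //.
  apply: le_lt_trans (hK _ _ (f0 x) (g0 x)) _.
  have : e / (2 * (b + 1)) * g x <= e / (2 * (b + 1)) * (b + 1).
    by rewrite ler_wpM2l // ltW.
  have -> : e / (2 * (b + 1)) * (b + 1) = e / 2 by field; lra.
  by move: h1; lra.
have {}a0 : 0 < a by rewrite lt_neqAle eq_sym an0.
have {}b0 : 0 < b by move: ab; rewrite (negbTE an0) /= lt_neqAle eq_sym b0 andbT.
rewrite theta_expm //.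
have : g x * expm (ln (f x) - ln (g x)) @[x --> F] --> b * expm (ln a - ln b).
  apply: cvgM => //; apply: cvg_lam_comp; last by apply: is_derive_cvg; exact: is_derive_expm.
  apply: cvgB; apply: cvg_lam_comp; [exact: fa| |exact: gb|].
    by apply: is_derive_cvg; exact: is_derive1_ln.
  by apply: is_derive_cvg; exact: is_derive1_ln.
apply: cvg_trans; apply: near_eq_cvg.
have h1 : \forall x \near F, 0 < f x by exact: (cvgr_gt _ fa _ a0).
have h2 : \forall x \near F, 0 < g x by exact: (cvgr_gt _ gb _ b0).
by apply: filterS2 h1 h2 => x h1 h2; rewrite theta_expm.
Qed.

End LogarithmicMean.

#[global] Opaque theta theta1 expm expm1.

(** * The heat semigroup of a finite Markov chain *)

Section ExponentialGeneratingFunction.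
Context {R : realType}.
Implicit Types (b : nat -> R) (t : R).

(** Entries of a matrix exponential are handled as scalar exponential generating functions, for
    which differentiation is the shift of the coefficient sequence. *)
Definition egf_coef b : nat -> R := fun k => b k / k`!%:R.

Definition egf b t : R := limn (pseries (egf_coef b) t).

Definition geometric_bound b := exists B l : R,
  [/\ 0 <= B, 0 <= l & forall k, `|b k| <= B * l ^+ k].

Lemma geometric_bound_shift b : geometric_bound b -> geometric_bound (fun k => b k.+1).
Proof.
move=> [B [l [B0 l0 h]]]; exists (B * l), l; split => //; first exact: mulr_ge0.
by move=> k; apply: le_trans (h _) _; rewrite exprS mulrA.
Qed.

Lemma cvg_egf b t : geometric_bound b -> cvgn (pseries (egf_coef b) t).
Proof.
move=> [B [l [B0 l0 h]]]; apply: normed_cvg.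
apply: (@series_le_cvg _ _ (B *: exp_coeff (l * `|t|))).
- by move=> k; rewrite normr_ge0.
- move=> k; rewrite /exp_coeff; apply: mulr_ge0 => //.
  by rewrite divr_ge0 // exprn_ge0 // mulr_ge0.
- move=> k; rewrite [leRHS](_ : _ = B * l ^+ k * (`|t| ^+ k / k`!%:R)).
    rewrite /egf_coef /= -mulrA [k`!%:R^-1 * _]mulrC normrM ler_pM //.
    by rewrite normrM normrX normfV normr_nat.
  transitivity (B * ((l * `|t|) ^+ k / k`!%:R)); first by [].
  by rewrite exprMn; ring.
- by apply: is_cvg_seriesZ; exact: is_cvg_series_exp_coeff.
Qed.

Lemma pseries_diffs_egf b : pseries_diffs (egf_coef b) = egf_coef (fun k => b k.+1).
Proof.
apply/funext => k; rewrite /pseries_diffs /egf_coef factS natrM.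
by field; rewrite nat1r !pnatr_eq0 -lt0n fact_gt0.
Qed.

Lemma is_derive_egf b t : geometric_bound b ->
  is_derive t 1 (egf b) (egf (fun k => b k.+1) t).
Proof.
move=> h; have h1 := geometric_bound_shift h; have h2 := geometric_bound_shift h1.
rewrite /egf -pseries_diffs_egf; apply: (@pseries_snd_diffs _ _ (`|t| + 1)).
- exact: cvg_egf.
- by rewrite pseries_diffs_egf; exact: cvg_egf.
- by rewrite !pseries_diffs_egf; exact: cvg_egf.
- by rewrite [X in _ < X]ger0_norm ?ltrDl // addr_ge0.
Qed.

Lemma egf_sum (I : finType) (m : I -> R) (b : I -> nat -> R) t :
  (forall i, geometric_bound (b i)) ->
  egf (fun k => \sum_i m i * b i k) t = \sum_i m i * egf (b i) t.
Proof.
move=> h; apply: cvg_lim => //.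
have -> : pseries (egf_coef (fun k => \sum_i m i * b i k)) t =
    (fun n => \sum_i m i * pseries (egf_coef (b i)) t n).
  apply/funext => n; rewrite /pseries /series /=.
  under [RHS]eq_bigr do rewrite big_distrr /=.
  rewrite exchange_big /=; apply: eq_bigr => k _.
  rewrite /egf_coef !big_distrl /=; apply: eq_bigr => i _; ring.
apply: (@cvg_big _ _ _ _ _ add_continuous) => // i _.
by apply: cvgM; [exact: cvg_cst|exact: cvg_egf].
Qed.

Lemma egf_ge b t : geometric_bound b -> (forall k, 0 <= b k) -> 0 <= t -> b 0 <= egf b t.
Proof.
move=> h b0 t0.
have -> : b 0 = pseries (egf_coef b) t 1.
  by rewrite /pseries /series /= big_nat1 /egf_coef expr0 fact0 mulr1 divr1.
apply: nondecreasing_cvgn_le; last exact: cvg_egf.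
apply/nondecreasing_seqP => n; rewrite /pseries /series /= big_nat_recr //= lerDl.
by rewrite mulr_ge0 ?exprn_ge0 // /egf_coef divr_ge0.
Qed.

Lemma egf0 b : egf b 0 = b 0.
Proof.
apply: cvg_lim => //; apply: cvg_near_cst; near=> n.
rewrite -(@prednK n); last by near: n; exact: nbhs_infty_gt.
rewrite /pseries /series /= big_nat_recl //= expr0 mulr1.
rewrite /egf_coef fact0 divr1 big1_seq ?addr0 // => k _.
by rewrite exprS mul0r mulr0.
Unshelve. all: by end_near. Qed.

End ExponentialGeneratingFunction.

Section HeatKernel.
Context {R : realType} {X : finType}.
Variable Q : X -> X -> R.
Hypothesis Q_ge0 : forall x y, 0 <= Q x y.
Implicit Types (f : X -> R) (t : R).

Definition laplacian f x : R := \sum_y Q x y * (f y - f x).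

(** Uniformization: the generator plus [l] times the identity is the matrix [M], which has
    nonnegative entries and row sums [l]. The factor e^(-l t) then undoes the shift, and positivity
    of the kernel is visible term by term. *)
Let l : R := \sum_x \sum_z Q x z.

Let M x y : R := Q x y + (x == y)%:R * (l - \sum_z Q x z).

Let M_ge0 x y : 0 <= M x y.
Proof.
rewrite /M addr_ge0 // mulr_ge0 // subr_ge0 /l [leRHS](bigD1 x) //= lerDl.
by apply: sumr_ge0 => z _; exact: sumr_ge0.
Qed.

Let sumM f x : \sum_y M x y * f y = laplacian f x + l * f x.
Proof.
rewrite /laplacian /M.
transitivity (\sum_y Q x y * f y + \sum_y (x == y)%:R * ((l - \sum_z Q x z) * f y)).
  by rewrite -big_split; apply: eq_bigr => y _ /=; ring.
have -> : \sum_y (x == y)%:R * ((l - \sum_z Q x z) * f y) = (l - \sum_z Q x z) * f x.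
  move: (l - _) => c; rewrite (bigD1 x) //= eqxx mul1r big1 ?addr0 // => y /negbTE.
  by rewrite eq_sym => ->; rewrite mul0r.
under [in RHS]eq_bigr do rewrite mulrBr.
by rewrite sumrB -big_distrl /=; ring.
Qed.

Fixpoint markov_iter k y x : R :=
  if k is k'.+1 then \sum_z M x z * markov_iter k' y z else (x == y)%:R.

Let markov_iter_ge0 k y x : 0 <= markov_iter k y x.
Proof.
elim: k x => [x|k ih x] /=; first exact: ler0n.
by apply: sumr_ge0 => z _; rewrite mulr_ge0.
Qed.

Let markov_iter_bound y x : geometric_bound (fun k => markov_iter k y x).
Proof.
have l0 : 0 <= l by apply: sumr_ge0 => z _; exact: sumr_ge0.
exists 1, l; split => // k; rewrite mul1r ger0_norm //.
elim: k x => [x|k ih x] /=; first by rewrite expr0 lern1; case: (x == y).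
apply: (@le_trans _ _ (\sum_z M x z * l ^+ k)).
  by apply: ler_sum => z _; rewrite ler_wpM2l.
rewrite (sumM (fun=> l ^+ k)) exprS [laplacian _ _]big1 ?add0r // => z _.
by rewrite subrr mulr0.
Qed.

Definition heat_kernel t x y : R := expR (- l * t) * egf (fun k => markov_iter k y x) t.

Lemma heat_kernel0 x y : heat_kernel 0 x y = (x == y)%:R.
Proof. by rewrite /heat_kernel mulr0 expR0 mul1r egf0. Qed.

Lemma heat_kernel_ge0 t x y : 0 <= t -> 0 <= heat_kernel t x y.
Proof.
move=> t0; rewrite mulr_ge0 ?expR_ge0 //.
by apply: le_trans (egf_ge _ _ t0) => //; exact: markov_iter_ge0 0%N _ _.
Qed.

Lemma heat_kernel_diag_gt0 t x : 0 <= t -> 0 < heat_kernel t x x.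
Proof.
move=> t0; rewrite mulr_gt0 ?expR_gt0 //.
by apply: lt_le_trans (egf_ge _ _ t0) => //; rewrite /= eqxx.
Qed.

Lemma is_derive_heat_kernel t x y :
  is_derive t 1 (fun s => heat_kernel s x y) (laplacian (heat_kernel t ^~ y) x).
Proof.
have d := is_derive_egf t (markov_iter_bound y x).
rewrite /heat_kernel; deriv; last first.
  rewrite /= egf_sum; last by move=> z; exact: markov_iter_bound.
  rewrite (sumM (fun z => egf (fun k => markov_iter k y z) t)) /laplacian.
  set S := \sum_y0 _.
  have -> : \sum_y0 Q x y0 * (expR (- l * t) * egf (fun k => markov_iter k y y0) t -
     expR (- l * t) * egf (fun k => markov_iter k y x) t) = expR (- l * t) * S.
    by rewrite /S big_distrr; apply: eq_bigr => z _ /=; ring.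
  by ring.
Qed.

End HeatKernel.

#[global] Opaque heat_kernel.

(** * The Dirichlet form and its dual norm *)

Section Dirichlet.
Context {R : realType} {X : finType}.
Variables (Q : X -> X -> R) (pi : X -> R).
Hypothesis Q_ge0 : forall x y, 0 <= Q x y.
Hypothesis pi_gt0 : forall x, 0 < pi x.
Hypothesis Q_rev : forall x y, Q x y * pi x = Q y x * pi y.
Implicit Types (rho mu psi phi v f : X -> R) (b c h : R).

Definition pairing v phi : R := \sum_x v x * phi x * pi x.

Definition dirichlet rho psi phi : R :=
  2^-1 * \sum_x \sum_y (psi x - psi y) * (phi x - phi y)
    * theta (rho x) (rho y) * Q x y * pi x.

(* [dual_le rho v b] says that the squared norm of v dual to [dirichlet rho] is
   at most b. *)
Definition dual_le rho v b : Prop :=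
  forall phi, 2 * pairing v phi - dirichlet rho phi phi <= b.

Lemma sum_symmetrize (a : X -> X -> R) :
  \sum_x \sum_y a x y = 2^-1 * \sum_x \sum_y (a x y + a y x).
Proof.
have -> : \sum_x \sum_y (a x y + a y x) = \sum_x \sum_y a x y + \sum_x \sum_y a x y.
  under eq_bigr do rewrite big_split /=.
  by rewrite big_split /=; congr (_ + _); exact: exchange_big.
by field.
Qed.

Lemma pairingDl v w phi : pairing (fun x => v x + w x) phi = pairing v phi + pairing w phi.
Proof. by rewrite /pairing -big_split; apply: eq_bigr => x _ /=; ring. Qed.

Lemma pairingZl c v phi : pairing (fun x => c * v x) phi = c * pairing v phi.
Proof. by rewrite /pairing big_distrr; apply: eq_bigr => x _ /=; ring. Qed.

Lemma pairingDr v phi psi :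
  pairing v (fun x => phi x + psi x) = pairing v phi + pairing v psi.
Proof. by rewrite /pairing -big_split; apply: eq_bigr => x _ /=; ring. Qed.

Lemma pairingZr c v phi : pairing v (fun x => c * phi x) = c * pairing v phi.
Proof. by rewrite /pairing big_distrr; apply: eq_bigr => x _ /=; ring. Qed.

Lemma pairing_flux rho psi phi : (forall x, 0 <= rho x) ->
  pairing (fun x => \sum_y (psi x - psi y) * theta (rho x) (rho y) * Q x y) phi =
  dirichlet rho psi phi.
Proof.
move=> rho0; rewrite /pairing /dirichlet.
under eq_bigr do rewrite !big_distrl /=.
rewrite sum_symmetrize; congr (_ * _).
apply: eq_bigr => x _; apply: eq_bigr => y _.
rewrite (theta_sym (rho0 y) (rho0 x)).
have -> : (psi y - psi x) * theta (rho x) (rho y) * Q y x * phi y * pi y =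
  (psi y - psi x) * theta (rho x) (rho y) * phi y * (Q y x * pi y) by ring.
by rewrite -Q_rev; ring.
Qed.

(** Since theta(a, b) (ln a - ln b) = a - b, the Laplacian of mu is minus the flux of ln mu: the
    heat flow is the gradient flow of the entropy. *)
Lemma pairing_laplacian mu phi : (forall x, 0 < mu x) ->
  pairing (laplacian Q mu) phi = - dirichlet mu (fun x => ln (mu x)) phi.
Proof.
move=> mu0; rewrite -pairing_flux; last by move=> x; exact: ltW.
rewrite -mulN1r -pairingZl; apply: eq_bigr => x _; congr (_ * _ * _).
rewrite big_distrr; apply: eq_bigr => y _ /=.
by rewrite [(ln _ - _) * _]mulrC theta_mul_ln //; ring.
Qed.

Lemma dirichletC rho psi phi : dirichlet rho psi phi = dirichlet rho phi psi.
Proof.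
congr (_ * _); apply: eq_bigr => x _; apply: eq_bigr => y _.
by rewrite [(psi x - _) * _]mulrC.
Qed.

Lemma dirichletDl rho psi psi' phi : dirichlet rho (fun x => psi x + psi' x) phi =
  dirichlet rho psi phi + dirichlet rho psi' phi.
Proof.
rewrite /dirichlet -mulrDr -big_split; congr (_ * _); apply: eq_bigr => x _ /=.
by rewrite -big_split; apply: eq_bigr => y _ /=; ring.
Qed.

Lemma dirichletZl rho c psi phi :
  dirichlet rho (fun x => c * psi x) phi = c * dirichlet rho psi phi.
Proof.
rewrite /dirichlet mulrCA; congr (_ * _); rewrite big_distrr; apply: eq_bigr => x _ /=.
by rewrite big_distrr; apply: eq_bigr => y _ /=; ring.
Qed.

Lemma dirichletDr rho psi phi phi' : dirichlet rho psi (fun x => phi x + phi' x) =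
  dirichlet rho psi phi + dirichlet rho psi phi'.
Proof. by rewrite !(dirichletC _ psi) dirichletDl. Qed.

Lemma dirichletZr rho c psi phi :
  dirichlet rho psi (fun x => c * phi x) = c * dirichlet rho psi phi.
Proof. by rewrite !(dirichletC _ psi) dirichletZl. Qed.

Lemma dirichlet_ge0 rho phi : 0 <= dirichlet rho phi phi.
Proof.
rewrite mulr_ge0 // sumr_ge0 // => x _; rewrite sumr_ge0 // => y _.
rewrite -!mulrA mulrA -expr2; apply: mulr_ge0; first exact: sqr_ge0.
by rewrite !mulr_ge0 ?theta_ge0 // ltW.
Qed.

(** Both components are compared with the tangent plane of [theta] at the mixture, so only the
    mixture has to be positive. *)
Lemma dirichlet_concave mu rho0 rho1 c phi : (forall x, 0 < mu x) ->
  (forall x, 0 <= rho0 x) -> (forall x, 0 <= rho1 x) -> 0 <= c <= 1 ->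
  (forall x, mu x = (1 - c) * rho0 x + c * rho1 x) ->
  (1 - c) * dirichlet rho0 phi phi + c * dirichlet rho1 phi phi <= dirichlet mu phi phi.
Proof.
move=> mu0 h0 h1 /andP[c0 c1] muE.
rewrite /dirichlet mulrCA [c * _]mulrCA -mulrDr ler_wpM2l //.
rewrite !big_distrr -big_split; apply: ler_sum => x _ /=.
rewrite !big_distrr -big_split; apply: ler_sum => y _ /=.
suff : (phi x - phi y) ^+ 2 * (Q x y * pi x) *
    ((1 - c) * theta (rho0 x) (rho0 y) + c * theta (rho1 x) (rho1 y)) <=
    (phi x - phi y) ^+ 2 * (Q x y * pi x) * theta (mu x) (mu y).
  move: (theta (rho0 x) _) (theta (rho1 x) _) (theta (mu x) _).
  by move: (phi x - phi y) (Q x y) (pi x) => u q r t0 t1 t2; clear; lra.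
apply: ler_wpM2l; first by apply: mulr_ge0; [exact: sqr_ge0|rewrite mulr_ge0 // ltW].
rewrite (thetaE (mu0 x) (mu0 y)) {2}muE {3}(muE y).
have k0 := theta_le_tangent (mu0 x) (mu0 y) (h0 x) (h0 y).
have k1 := theta_le_tangent (mu0 x) (mu0 y) (h1 x) (h1 y).
have c1' : 0 <= 1 - c by rewrite subr_ge0.
apply: (le_trans (lerD (ler_wpM2l c1' k0) (ler_wpM2l c0 k1))).
by rewrite le_eqVlt; apply/orP; left; apply/eqP; ring.
Qed.

Lemma dual_le_mono rho v b b' : b <= b' -> dual_le rho v b -> dual_le rho v b'.
Proof. by move=> bb h phi; exact: le_trans (h phi) bb. Qed.

Lemma dual_le_ge0 rho v b : dual_le rho v b -> 0 <= b.
Proof.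
move=> /(_ (fun=> 0)); rewrite /pairing big1; last by move=> x _; rewrite mulr0 mul0r.
rewrite /dirichlet big1 ?mulr0 ?subr0 // => x _.
by rewrite big1 // => y _; rewrite /= ?subrr !mul0r.
Qed.

Lemma dual_leZ rho v b c : dual_le rho v b -> dual_le rho (fun x => c * v x) (c ^+ 2 * b).
Proof.
move=> h phi; have [->|c0] := eqVneq c 0.
  rewrite pairingZl mul0r mulr0 expr2 !mul0r sub0r oppr_le0; exact: dirichlet_ge0.
have := h (fun x => c^-1 * phi x).
rewrite pairingZr dirichletZl dirichletZr pairingZl => /(ler_wpM2l (sqr_ge0 c)).
apply: le_trans; rewrite le_eqVlt; apply/orP; left; apply/eqP.
by field.
Qed.

Lemma dual_le_mass rho v b : dual_le rho v b -> \sum_x v x * pi x = 0.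
Proof.
move=> h; set m := \sum_x _; apply/eqP/negP => /negP m0.
(* Constants have zero energy; this one would give the left-hand side the value b + 1. *)
have := h (fun=> (b + 1) / (2 * m)).
have -> : pairing v (fun=> (b + 1) / (2 * m)) = (b + 1) / (2 * m) * m.
  move: (_ / _) => K; by rewrite /m /pairing big_distrr; apply: eq_bigr => x _ /=; ring.
rewrite /dirichlet big1 ?mulr0 ?subr0; last first.
  by move=> x _; rewrite big1 // => y _; rewrite /= ?subrr !mul0r.
have -> : 2 * ((b + 1) / (2 * m) * m) = b + 1 by field.
lra.
Qed.

(** Joint convexity of the squared dual norm in density and velocity, dual to the concavity of
    [dirichlet]. It bounds the cost of mixing a degenerate density with a positive one. *)
Lemma dual_le_mix mu rho0 rho1 v v0 v1 b0 b1 c : (forall x, 0 < mu x) ->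
  (forall x, 0 <= rho0 x) -> (forall x, 0 <= rho1 x) -> 0 <= c <= 1 ->
  (forall x, mu x = (1 - c) * rho0 x + c * rho1 x) ->
  (forall x, v x = (1 - c) * v0 x + c * v1 x) ->
  dual_le rho0 v0 b0 -> dual_le rho1 v1 b1 -> dual_le mu v ((1 - c) * b0 + c * b1).
Proof.
move=> mu0 h0 h1 c01 muE vE n0 n1 phi.
have := dirichlet_concave phi mu0 h0 h1 c01 muE.
have -> : pairing v phi = (1 - c) * pairing v0 phi + c * pairing v1 phi.
  rewrite -!pairingZl -pairingDl; apply: eq_bigr => x _; congr (_ * _ * _); exact: vE.
case/andP: c01 => c0 c1; have c1' : 0 <= 1 - c by rewrite subr_ge0.
have := ler_wpM2l c1' (n0 phi); have := ler_wpM2l c0 (n1 phi).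
move: (pairing v0 phi) (pairing v1 phi) (dirichlet rho0 phi phi) (dirichlet rho1 phi phi).
by move: (dirichlet mu phi phi) => d a0 a1 d0 d1; clear; lra.
Qed.

(* The test function phi + h ln mu absorbs the drift h * laplacian mu. *)
Lemma dual_le_flow mu v w b h : (forall x, 0 < mu x) ->
  (forall x, w x = v x + h * laplacian Q mu x) ->
  dual_le mu v b -> dual_le mu w (b - 2 * h * pairing w (fun x => ln (mu x))).
Proof.
move=> mu0 wE n phi; set l := fun x => ln (mu x).
have wP f : pairing w f = pairing v f - h * dirichlet mu l f.
  rewrite -mulrN -pairing_laplacian // -pairingZl -pairingDl.
  by apply: eq_bigr => x _; rewrite wE.
have := n (fun x => phi x + h * l x); rewrite !wP.
rewrite pairingDr pairingZr dirichletDl !dirichletDr !dirichletZl !dirichletZr.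
rewrite (dirichletC mu phi l).
have := mulr_ge0 (sqr_ge0 h) (dirichlet_ge0 mu l).
rewrite expr2; lra.
Qed.

End Dirichlet.

(** * The heat semigroup and its gradient estimate *)

Section GradientEstimate.
Context {R : realType} {X : finType}.
Variables (Q : X -> X -> R) (pi : X -> R).
Hypothesis Q_ge0 : forall x y, 0 <= Q x y.
Hypothesis pi_gt0 : forall x, 0 < pi x.
Hypothesis Q_rev : forall x y, Q x y * pi x = Q y x * pi y.
Implicit Types (rho psi phi v f g : X -> R) (t : R).

Local Notation "'<<' f , g '>>'" := (pairing pi f g).
Local Notation D := (dirichlet Q pi).

Definition heat t f x : R := \sum_y heat_kernel Q t x y * f y.

Lemma heat0 f : heat 0 f = f.
Proof.
apply/funext => x; rewrite /heat (bigD1 x) //= heat_kernel0 eqxx mul1r big1 ?addr0 //.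
by move=> y; rewrite heat_kernel0 eq_sym => /negbTE ->; rewrite mul0r.
Qed.

Lemma heat_ge0 t f x : 0 <= t -> (forall x, 0 <= f x) -> 0 <= heat t f x.
Proof. by move=> t0 f0; apply: sumr_ge0 => y _; rewrite mulr_ge0 // heat_kernel_ge0. Qed.

Lemma heat_gt0 t f x : 0 <= t -> (forall x, 0 < f x) -> 0 < heat t f x.
Proof.
move=> t0 f0; rewrite /heat (bigD1 x) //= ltr_pwDl //.
  by rewrite mulr_gt0 // heat_kernel_diag_gt0.
by apply: sumr_ge0 => y _; rewrite mulr_ge0 ?heat_kernel_ge0 // ltW.
Qed.

Lemma laplacian_sum (I : finType) (a : I -> R) (u : I -> X -> R) x :
  laplacian Q (fun z => \sum_i u i z * a i) x = \sum_i laplacian Q (u i) x * a i.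
Proof.
rewrite /laplacian; under [RHS]eq_bigr do rewrite big_distrl /=.
rewrite exchange_big; apply: eq_bigr => y _ /=.
by rewrite -sumrB big_distrr; apply: eq_bigr => i _ /=; ring.
Qed.

Lemma is_derive_heat t f x :
  is_derive t 1 (fun s => heat s f x) (laplacian Q (heat t f) x).
Proof.
have d s y z := is_derive_heat_kernel Q_ge0 s y z.
rewrite (@laplacian_sum X f (fun y z => heat_kernel Q t z y)).
apply: is_derive_lam_sum => y.
by deriv; ring.
Qed.

Lemma laplacian_sym f g : << laplacian Q f, g >> = << f, laplacian Q g >>.
Proof.
pose a u w := \sum_x \sum_y Q x y * (u y - u x) * w x * pi x.
have aE u w : a u w = - (2^-1 * \sum_x \sum_y Q x y * pi x * ((u y - u x) * (w y - w x))).
  rewrite /a sum_symmetrize -mulrN -sumrN; congr (_ * _); apply: eq_bigr => x _.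
  rewrite -sumrN; apply: eq_bigr => y _.
  have -> : Q y x * (u x - u y) * w y * pi y = (Q y x * pi y) * ((u x - u y) * w y) by ring.
  by rewrite -Q_rev; ring.
have -> : << laplacian Q f, g >> = a f g.
  by apply: eq_bigr => x _; rewrite /laplacian !big_distrl.
have -> : << f, laplacian Q g >> = a g f.
  apply: eq_bigr => x _; rewrite /laplacian big_distrr !big_distrl.
  by apply: eq_bigr => y _ /=; ring.
rewrite !aE; congr (- (_ * _)); apply: eq_bigr => x _; apply: eq_bigr => y _; ring.
Qed.

Lemma pairing_heat t f g : << heat t f, g >> = << f, heat t g >>.
Proof.
have E := @is_derive0_eq R (fun s => << heat s f, heat (t - s) g >>) t 0.
move: E; rewrite subrr subr0 !heat0; apply => s.
apply: (@is_derive_eq _ _ _ _ _ _ _ (<< laplacian Q (heat s f), heat (t - s) g >>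
   + << heat s f, fun x => - laplacian Q (heat (t - s) g) x >>)).
  rewrite /pairing -big_split; apply: is_derive_lam_sum => x.
  have d1 := is_derive_heat s f x.
  have d2 : is_derive s 1 (fun u => heat (t - u) g x) (- laplacian Q (heat (t - s) g) x).
    have d3 : is_derive s 1 (fun u => t - u) (-1) by deriv; rewrite add0r.
    by rewrite -mulrN1; exact: (is_derive_lam_comp (is_derive_heat _ _ _) d3).
  by deriv; ring.
rewrite (_ : (fun x => - _) = (fun x => -1 * laplacian Q (heat (t - s) g) x)); last first.
  by apply/funext => x; rewrite mulN1r.
by rewrite pairingZr laplacian_sym mulN1r subrr.
Qed.

Lemma heat_mass t f : \sum_x heat t f x * pi x = \sum_x f x * pi x.
Proof.
rewrite -[in RHS](heat0 f).
apply: (@is_derive0_eq R (fun s => \sum_x heat s f x * pi x)) => s.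
apply: (@is_derive_eq _ _ _ _ _ _ _ << laplacian Q (heat s f), fun=> 1 >>); last first.
  rewrite laplacian_sym /pairing big1 // => x _.
  by rewrite /laplacian big1 ?mulr0 ?mul0r // => y _; rewrite subrr mulr0.
apply: is_derive_lam_sum => x; have d1 := is_derive_heat s f x.
by deriv; ring.
Qed.

Lemma heat_density t f : 0 <= t -> density pi f -> density pi (heat t f).
Proof.
by move=> t0 [f0 f1]; split; [move=> x; exact: heat_ge0|rewrite heat_mass].
Qed.

(* Twice the right-hand side of Bochner's formula: the derivative of
   [dirichlet (heat u rho) (heat (t - u) psi) (heat (t - u) psi)] in u. *)
Definition bochner rho psi : R :=
  2^-1 * (\sum_x \sum_y (psi x - psi y) ^+ 2 *
    (theta1 (rho x) (rho y) * laplacian Q rho x + theta1 (rho y) (rho x) * laplacian Q rho y)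
     * Q x y * pi x)
  - 2 * D rho psi (laplacian Q psi).

Variable kappa : R.
Hypothesis bochner_ge : forall rho psi, (forall x, 0 < rho x) ->
  2 * kappa * D rho psi psi <= bochner rho psi.

Lemma is_derive_dirichlet (rho psi : R -> X -> R) (drho dpsi : X -> R) u :
  (forall x, 0 < rho u x) ->
  (forall x, is_derive u 1 (fun s => rho s x) (drho x)) ->
  (forall x, is_derive u 1 (fun s => psi s x) (dpsi x)) ->
  is_derive u 1 (fun s => D (rho s) (psi s) (psi s))
    (2^-1 * (\sum_x \sum_y (psi u x - psi u y) ^+ 2 *
      (theta1 (rho u x) (rho u y) * drho x + theta1 (rho u y) (rho u x) * drho y)
      * Q x y * pi x) + 2 * D (rho u) (psi u) dpsi).
Proof.
move=> rho0 drhoP dpsiP.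
have dth x y := is_derive_theta (rho0 x) (rho0 y) (drhoP x) (drhoP y).
have dl x y : is_derive u 1 (fun s => (psi s x - psi s y) * (psi s x - psi s y)
    * theta (rho s x) (rho s y) * Q x y * pi x)
   ((psi u x - psi u y) ^+ 2 * (theta1 (rho u x) (rho u y) * drho x
      + theta1 (rho u y) (rho u x) * drho y) * Q x y * pi x
    + 2 * ((psi u x - psi u y) * (dpsi x - dpsi y) * theta (rho u x) (rho u y) * Q x y * pi x)).
  have h1 := dpsiP x; have h2 := dpsiP y; have h3 := dth x y.
  by deriv; ring.
rewrite /dirichlet.
apply: (@is_derive_eq _ _ _ _ _ _ _ (2^-1 * \sum_x \sum_y
  ((psi u x - psi u y) ^+ 2 * (theta1 (rho u x) (rho u y) * drho x
      + theta1 (rho u y) (rho u x) * drho y) * Q x y * pi x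
    + 2 * ((psi u x - psi u y) * (dpsi x - dpsi y) * theta (rho u x) (rho u y) * Q x y * pi x)))).
  have ds : is_derive u 1 (fun s => \sum_x \sum_y (psi s x - psi s y) * (psi s x - psi s y)
    * theta (rho s x) (rho s y) * Q x y * pi x) _ :=
    is_derive_lam_sum _ _ (fun x => is_derive_lam_sum _ _ (fun y => dl x y)).
  by deriv; rewrite mul0r add0r.
rewrite mulrCA -mulrDr; congr (_ * _).
rewrite big_distrr -big_split; apply: eq_bigr => x _ /=.
by rewrite big_distrr -big_split.
Qed.

(** Interpolation between the two sides: the semigroup acts for time u on the density and for time t
    - u on the function, and the derivative in u of the weighted energy is nonnegative by Bochner's
    inequality. *)
Lemma gradient_estimate t rho psi : 0 <= t -> (forall x, 0 < rho x) ->
  D rho (heat t psi) (heat t psi) <= expR (- (2 * kappa * t)) * D (heat t rho) psi psi.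
Proof.
move=> t0 rho0.
pose F u := expR (- (2 * kappa * u)) * D (heat u rho) (heat (t - u) psi) (heat (t - u) psi).
have F0 : F 0 = D rho (heat t psi) (heat t psi).
  by rewrite /F subr0 mulr0 oppr0 expR0 mul1r heat0.
have Ft : F t = expR (- (2 * kappa * t)) * D (heat t rho) psi psi.
  by rewrite /F subrr heat0.
rewrite -F0 -Ft.
pose dD u := bochner (heat u rho) (heat (t - u) psi).
pose dF u := expR (- (2 * kappa * u)) *
  (dD u - 2 * kappa * D (heat u rho) (heat (t - u) psi) (heat (t - u) psi)).
have Fd (u : R) : 0 <= u -> is_derive u 1 F (dF u).
  move=> u0.
  have hD : is_derive u 1 (fun s => D (heat s rho) (heat (t - s) psi) (heat (t - s) psi)) (dD u).
    notypeclasses refine (is_derive_eq _ _).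
      apply: (@is_derive_dirichlet (fun s => heat s rho) (fun s => heat (t - s) psi)
        (laplacian Q (heat u rho)) (fun x => -1 * laplacian Q (heat (t - u) psi) x)).
      - by move=> x; exact: heat_gt0.
      - by move=> x; exact: is_derive_heat.
      - move=> x; have d3 : is_derive u 1 (fun s => t - s) (-1) by deriv; rewrite add0r.
        by rewrite mulrC; exact: (is_derive_lam_comp (is_derive_heat _ _ _) d3).
    by rewrite /dD /bochner dirichletZr; ring.
  by rewrite /F; deriv; rewrite /dF; ring.
have Fc : {within `[0, t], continuous F}.
  by apply: within_itv_cvg => u /andP[u0 _]; exact: is_derive_cvg (Fd u u0).
have Fd' u : 0 < u < t -> is_derive u 1 F (dF u) by case/andP => /ltW u0 _; exact: Fd.
have dF0 u : 0 < u < t -> 0 <= dF u.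
  case/andP => /ltW u0 _; rewrite mulr_ge0 ?expR_ge0 // subr_ge0.
  by apply: bochner_ge => x; exact: heat_gt0.
exact: (is_derive_ge0_le t0 Fc Fd' dF0).
Qed.

Lemma dual_le_heat t rho v b : 0 <= t -> (forall x, 0 < rho x) -> dual_le Q pi rho v b ->
  dual_le Q pi (heat t rho) (heat t v) (expR (- (2 * kappa * t)) * b).
Proof.
move=> t0 rho0 n phi; set c := expR _.
have g := gradient_estimate phi t0 rho0; rewrite -/c in g.
(* Scaling the velocity by [c] turns the bound b into c^2 b. The factor [c] of the gradient estimate
   then appears in every term, and dividing by it leaves c b. *)
have := dual_leZ Q_ge0 pi_gt0 c n; move=> /(_ (heat t phi)).
rewrite pairingZl -pairing_heat => h.
have c0 : 0 < c := expR_gt0 _.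
rewrite -(ler_pM2l c0).
move: g h; move: (D rho _ _) (D (heat t rho) _ _) (<< _, _ >>) => p q r g h.
nra.
Qed.

End GradientEstimate.

(** * Continuity of determinants and adjugates *)

Section MatrixLimits.
Context {R : realType} {T : Type} {F : set_system T} {FF : Filter F}.

Lemma eq_cvg_lam (f g : T -> R) (a b : R) : (forall t, f t = g t) -> a = b ->
  g t @[t --> F] --> b -> f t @[t --> F] --> a.
Proof. by move=> /funext -> ->. Qed.

Lemma cvg_lam_prod (I : finType) (f : I -> T -> R) (a : I -> R) :
  (forall i, f i t @[t --> F] --> a i) -> \prod_i f i t @[t --> F] --> \prod_i a i.
Proof. by move=> h; apply: (cvg_big mul_continuous) => i _; exact: h. Qed.

Lemma cvg_lam_sum (I : finType) (f : I -> T -> R) (a : I -> R) :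
  (forall i, f i t @[t --> F] --> a i) -> \sum_i f i t @[t --> F] --> \sum_i a i.
Proof. by move=> h; apply: (cvg_big add_continuous) => i _; exact: h. Qed.

Lemma cvg_det n (M : T -> 'M[R]_n) (A : 'M[R]_n) :
  (forall i j, M t i j @[t --> F] --> A i j) -> \det (M t) @[t --> F] --> \det A.
Proof.
move=> h; apply: cvg_lam_sum => s; apply: cvgM; first exact: cvg_cst.
by apply: cvg_lam_prod => i; exact: h.
Qed.

Lemma cvg_adj n (M : T -> 'M[R]_n) (A : 'M[R]_n) i j :
  (forall i j, M t i j @[t --> F] --> A i j) -> \adj (M t) i j @[t --> F] --> \adj A i j.
Proof.
move=> h; rewrite mxE; under [X in X @ _]eq_fun do rewrite mxE.
rewrite /cofactor; apply: cvgM; first exact: cvg_cst.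
apply: cvg_det => k l; rewrite !mxE; under [X in X @ _]eq_fun do rewrite !mxE.
exact: h.
Qed.

End MatrixLimits.

(** * The continuity equation at positive densities *)

Section Potential.
Context {R : realType} {X : finType}.
Variables (Q : X -> X -> R) (pi : X -> R).
Hypothesis Q_ge0 : forall x y, 0 <= Q x y.
Hypothesis pi_gt0 : forall x, 0 < pi x.
Hypothesis pi_sum : \sum_x pi x = 1.
Hypothesis Q_rev : forall x y, Q x y * pi x = Q y x * pi y.
Hypothesis Q_irr : forall phi : X -> R, (forall x y, 0 < Q x y -> phi x = phi y) ->
  forall x y, phi x = phi y.
Implicit Types (rho psi phi v : X -> R).

Local Notation D := (dirichlet Q pi).

Definition flux rho psi x : R := \sum_y (psi x - psi y) * theta (rho x) (rho y) * Q x y.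

Lemma flux_mass rho psi : (forall x, 0 <= rho x) -> \sum_x flux rho psi x * pi x = 0.
Proof.
move=> rho0; transitivity (pairing pi (flux rho psi) (fun=> 1)).
  by apply: eq_bigr => x _; rewrite mulr1.
rewrite (pairing_flux Q_rev) // /dirichlet big1 ?mulr0 // => x _.
by rewrite big1 // => y _; rewrite subrr mulr0 !mul0r.
Qed.

Lemma dirichlet_eq0 rho psi : (forall x, 0 < rho x) -> D rho psi psi = 0 ->
  forall x y, psi x = psi y.
Proof.
move=> rho0 /eqP; rewrite mulf_eq0 invr_eq0 (negbTE (_ : 2 != 0)) //=.
have t0 x y : 0 <= (psi x - psi y) * (psi x - psi y) * theta (rho x) (rho y) * Q x y * pi x.
  rewrite -!mulrA mulrA -expr2; apply: mulr_ge0; first exact: sqr_ge0.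
  by rewrite !mulr_ge0 ?theta_ge0 // ltW.
rewrite psumr_eq0; last by move=> x _; exact: sumr_ge0.
move=> /allP h; apply: Q_irr => x y q0; have := h x (mem_index_enum x).
rewrite /= psumr_eq0 // => /allP /(_ y (mem_index_enum y)) /=.
rewrite !mulf_eq0 (gt_eqF (pi_gt0 x)) (gt_eqF q0) (gt_eqF (theta_gt0 (rho0 x) (rho0 y))).
by rewrite !orbF orbb subr_eq0 => /eqP.
Qed.

(* The flux operator plus the rank-one map onto the mean, which makes it
   invertible. *)
Definition flux_coef rho x y : R :=
  (x == y)%:R * (\sum_z theta (rho x) (rho z) * Q x z)
  - theta (rho x) (rho y) * Q x y + pi y.

Definition flux_mx rho : 'M[R]_#|X| :=
  \matrix_(i, j) flux_coef rho (enum_val i) (enum_val j).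

Lemma flux_mx_coef rho i j : flux_mx rho i j = flux_coef rho (enum_val i) (enum_val j).
Proof. exact: mxE. Qed.
Lemma flux_mxE rho psi x : \sum_j flux_mx rho (enum_rank x) j * psi (enum_val j) =
  flux rho psi x + \sum_y psi y * pi y.
Proof.
transitivity (\sum_y ((x == y)%:R * (\sum_z theta (rho x) (rho z) * Q x z)
    - theta (rho x) (rho y) * Q x y + pi y) * psi y).
  rewrite [RHS](reindex (@enum_val X predT)) /=; last first.
    by apply: onW_bij; exact: enum_val_bij.
  by apply: eq_bigr => j _; rewrite flux_mx_coef enum_rankK.
pose s := \sum_z theta (rho x) (rho z) * Q x z; rewrite -/s.
transitivity (\sum_y (x == y)%:R * (s * psi y) -
    \sum_y theta (rho x) (rho y) * Q x y * psi y + \sum_y psi y * pi y).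
  rewrite -sumrB -big_split; apply: eq_bigr => y _ /=.
  by rewrite mulrDl mulrBl -(mulrA (x == y)%:R) [pi y * _]mulrC.
have -> : \sum_y (x == y)%:R * (s * psi y) = s * psi x.
  move: s => s; rewrite (bigD1 x) //= eqxx mul1r big1 ?addr0 // => y.
  by rewrite eq_sym => /negbTE ->; rewrite mul0r.
congr (_ + _); rewrite /s /flux big_distrl -sumrB; apply: eq_bigr => y _ /=; ring.
Qed.

(** A kernel vector has mean zero, because fluxes have no mass; its flux then vanishes, hence also
    its Dirichlet energy. By irreducibility it is constant, and a constant of mean zero is 0. *)
Lemma flux_mx_unit rho : (forall x, 0 < rho x) -> \det (flux_mx rho) != 0.
Proof.
move=> rho0; rewrite -unitfE -unitmxE -unitmx_tr -row_free_unit -kermx_eq0.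
apply/rowV0P => u /sub_kermxP uM.
have rho0' x : 0 <= rho x by exact: ltW.
pose psi x := u 0 (enum_rank x).
have e x : flux rho psi x + \sum_y psi y * pi y = 0.
  rewrite -flux_mxE.
  transitivity ((u *m (flux_mx rho)^T) 0 (enum_rank x)); last by rewrite uM mxE.
  by rewrite mxE; apply: eq_bigr => j _; rewrite [in RHS]mxE /psi enum_valK mulrC.
have m0 : \sum_y psi y * pi y = 0.
  have : \sum_x (flux rho psi x + \sum_y psi y * pi y) * pi x = 0.
    by rewrite big1 // => z _; rewrite e mul0r.
  under eq_bigr do rewrite mulrDl.
  by rewrite big_split /= flux_mass // add0r -big_distrr /= pi_sum mulr1.
have f0 x : flux rho psi x = 0 by have := e x; rewrite m0 addr0.
have psi_cst : forall x y, psi x = psi y.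
  apply: (dirichlet_eq0 rho0); rewrite -(pairing_flux Q_rev) //.
  by rewrite /pairing big1 // => z _; rewrite [X in X * _ * _](f0 z) !mul0r.
have psi0 x : psi x = 0.
  rewrite -m0 (eq_bigr (fun y => psi x * pi y)); last by move=> y _; rewrite (psi_cst x y).
  by rewrite -big_distrr /= pi_sum mulr1.
by apply/rowP => j; rewrite mxE -(enum_valK j) -/(psi _) psi0.
Qed.

(** Cramer's formula for the inverse matrix, from which continuity in the density is immediate. *)
Definition potential_kernel rho x y : R :=
  (\det (flux_mx rho))^-1 * \adj (flux_mx rho) (enum_rank x) (enum_rank y).

Definition potential rho v x : R := \sum_y potential_kernel rho x y * v y.

Lemma potentialP rho v x : (forall x, 0 < rho x) -> \sum_x v x * pi x = 0 ->
  flux rho (potential rho v) x = v x.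
Proof.
move=> rho0 v0.
have S z y : \sum_j flux_mx rho (enum_rank z) j * potential_kernel rho (enum_val j) y =
    (z == y)%:R.
  under eq_bigr do rewrite /potential_kernel enum_valK mulrCA.
  rewrite -big_distrr /=.
  have := congr1 (fun A : 'M[R]_(#|X|) => A (enum_rank z) (enum_rank y)) (mul_mx_adj (flux_mx rho)).
  rewrite !mxE (inj_eq enum_rank_inj) => ->.
  by rewrite mulrnAr mulVf // flux_mx_unit.
have e z : flux rho (potential rho v) z + \sum_y potential rho v y * pi y = v z.
  rewrite -flux_mxE /potential.
  transitivity (\sum_y (z == y)%:R * v y).
    under eq_bigr do rewrite big_distrr.
    rewrite exchange_big; apply: eq_bigr => y _; rewrite -S big_distrl.
    by apply: eq_bigr => j _; rewrite /= mulrA.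
  rewrite (bigD1 z) //= eqxx mul1r big1 ?addr0 // => y.
  by rewrite eq_sym => /negbTE ->; rewrite mul0r.
have rho0' z : 0 <= rho z by exact: ltW.
suff m0 : \sum_y potential rho v y * pi y = 0 by have := e x; rewrite m0 addr0.
have : \sum_x (flux rho (potential rho v) x + \sum_y potential rho v y * pi y) * pi x = 0.
  by rewrite -[RHS]v0; apply: eq_bigr => z _; rewrite e.
under eq_bigr do rewrite mulrDl.
by rewrite big_split /= flux_mass // add0r -big_distrr /= pi_sum mulr1.
Qed.

Lemma dual_le_potential rho v b : (forall x, 0 < rho x) -> dual_le Q pi rho v b ->
  D rho (potential rho v) (potential rho v) <= b.
Proof.
move=> rho0 n; have m0 := dual_le_mass n.
have := n (potential rho v); set psi := potential rho v.
have -> : pairing pi v psi = D rho psi psi.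
  rewrite -(pairing_flux Q_rev); last by move=> x; exact: ltW.
  by apply: eq_bigr => x _; rewrite -[in LHS](potentialP x rho0 m0).
by lra.
Qed.

Lemma cvg_potential (T : Type) (F : set_system T) (FF : Filter F)
    (rho : T -> X -> R) (v : T -> X -> R) rho0 v0 x :
  (forall t x, 0 <= rho t x) -> (forall x, 0 < rho0 x) ->
  (forall x, rho t x @[t --> F] --> rho0 x) -> (forall x, v t x @[t --> F] --> v0 x) ->
  potential (rho t) (v t) x @[t --> F] --> potential rho0 v0 x.
Proof.
move=> rho_ge0 rho0_gt0 rhoc vc.
have thc y z : theta (rho t y) (rho t z) @[t --> F] --> theta (rho0 y) (rho0 z).
  by apply: theta_cvg => //; exact: ltW.
have Mc i j : flux_mx (rho t) i j @[t --> F] --> flux_mx rho0 i j.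
  apply: (eq_cvg_lam (fun t => flux_mx_coef (rho t) i j) (flux_mx_coef rho0 i j)).
  rewrite /flux_coef; apply: cvgD; last exact: cvg_cst.
  apply: cvgB; last by apply: cvgM; [exact: thc|exact: cvg_cst].
  apply: cvgM; first exact: cvg_cst.
  by apply: cvg_lam_sum => z; apply: cvgM; [exact: thc|exact: cvg_cst].
apply: cvg_lam_sum => y; apply: cvgM => //; apply: cvgM; last exact: cvg_adj.
by apply: cvgV; [exact: flux_mx_unit|exact: cvg_det].
Qed.

(** At the constant density 1 the potential is a fixed linear function of the velocity, so the
    squared dual norm is at most a constant times the squared sup norm. *)
Lemma dual_le_uniform : exists2 K : R, 0 <= K & forall v B, \sum_x v x * pi x = 0 ->
  (forall x, `|v x| <= B) -> dual_le Q pi (fun=> 1) v (K * B ^+ 2).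
Proof.
pose K := \sum_x \sum_y `|potential_kernel (fun=> 1) x y| * pi x.
exists K => [|v B v0 vB phi].
  by apply: sumr_ge0 => x _; apply: sumr_ge0 => y _; rewrite mulr_ge0 // ltW.
have one0 (x : X) : 0 < (1 : R) by [].
have one0' (x : X) : 0 <= (1 : R) by [].
set psi := potential (fun=> 1) v.
have pE f : pairing pi v f = D (fun=> 1) psi f.
  rewrite -(pairing_flux Q_rev) //.
  by apply: eq_bigr => x _; rewrite -[in LHS](potentialP x one0 v0).
(* Completion of the square: the energy of phi - psi is nonnegative. *)
have h : 2 * pairing pi v phi - D (fun=> 1) phi phi <= pairing pi v psi.
  have := dirichlet_ge0 Q_ge0 pi_gt0 (fun=> 1) (fun x => phi x + -1 * psi x).
  rewrite dirichletDl !dirichletDr !dirichletZl !dirichletZr !pE.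
  by rewrite (dirichletC _ _ _ phi psi); clear one0 one0'; lra.
apply: le_trans h _; rewrite /K big_distrl /pairing; apply: ler_sum => x _ /=.
have -> : v x * psi x * pi x = \sum_y (potential_kernel (fun=> 1) x y * pi x) * (v x * v y).
  by rewrite /psi /potential big_distrr big_distrl; apply: eq_bigr => y _ /=; ring.
rewrite big_distrl; apply: ler_sum => y _ /=.
apply: le_trans (ler_norm _) _; rewrite normrM normrM (gtr0_norm (pi_gt0 x)) ler_wpM2l //.
  by rewrite mulr_ge0 // ltW.
by rewrite normrM expr2 ler_pM.
Qed.

End Potential.

(** * Curves and the transport distance *)

Section Curves.
Context {R : realType} {X : finType}.
Variables (Q : X -> X -> R) (pi : X -> R).
Hypothesis Q_ge0 : forall x y, 0 <= Q x y.
Hypothesis pi_gt0 : forall x, 0 < pi x.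
Hypothesis pi_sum : \sum_x pi x = 1.
Hypothesis Q_rev : forall x y, Q x y * pi x = Q y x * pi y.
Hypothesis Q_irr : forall phi : X -> R, (forall x y, 0 < Q x y -> phi x = phi y) ->
  forall x y, phi x = phi y.
Local Notation mu := (@lebesgue_measure R).

Lemma actionE (rho psi : R -> X -> R) :
  action Q pi rho psi = ((2^-1)%:E * \int[mu]_(t in `[0%R, 1%R])
    (2 * dirichlet Q pi (rho t) (psi t) (psi t))%:E)%E.
Proof.
congr (_ * _)%E; apply: eq_integral => t _; congr EFin.
by rewrite /dirichlet mulrA mulfV ?mul1r.
Qed.

Lemma action_ge0 (rho psi : R -> X -> R) : (0 <= action Q pi rho psi)%E.
Proof.
rewrite actionE mule_ge0 // integral_ge0 // => t _.
by rewrite lee_fin mulr_ge0 // dirichlet_ge0.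
Qed.

Lemma near_itv01 (t : R) : 0 < t < 1 -> \forall s \near t, 0 < s < 1.
Proof.
move=> t01; have : t \in `]0, 1[ by rewrite in_itv.
by move/near_in_itvoo; apply: filterS => s; rewrite in_itv.
Qed.

Lemma W_sqrE (r0 r1 : X -> R) : (W Q pi r0 r1 ^+ 2)%E =
  ereal_inf [set a | exists rho psi, admissible Q pi r0 r1 rho psi /\ a = action Q pi rho psi].
Proof.
rewrite /W sqr_sqrte //; apply: le_ereal_inf_tmp => _ [rho [psi [_ ->]]].
exact: action_ge0.
Qed.

(** The passage from dual bounds back to the distance: positivity inside the interval yields a
    potential, continuous there, whose energy is at most the dual bound [dS]. The end points may
    have zeros. *)
Lemma W_sqr_le_curve (r0 r1 : X -> R) (rho v : R -> X -> R) (S dS : R -> R) :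
  rho 0 = r0 -> rho 1 = r1 ->
  (forall t, 0 <= t <= 1 -> density pi (rho t)) ->
  (forall x, {within `[0, 1], continuous (rho^~ x)}) ->
  (forall (t : R) x, 0 < t < 1 -> is_derive t 1 (rho^~ x) (v t x)) ->
  (forall (t : R) x, 0 < t < 1 -> v s x @[s --> t] --> v t x) ->
  (forall t x, 0 < t < 1 -> 0 < rho t x) ->
  {within `[0, 1], continuous S} ->
  (forall t : R, 0 < t < 1 -> is_derive t 1 S (dS t)) ->
  (forall t, 0 < t < 1 -> dual_le Q pi (rho t) (v t) (dS t)) ->
  (W Q pi r0 r1 ^+ 2 <= (S 1 - S 0)%:E)%E.
Proof.
move=> rho0 rho1 rhod rhoc rhoD vc rho_gt0 Sc Sd n.
(* Continuity of the potential is stated for families that are nonnegative for every parameter,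
   whereas [rho] is a density only on [0, 1]. *)
pose c := clamp (0 : R) 1.
have c_near (t : R) : 0 < t < 1 -> \forall s \near t, c s = s.
  move=> /near_itv01; apply: filterS => s /andP[s0 s1].
  by rewrite /c clamp_id // !ltW.
pose psi t := potential Q pi (rho (c t)) (v t).
have psiE t : 0 < t < 1 -> psi t = potential Q pi (rho t) (v t).
  by case/andP => t0 t1; rewrite /psi /c clamp_id // !ltW.
have rhoc' (t : R) x : 0 < t < 1 -> rho (c s) x @[s --> t] --> rho t x.
  move=> t01; have h := is_derive_cvg (rhoD t x t01).
  apply: cvg_trans h; apply: near_eq_cvg.
  by apply: filterS (c_near t t01) => s ->.
have psic (t : R) x : 0 < t < 1 -> psi s x @[s --> t] --> psi t x.
  move=> t01; rewrite psiE //; apply: (cvg_potential Q_ge0 pi_gt0 pi_sum Q_rev Q_irr).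
  - by move=> s y; have [] := rhod (c s) (clamp_itv s ler01).
  - by move=> y; exact: rho_gt0.
  - by move=> y; exact: rhoc'.
  - by move=> y; exact: vc.
have adm : admissible Q pi r0 r1 rho psi.
  split => //.
  - move=> x; split => // t t01; first by have [] := rhoD t x t01.
    have dE s : 0 < s < 1 -> ((rho^~ x)^`())%classic s = v s x.
      by move=> s01; rewrite derive1E; have [] := rhoD s x s01.
    rewrite /prop_for /continuous_at [X in _ --> X](dE t t01); apply: cvg_trans (vc t x t01).
    by apply: near_eq_cvg; apply: filterS (near_itv01 t01) => s /dE.
  - move=> x; apply: (@measurable_fun_itv_cc R 0 1 false true).
    apply: open_continuous_measurable_fun; first exact: interval_open.
    by move=> t /set_mem; rewrite /= in_itv /= => t01; exact: psic.
  - move=> x t t01; have [_] := rhoD t x t01; rewrite derive1E => ->.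
    have m0 := dual_le_mass (n t t01).
    have := potentialP Q_ge0 pi_gt0 pi_sum Q_rev Q_irr x (fun y => rho_gt0 t y t01) m0.
    rewrite -psiE // /flux => e; rewrite -[X in X + _]e -big_split big1 // => y _ /=.
    ring.
rewrite W_sqrE; apply: (@le_trans _ _ (action Q pi rho psi)).
  by apply: ereal_inf_lbound; exists rho, psi.
pose a t := dirichlet Q pi (rho (c t)) (psi t) (psi t).
have cE t : 0 < t < 1 -> c t = t by case/andP => t0 t1; rewrite /c clamp_id // !ltW.
have ac (t : R) : 0 < t < 1 -> 2 * a s @[s --> t] --> 2 * a t.
  move=> t01; apply: cvgM; first exact: cvg_cst.
  apply: cvgM; first exact: cvg_cst.
  apply: cvg_lam_sum => x; apply: cvg_lam_sum => y.
  apply: cvgM; last exact: cvg_cst.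
  apply: cvgM; last exact: cvg_cst.
  apply: cvgM; last first.
    rewrite cE //; apply: theta_cvg => //; try exact: rhoc'.
    - by move=> s; have [] := rhod (c s) (clamp_itv s ler01).
    - by move=> s; have [] := rhod (c s) (clamp_itv s ler01).
    - by apply: ltW; exact: rho_gt0.
    - by apply: ltW; exact: rho_gt0.
  by apply: cvgM; apply: cvgB; exact: psic.
have am : measurable_fun (`]0%R, 1%R[%classic : set R) (fun t => 2 * a t).
  apply: open_continuous_measurable_fun; first exact: interval_open.
  by move=> t /set_mem; rewrite /= in_itv /= => t01; exact: ac.
rewrite actionE.
have aE t : (t \in `]0%R, 1%R[%classic) -> 2 * dirichlet Q pi (rho t) (psi t) (psi t) = 2 * a t.
  by rewrite inE /= in_itv /= => t01; rewrite /a cE.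
rewrite integral_itv_bndoo; last first.
  by apply/measurable_EFinP; apply: eq_measurable_fun am => t ht; exact/esym/(aE t ht).
have -> : (\int[mu]_(t in `]0%R, 1%R[) (2 * dirichlet Q pi (rho t) (psi t) (psi t))%:E =
    \int[mu]_(t in `]0%R, 1%R[) (2 * a t)%:E)%E.
  by apply: eq_integral => t ht; exact: (congr1 EFin (aE t ht)).
have : (\int[mu]_(t in `]0%R, 1%R[) (2 * a t)%:E <= (2 * S 1 - 2 * S 0)%:E)%E.
  have a0 t : 0 < t < 1 -> 0 <= 2 * a t by move=> _; rewrite mulr_ge0 // dirichlet_ge0.
  have S2c : {within `[0, 1], continuous (fun s => 2 * S s)}.
    by move=> t; apply: cvgM; [exact: cvg_cst|exact: Sc].
  have S2d (t : R) : 0 < t < 1 -> is_derive t 1 (fun s => 2 * S s) (2 * dS t).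
    by move=> t01; have h := Sd t t01; deriv; ring.
  have aS t : 0 < t < 1 -> 2 * a t <= 2 * dS t.
    move=> t01; rewrite ler_pM2l // /a cE // psiE //.
    apply: dual_le_potential => //; [by move=> x; exact: rho_gt0|exact: n].
  exact: (integral_le_primitive ac a0 S2c S2d aS).
have h2 : (0 <= (2^-1)%:E :> \bar R)%E by rewrite lee_fin.
move=> /(lee_wpmul2l h2) /le_trans; apply.
by rewrite -EFinM lee_fin le_eqVlt; apply/orP; left; apply/eqP; field.
Qed.

End Curves.

(** * Continuity and derivative of the entropy *)

Section Entropy.
Context {R : realType} {X : finType}.
Variable pi : X -> R.

(** At 0 the limit follows from |x ln x| <= 2 sqrt x for x < 1, which is ln y < y at y = 1 / sqrt
    x. *)
Lemma cvg_xlnx (T : Type) (F : set_system T) (FF : Filter F) (f : T -> R) (a : R) :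
  (forall t, 0 <= f t) -> 0 <= a -> f t @[t --> F] --> a ->
  f t * ln (f t) @[t --> F] --> a * ln a.
Proof.
move=> f0; rewrite le_eqVlt => /predU1P[<-|a0] fa; last first.
  apply: cvgM => //; apply: cvg_lam_comp fa _.
  by apply: is_derive_cvg; exact: is_derive1_ln.
rewrite mul0r; apply/norm_cvg0P.
have sq : 2 * Num.sqrt (f t) @[t --> F] --> 2 * Num.sqrt 0.
  by apply: cvgM; [exact: cvg_cst|apply: cvg_lam_comp fa _; exact: sqrt_continuous].
rewrite sqrtr0 mulr0 in sq; apply: squeeze_cvgr sq; last exact: cvg_cst.
have f1 : \forall t \near F, f t < 1 by apply: (cvgr_lt _ fa).
apply: filterS f1 => t f1; rewrite normr_ge0 /=.
have := f0 t; rewrite le_eqVlt => /predU1P[<-|ft0]; first by rewrite mul0r normr0 sqrtr0 mulr0.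
have s0 : 0 < Num.sqrt (f t) by rewrite sqrtr_gt0.
have e : f t = Num.sqrt (f t) ^+ 2 by rewrite sqr_sqrtr.
have := @ln_sublinear R (Num.sqrt (f t))^-1; rewrite invr_gt0 => /(_ s0).
rewrite lnV ?posrE // ler0_norm; last by rewrite mulr_ge0_le0 // ln_le0 // ltW.
have el : ln (f t) = 2 * ln (Num.sqrt (f t)) by rewrite [in LHS]e lnXn // mulr_natl.
move: s0 el e; move: (f t) (ln (f t)) (Num.sqrt (f t)) => r l s s0 -> -> h.
have h2 : - ln s * s < 1 by rewrite -(ltr_pdivlMr (- ln s) 1 s0) div1r.
by have := ler_wpM2l (ltW s0) (ltW h2); rewrite expr2; lra.
Qed.

Lemma cvg_entropy (T : Type) (F : set_system T) (FF : Filter F) (rho : T -> X -> R)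
    (r : X -> R) : (forall t x, 0 <= rho t x) -> (forall x, 0 <= r x) ->
  (forall x, rho t x @[t --> F] --> r x) -> entropy pi (rho t) @[t --> F] --> entropy pi r.
Proof.
move=> rho0 r0 h; apply: cvg_lam_sum => x.
rewrite -mulrA; under [X in X @ _]eq_fun do rewrite -mulrA.
by apply: cvgM; [exact: cvg_cst|exact: cvg_xlnx].
Qed.

(** The derivative of x ln x is ln x + 1, and the constant 1 drops out because the velocity has no
    mass. *)
Lemma is_derive_entropy (rho : R -> X -> R) (v : X -> R) (t : R) :
  (forall x, 0 < rho t x) -> (forall x, is_derive t 1 (rho^~ x) (v x)) ->
  \sum_x v x * pi x = 0 ->
  is_derive t 1 (fun s => entropy pi (rho s)) (pairing pi v (fun x => ln (rho t x))).
Proof.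
move=> rho0 d v0.
apply: (@is_derive_eq _ _ _ _ _ _ _ (\sum_x (v x * ln (rho t x) * pi x + v x * pi x))).
  apply: is_derive_lam_sum => x; have dx := d x.
  notypeclasses refine (is_derive_eq _ _).
    notypeclasses refine (is_derive_lamM _ (is_derive_lam_ln (rho0 x) dx)).
    by notypeclasses refine (is_derive_lamM (is_derive_lam_cst _ _) dx).
  by rewrite /=; field; rewrite gt_eqF.
by rewrite big_split /= v0 addr0.
Qed.

End Entropy.

(** * Evolution variational inequality *)

Lemma within_clamp {R : realType} (f : R -> R) (a b : R) :
  (forall t, f (clamp a b s) @[s --> t] --> f (clamp a b t)) -> {within `[a, b], continuous f}.
Proof.
move=> fc; apply: (@subspace_eq_continuous _ _ _ (fun t => f (clamp a b t))).
  by move=> t /set_mem; rewrite /= in_itv /= => tab; rewrite /= /from_subspace clamp_id.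
exact: continuous_subspaceT fc.
Qed.

Section EVI.
Context {R : realType} {X : finType}.
Variables (Q : X -> X -> R) (pi : X -> R).
Hypothesis Q_ge0 : forall x y, 0 <= Q x y.
Hypothesis pi_gt0 : forall x, 0 < pi x.
Hypothesis pi_sum : \sum_x pi x = 1.
Hypothesis Q_rev : forall x y, Q x y * pi x = Q y x * pi y.
Hypothesis Q_irr : forall phi : X -> R, (forall x y, 0 < Q x y -> phi x = phi y) ->
  forall x y, phi x = phi y.

(** Curves carry a bound [e] on the squared dual norm of the velocity, with primitive [S], in place
    of a potential, and their densities may vanish. They are C^1 on the whole line and constant
    outside [0, 1], so that concatenation needs no gluing condition. *)
Record energy_path (r0 r1 : X -> R) (rho v : R -> X -> R) (S e : R -> R) : Prop := {
  path_left : forall t, t <= 0 -> rho t = r0;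
  path_right : forall t, 1 <= t -> rho t = r1;
  path_density : forall t, density pi (rho t);
  path_derive : forall (t : R) x, is_derive t 1 (rho^~ x) (v t x);
  path_cont : forall (t : R) x, v s x @[s --> t] --> v t x;
  path_flat : forall t x, (t <= 0) || (1 <= t) -> v t x = 0;
  path_energy : forall t : R, is_derive t 1 S (e t);
  path_energy_left : forall t, t <= 0 -> S t = S 0;
  path_energy_right : forall t, 1 <= t -> S t = S 1;
  path_dual : forall t, dual_le Q pi (rho t) (v t) (e t) }.

(** A form of W(r0, r1)^2 <= C that supplies a curve regular enough for the heat flow to act on
    it. *)
Definition transportable (r0 r1 : X -> R) (C : R) : Prop :=
  exists rho v S e, energy_path r0 r1 rho v S e /\ S 1 - S 0 <= C.

Lemma density_le (r : X -> R) x : density pi r -> r x <= \sum_y (pi y)^-1.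
Proof.
move=> [r0 r1]; have : r x * pi x <= 1.
  by rewrite -r1 (bigD1 x) //= lerDl sumr_ge0 // => y _; rewrite mulr_ge0 // ltW.
rewrite -ler_pdivlMr // div1r => /le_trans; apply.
by rewrite (bigD1 x) //= lerDl sumr_ge0 // => y _; rewrite invr_ge0 ltW.
Qed.

Lemma dual_le_to_uniform : exists2 K : R, 0 <= K & forall r, density pi r ->
  dual_le Q pi (fun=> 1) (fun x => 1 - r x) K.
Proof.
have [K K0 hK] := dual_le_uniform Q_ge0 pi_gt0 pi_sum Q_rev Q_irr.
pose B : R := 1 + \sum_y (pi y)^-1.
have B1 : 0 <= \sum_y (pi y)^-1 by apply: sumr_ge0 => y _; rewrite invr_ge0 ltW.
exists (K * B ^+ 2) => [|r rd]; first by rewrite mulr_ge0 ?sqr_ge0.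
apply: hK => [|x].
  under eq_bigr do rewrite mulrBl mul1r.
  by rewrite sumrB pi_sum; case: rd => _ ->; rewrite subrr.
have := density_le x rd; case: rd => /(_ x) r0 _ r1.
by rewrite ler_norml /B; lra.
Qed.

Variable kappa : R.
Hypothesis kappa_ge0 : 0 <= kappa.
Hypothesis bochner_ge : forall rho psi, (forall x, 0 < rho x) ->
  2 * kappa * dirichlet Q pi rho psi psi <= bochner Q pi rho psi.

Section Flow.
Variables (r0 r1 : X -> R) (rho v : R -> X -> R) (S e : R -> R).
Hypothesis path : energy_path r0 r1 rho v S e.
Variables (h eps K : R).
Hypotheses (h_ge0 : 0 <= h) (h_le : kappa * h <= 1) (eps01 : 0 < eps <= 1) (K_ge0 : 0 <= K).
Hypothesis KP : forall r, density pi r -> dual_le Q pi (fun=> 1) (fun x => 1 - r x) K.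

(* The clock tau slows down the path by the contraction factor of the heat flow:
   its speed 1 + l (t - 1/2) is at most expR (l (t - 1/2)). *)
Let l : R := 2 * kappa * h.
Let tau (t : R) : R := (1 - l / 2) * t + l * (t * t) / 2.
Let dtau (t : R) : R := 1 + l * (t - 2^-1).
(** The weight [c] of the constant density 1 is positive inside and vanishes at both ends. Mixing
    costs a multiple of dc^2 / c; taking [c] proportional to the square of [a] keeps this at most 4
    [eps]. *)
Let a (t : R) : R := t * (1 - t).
Let c (t : R) : R := eps * (a t * a t).
Let dc (t : R) : R := 2 * eps * a t * (1 - 2 * t).
Let base (t : R) x : R := (1 - c t) * rho (tau t) x + c t.
Let dbase (t : R) x : R := (1 - c t) * (dtau t * v (tau t) x) + dc t * (1 - rho (tau t) x).
Let mu (t : R) : X -> R := heat Q (h * t) (base t).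
Let dmu (t : R) x : R := heat Q (h * t) (dbase t) x + h * laplacian Q (mu t) x.

Let tauD (t : R) : is_derive t 1 tau (dtau t).
Proof. by rewrite /tau; deriv; rewrite /dtau; field. Qed.

Let cD (t : R) : is_derive t 1 c (dc t).
Proof. by rewrite /c /a; deriv; rewrite /dc /a; ring. Qed.

Let rhoD (t : R) x : is_derive t 1 (fun s => rho (tau s) x) (dtau t * v (tau t) x).
Proof. by rewrite mulrC; exact: (is_derive_lam_comp (path_derive path _ x) (tauD t)). Qed.

Let baseD (t : R) x : is_derive t 1 (fun s => base s x) (dbase t x).
Proof.
have h1 := cD t; have h2 := rhoD t x.
by rewrite /base; deriv; rewrite /dbase; ring.
Qed.

Let kernelD (t : R) x y : is_derive t 1 (fun s => heat_kernel Q (h * s) x y)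
  (laplacian Q (heat_kernel Q (h * t) ^~ y) x * h).
Proof.
apply: (is_derive_lam_comp (is_derive_heat_kernel Q_ge0 _ _ _)).
by deriv; ring.
Qed.

Let muD (t : R) x : is_derive t 1 (fun s => mu s x) (dmu t x).
Proof.
apply: (@is_derive_eq _ _ _ _ _ _ _ (\sum_y
  (laplacian Q (heat_kernel Q (h * t) ^~ y) x * h * base t y
   + heat_kernel Q (h * t) x y * dbase t y))).
  apply: is_derive_lam_sum => y; exact: (is_derive_lamM (kernelD t x y) (baseD t y)).
rewrite big_split /= addrC; congr (_ + _).
rewrite (@laplacian_sum _ _ _ X (base t) (fun y z => heat_kernel Q (h * t) z y)).
by rewrite big_distrr; apply: eq_bigr => y _ /=; ring.
Qed.

Let dmu_cont (t : R) x : dmu s x @[s --> t] --> dmu t x.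
Proof.
have muc y := is_derive_cvg (muD t y).
apply: cvgD; last first.
  apply: cvgM; first exact: cvg_cst.
  apply: cvg_lam_sum => y; apply: cvgM; first exact: cvg_cst.
  by apply: cvgB.
apply: cvg_lam_sum => y; apply: cvgM; first exact: is_derive_cvg (kernelD t x y).
have cc := is_derive_cvg (cD t).
have rc := is_derive_cvg (rhoD t y).
apply: cvgD; apply: cvgM.
- by apply: cvgB; first exact: cvg_cst.
- apply: cvgM.
    by apply: (@is_derive_cvg _ dtau); rewrite /dtau; deriv.
  have vc : v s y @[s --> tau t] --> v (tau t) y by exact: (path_cont path).
  exact: (cvg_lam_comp (is_derive_cvg (tauD t)) vc).
- by apply: (@is_derive_cvg _ dc); rewrite /dc /a; deriv.
- by apply: cvgB; first exact: cvg_cst.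
Qed.

Let l02 : 0 <= l <= 2.
Proof.
by rewrite /l -mulrA mulr_ge0 ?mulr_ge0 //= ler_piMr.
Qed.

Let a01 t : 0 <= t <= 1 -> 0 <= a t <= 1.
Proof. by rewrite /a => t01; apply/andP; split; nra. Qed.

Let c01 t : 0 <= t <= 1 -> 0 <= c t <= 1.
Proof.
move=> /a01 /andP[a0 a1]; move: eps01 => /andP[e0 e1].
have aa := mulr_ge0 a0 a0; have aa1 := mulr_ile1 a0 a0 a1 a1.
by rewrite /c (mulr_ge0 (ltW e0) aa) (mulr_ile1 (ltW e0) aa e1 aa1).
Qed.

Let c_gt0 t : 0 < t < 1 -> 0 < c t.
Proof.
move=> /andP[t0 t1]; move: eps01 => /andP[e0 _].
by rewrite /c /a !mulr_gt0 // subr_gt0.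
Qed.

Let base_gt0 t x : 0 < t < 1 -> 0 < base t x.
Proof.
move=> t01; have c0 := c_gt0 t01.
have /andP[_ c1] : 0 <= c t <= 1 by apply: c01; lra.
rewrite /base ltr_wpDl // mulr_ge0 ?subr_ge0 //.
by have [] := path_density path (tau t).
Qed.

Let base_density t : 0 <= t <= 1 -> density pi (base t).
Proof.
move=> /c01 /andP[c0 c1]; have [d0 d1] := path_density path (tau t); split.
  by move=> x; rewrite /base addr_ge0 // mulr_ge0 // subr_ge0.
under eq_bigr do rewrite mulrDl -mulrA.
by rewrite big_split /= -!big_distrr /= d1 pi_sum; ring.
Qed.

Let mu_density t : 0 <= t <= 1 -> density pi (mu t).
Proof.
move=> t01; apply: heat_density => //; last exact: base_density.
by rewrite mulr_ge0 //; lra.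
Qed.

Let mu_gt0 t x : 0 < t < 1 -> 0 < mu t x.
Proof.
move=> t01; apply: heat_gt0 => //; last by move=> y; exact: base_gt0.
by rewrite mulr_ge0 //; lra.
Qed.

Let dual_base t : 0 < t < 1 ->
  dual_le Q pi (base t) (dbase t) (dtau t ^+ 2 * e (tau t) + 4 * eps * K).
Proof.
move=> t01; have c0 := c_gt0 t01.
have c01' : 0 <= c t <= 1 by apply: c01; lra.
have dens := path_density path (tau t); have [d0 _] := dens.
have n0 := dual_leZ Q_ge0 pi_gt0 (dtau t) (path_dual path (tau t)).
have n1 := dual_leZ Q_ge0 pi_gt0 (dc t / c t) (KP dens).
have base0 x := base_gt0 x t01.
have := dual_le_mix Q_ge0 pi_gt0 base0 d0 (fun=> ler01) c01' _ _ n0 n1.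
move=> /(_ (dbase t)) m; apply: dual_le_mono (m _ _); first last.
- by move=> x; rewrite /dbase; field; rewrite gt_eqF.
- by move=> x; rewrite /base mulr1.
have e0 := dual_le_ge0 (path_dual path (tau t)).
apply: lerD.
  have q := mulr_ge0 (sqr_ge0 (dtau t)) e0.
  by rewrite (ler_piMl q) // lerBlDr lerDl ltW.
have a0 : a t != 0 by rewrite /a mulf_neq0 //; lra.
have eps0 : eps != 0 by move: eps01; lra.
have -> : c t * ((dc t / c t) ^+ 2 * K) = 4 * eps * K * (1 - 2 * t) ^+ 2.
  by rewrite /dc /c; field; rewrite eps0 a0.
have e4 : 0 <= 4 * eps * K by rewrite !mulr_ge0 //; move: eps01; lra.
by rewrite ler_piMr // expr2; nra.
Qed.

(** The heat flow contributes e^(-2 kappa h t) and the clock a factor [dtau t ^+ 2]. One factor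
    [dtau t] is at most e^(2 kappa h t - kappa h), which leaves e^(-kappa h); the other completes
    the derivative of [S (tau t)]. The condition kappa h <= 1 keeps [dtau] nonnegative. *)
Let dual_mu t : 0 < t < 1 -> dual_le Q pi (mu t) (dmu t)
  (expR (- (kappa * h)) * (dtau t * e (tau t)) + 4 * eps * K
   - 2 * h * pairing pi (dmu t) (fun x => ln (mu t x))).
Proof.
move=> t01; have mu0 x := mu_gt0 x t01.
apply: (dual_le_flow Q_ge0 pi_gt0 Q_rev mu0 (fun=> erefl)).
have ht : 0 <= h * t by rewrite mulr_ge0 //; lra.
have base0 x := base_gt0 x t01.
apply: dual_le_mono (dual_le_heat Q_ge0 pi_gt0 Q_rev bochner_ge ht base0 (dual_base t01)).
have e0 := dual_le_ge0 (path_dual path (tau t)).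
have e4 : 0 <= 4 * eps * K by rewrite !mulr_ge0 //; move: eps01; lra.
have dt0 : 0 <= dtau t by rewrite /dtau; move: l02; nra.
rewrite mulrDr; apply: lerD; last first.
  rewrite ler_piMl // -expR0 ler_expR oppr_le0 !mulr_ge0 //; lra.
have : dtau t <= expR (l * (t - 2^-1)) by exact: expR_ge1Dx.
have -> : l * (t - 2^-1) = 2 * kappa * (h * t) + (- (kappa * h)) by rewrite /l; field.
rewrite expRD => dte.
have := ler_wpM2l (expR_ge0 (- (2 * kappa * (h * t)))) dte.
have ex : expR (- (2 * kappa * (h * t))) * expR (2 * kappa * (h * t)) = 1.
  by rewrite mulrC expRxMexpNx_1.
rewrite [leRHS]mulrA ex mul1r => {}dte.
have := ler_wpM2r (mulr_ge0 dt0 e0) dte.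
by rewrite expr2 !mulrA.
Qed.

Lemma W_flow_approx : (W Q pi r0 (heat Q h r1) ^+ 2 <=
  (expR (- (kappa * h)) * (S 1 - S 0) + 4 * eps * K
   - 2 * h * (entropy pi (heat Q h r1) - entropy pi r0))%:E)%E.
Proof.
(* A primitive of the bound in [dual_mu]: the pairing of the velocity with ln mu is the derivative
   of the entropy along mu. *)
pose E t := expR (- (kappa * h)) * S (tau t) + 4 * eps * K * t - 2 * h * entropy pi (mu t).
have tau0 : tau 0 = 0 by rewrite /tau; field.
have tau1 : tau 1 = 1 by rewrite /tau; field.
have mu0 : mu 0 = r0.
  rewrite /mu mulr0 heat0; apply/funext => x.
  by rewrite /base tau0 /c /a (path_left path) //; ring.
have mu1 : mu 1 = heat Q h r1.
  rewrite /mu mulr1; congr (heat Q h _); apply/funext => x.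
  by rewrite /base tau1 /c /a (path_right path) //; ring.
have -> : expR (- (kappa * h)) * (S 1 - S 0) + 4 * eps * K
   - 2 * h * (entropy pi (heat Q h r1) - entropy pi r0) = E 1 - E 0.
  by rewrite /E tau0 tau1 mu0 mu1; ring.
pose dE t := expR (- (kappa * h)) * (dtau t * e (tau t)) + 4 * eps * K
   - 2 * h * pairing pi (dmu t) (fun x => ln (mu t x)).
have muc (t : R) x : mu s x @[s --> t] --> mu t x by exact: is_derive_cvg (muD t x).
have mucE x : {within `[0, 1], continuous (mu^~ x)}.
  by apply: within_itv_cvg => t _; exact: muc.
have SE (t : R) : S (tau s) @[s --> t] --> S (tau t).
  exact: is_derive_cvg (is_derive_lam_comp (path_energy path _) (tauD t)).
have Ec : {within `[0, 1], continuous E}.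
  apply: within_clamp => t; apply: cvgB.
    apply: cvgD; first by apply: cvgM; [exact: cvg_cst|exact: (cvg_lam_comp (@clamp_cvg _ 0 1 t) (SE _))].
    by apply: cvgM; [exact: cvg_cst|exact: clamp_cvg].
  apply: cvgM; first exact: cvg_cst.
  have cl s : 0 <= clamp (0 : R) 1 s <= 1 by exact: clamp_itv.
  apply: cvg_entropy => [s x|x|x].
  - by have [] := mu_density (cl s).
  - by have [] := mu_density (cl t).
  - exact: (cvg_lam_comp (@clamp_cvg _ 0 1 t) (@muc _ x)).
have muD' (t : R) x : 0 < t < 1 -> is_derive t 1 (mu^~ x) (dmu t x) by move=> _; exact: muD.
have ED (t : R) : 0 < t < 1 -> is_derive t 1 E (dE t).
  move=> t01; have d1 := is_derive_lam_comp (path_energy path _) (tauD t).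
  have d2 := is_derive_entropy (fun x => mu_gt0 x t01) (muD t) (dual_le_mass (dual_mu t01)).
  by rewrite /E; deriv; rewrite /dE; ring.
have dmuc (t : R) x : 0 < t < 1 -> dmu s x @[s --> t] --> dmu t x by move=> _; exact: dmu_cont.
exact: (W_sqr_le_curve Q_ge0 pi_gt0 pi_sum Q_rev Q_irr mu0 mu1 mu_density mucE muD' dmuc
  (fun t x t01 => mu_gt0 x t01) Ec ED dual_mu).
Qed.

End Flow.

Lemma W_flow r0 r1 C h : transportable r0 r1 C -> 0 <= h -> kappa * h <= 1 ->
  (W Q pi r0 (heat Q h r1) ^+ 2 <=
   (expR (- (kappa * h)) * C - 2 * h * (entropy pi (heat Q h r1) - entropy pi r0))%:E)%E.
Proof.
move=> [rho [v [S [e [path SC]]]]] h0 hk; apply/lee_addgt0Pr => d d0.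
have [K K0 KP] := dual_le_to_uniform.
pose eps : R := Num.min 1 (d / (4 * (K + 1))).
have K1 : 0 < 4 * (K + 1) by rewrite mulr_gt0 // ltr_wpDl.
have eps01 : 0 < eps <= 1 by rewrite /eps lt_min ltr01 divr_gt0 //= ge_min lexx.
apply: le_trans (W_flow_approx path h0 hk eps01 K0 KP) _.
rewrite -EFinD lee_fin.
have : eps * (4 * (K + 1)) <= d by rewrite -ler_pdivlMr // /eps ge_min lexx orbT.
have := ler_wpM2l (expR_ge0 (- (kappa * h))) SC.
move: eps01 => /andP[/ltW eps0 _].
have := mulr_ge0 eps0 K0; lra.
Qed.

End EVI.

(** * Regularization of curves of finite action *)

Section WeakCurves.
Context {R : realType} {X : finType}.
Variables (Q : X -> X -> R) (pi : X -> R).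
Hypothesis Q_ge0 : forall x y, 0 <= Q x y.
Hypothesis pi_gt0 : forall x, 0 < pi x.
Hypothesis pi_sum : \sum_x pi x = 1.
Hypothesis Q_rev : forall x y, Q x y * pi x = Q y x * pi y.
Hypothesis Q_irr : forall phi : X -> R, (forall x y, 0 < Q x y -> phi x = phi y) ->
  forall x y, phi x = phi y.

Local Notation D := (dirichlet Q pi).

(* The integrated form of [dual_le (sigma t) (sigma' t) (E' t)]. *)
Record weak_path (r0 r1 : X -> R) (sigma : R -> X -> R) (E : R -> R) : Prop := {
  weak_left : forall t, t <= 0 -> sigma t = r0;
  weak_right : forall t, 1 <= t -> sigma t = r1;
  weak_density : forall t, density pi (sigma t);
  weak_cont : forall (t : R) x, sigma s x @[s --> t] --> sigma t x;
  weak_energy : forall t : R, E s @[s --> t] --> E t;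
  weak_energy_left : forall t, t <= 0 -> E t = E 0;
  weak_energy_right : forall t, 1 <= t -> E t = E 1;
  weak_dual : forall (phi : X -> R) (F : R -> R),
    (forall t : R, is_derive t 1 F (D (sigma t) phi phi)) -> forall s t, s <= t ->
    2 * pairing pi (fun x => sigma t x - sigma s x) phi - (F t - F s) <= E t - E s }.

Lemma primitive_cst (f F : R -> R) (a b c : R) : a <= b ->
  (forall t : R, is_derive t 1 F (f t)) -> (forall t, a <= t <= b -> f t = c) ->
  F b - F a = c * (b - a).
Proof.
move=> ab Fd fE.
have Fc : {within `[a, b], continuous F}.
  by apply: within_itv_cvg => t _; exact: is_derive_cvg (Fd t).
have Ld (t : R) : a < t < b -> is_derive t 1 (fun s => c * s) c by move=> _; deriv; ring.
have Lc : {within `[a, b], continuous (fun s => c * s)}.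
  apply: within_itv_cvg => t _.
  by apply: (cvgM (cvg_cst _)); exact: cvg_id.
have Fd' (t : R) : a < t < b -> is_derive t 1 F (f t) by move=> _; exact: Fd.
have e t : a < t < b -> f t = c by move=> /andP[/ltW h1 /ltW h2]; apply: fE; rewrite h1.
have e1 t : a < t < b -> f t <= c by move=> /e ->.
have e2 t : a < t < b -> c <= f t by move=> /e ->.
have h1 := is_derive_le ab Fc Lc Fd' Ld e1.
have h2 := is_derive_le ab Lc Fc Ld Fd' e2.
by apply/eqP; rewrite eq_le; apply/andP; split; lra.
Qed.

Lemma dirichlet_cvg (T : Type) (F : set_system T) (FF : Filter F) (rho : T -> X -> R)
    (r phi : X -> R) : (forall t x, 0 <= rho t x) -> (forall x, 0 <= r x) ->
  (forall x, rho t x @[t --> F] --> r x) -> D (rho t) phi phi @[t --> F] --> D r phi phi.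
Proof.
move=> rho0 r0 h; apply: cvgM; first exact: cvg_cst.
apply: cvg_lam_sum => x; apply: cvg_lam_sum => y.
apply: cvgM; last exact: cvg_cst.
apply: cvgM; last exact: cvg_cst.
by apply: cvgM; [exact: cvg_cst|apply: theta_cvg].
Qed.

(* Jensen's inequality for the concave function [dirichlet ^~ phi phi]. *)
Lemma dirichlet_average (sigma : R -> X -> R) (G : X -> R -> R) (phi : X -> R) (F : R -> R)
    (a d : R) : 0 < d -> (forall t x, 0 <= sigma t x) ->
  (forall x (t : R), is_derive t 1 (G x) (sigma t x)) ->
  (forall t : R, is_derive t 1 F (D (sigma t) phi phi)) ->
  F (a + d) - F a <= d * D (fun x => (G x (a + d) - G x a) / d) phi phi.
Proof.
move=> d0 s0 Gd Fd; pose r x := (G x (a + d) - G x a) / d.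
rewrite -[X in d * dirichlet _ _ X _ _]/r.
have ad : a <= a + d by rewrite lerDl ltW.
have Ghomo x : G x a <= G x (a + d).
  by apply: (is_derive_ge0_homo (Gd x)) => // t; exact: s0.
have r0 x : 0 <= r x by rewrite /r divr_ge0 ?(ltW d0) ?subr_ge0.
(* The averaged density may have zeros, where [theta] has no tangent plane; the plane is taken at
   the density shifted by [eta], and [eta] tends to 0 at the end. *)
have step (eta : R) : 0 < eta -> F (a + d) - F a <= d * D (fun x => r x + eta) phi phi.
  move=> eta0; pose p x y := theta1 (r x + eta) (r y + eta).
  have re0 x : 0 < r x + eta by rewrite ltr_wpDl.
  have p0 x y : 0 <= p x y by apply: theta1_ge0; exact: ltW.
  pose w x y := (phi x - phi y) * (phi x - phi y) * (Q x y * pi x).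
  have w0 x y : 0 <= w x y.
    rewrite /w -expr2; apply: mulr_ge0; first exact: sqr_ge0.
    by rewrite mulr_ge0 // ltW.
  (* The tangent functional is linear in the density, hence its integral over the window only
     involves the primitives [G]. *)
  pose L u : R := 2^-1 * \sum_x \sum_y w x y * (p x y * G x u + p y x * G y u).
  pose dL u : R := 2^-1 * \sum_x \sum_y w x y * (p x y * sigma u x + p y x * sigma u y).
  have Ld (u : R) : is_derive u 1 L (dL u).
    have h x y : is_derive u 1 (fun u => w x y * (p x y * G x u + p y x * G y u))
        (w x y * (p x y * sigma u x + p y x * sigma u y)).
      by have h1 := Gd x u; have h2 := Gd y u; deriv; ring.
    have h2 : is_derive u 1 (fun u => \sum_x \sum_y w x y * (p x y * G x u + p y x * G y u))
        (\sum_x \sum_y w x y * (p x y * sigma u x + p y x * sigma u y)).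
      by apply: is_derive_lam_sum => x; apply: is_derive_lam_sum => y; exact: h.
    by rewrite /L; deriv; rewrite mul0r add0r.
  have DE rr : D rr phi phi = 2^-1 * \sum_x \sum_y w x y * theta (rr x) (rr y).
    congr (_ * _); apply: eq_bigr => x _; apply: eq_bigr => y _; rewrite /w; ring.
  have le (u : R) : D (sigma u) phi phi <= dL u.
    rewrite DE ler_wpM2l //; apply: ler_sum => x _; apply: ler_sum => y _.
    by apply: ler_wpM2l => //; exact: theta_le_tangent.
  have Fc : {within `[a, a + d], continuous F}.
    by apply: within_itv_cvg => t _; exact: is_derive_cvg (Fd t).
  have Lc : {within `[a, a + d], continuous L}.
    by apply: within_itv_cvg => t _; exact: is_derive_cvg (Ld t).
  apply: le_trans (is_derive_le ad Fc Lc (fun t _ => Fd t) (fun t _ => Ld t) (fun t _ => le t)) _.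
  rewrite DE /L -mulrBr mulrCA ler_wpM2l // -sumrB big_distrr; apply: ler_sum => x _ /=.
  rewrite -sumrB big_distrr; apply: ler_sum => y _ /=.
  rewrite -mulrBr [leRHS]mulrCA ler_wpM2l // (thetaE (re0 x) (re0 y)) -!/(p _ _).
  have -> : p x y * G x (a + d) + p y x * G y (a + d) - (p x y * G x a + p y x * G y a) =
    d * (p x y * r x + p y x * r y) by rewrite /r; field; rewrite gt_eqF.
  by rewrite ler_pM2l //; apply: lerD; rewrite ler_wpM2l // lerDl ltW.
have lim : d * D (fun x => r x + `|s|) phi phi @[s --> (0 : R)^'] --> d * D r phi phi.
  apply: cvgM; first exact: cvg_cst.
  apply: dirichlet_cvg => //.
    by move=> s y; rewrite addr_ge0.
  move=> y; rewrite -[X in _ --> X]addr0; apply: cvgD; first exact: cvg_cst.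
  rewrite -[X in _ --> X](@normr0 _ R).
  by apply: cvg_norm; exact: cvg_within.
apply: (cvgr_to_ge lim); near=> s; apply: step; rewrite normr_gt0.
by near: s; exact: nbhs_dnbhs_neq.
Unshelve. all: by end_near. Qed.

(** Averaging over a sliding window of length [d] makes the curve C^1, and Jensen's inequality
    preserves the dual bound. Time runs faster by 1 + d, so that the window is [-d, 0] at time 0 and
    [1, 1 + d] at time 1, where the curve is constant; this is the factor lost. *)
Lemma transportable_of_weak r0 r1 sigma E (d : R) : weak_path r0 r1 sigma E -> 0 < d ->
  transportable Q pi r0 r1 ((1 + d) * (E 1 - E 0)).
Proof.
move=> weak d0.
have /choice[G Gd] : forall x, exists G : R -> R, forall t : R, is_derive t 1 G (sigma t x).
  by move=> x; apply: primitive_exists => t; exact: (weak_cont weak).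
have [SE SEd] : exists SE : R -> R, forall t : R, is_derive t 1 SE (E t).
  by apply: primitive_exists => t; exact: (weak_energy weak).
have s_ge0 t x : 0 <= sigma t x by have [] := weak_density weak t.
have d1 : 0 < 1 + d by rewrite ltr_wpDl.
pose al (t : R) := (1 + d) * t - d.
pose be (t : R) := (1 + d) * t.
have alD (t : R) : is_derive t 1 al (1 + d) by rewrite /al; deriv; ring.
have beD (t : R) : is_derive t 1 be (1 + d) by rewrite /be; deriv; ring.
have abE t : al t + d = be t by rewrite /al /be subrK.
have ab t : al t <= be t by rewrite -abE lerDl ltW.
have ab0 t : t <= 0 -> al t <= 0 /\ be t <= 0.
  move=> t0; have h : (1 + d) * t <= 0 by rewrite mulr_ge0_le0 // ltW.
  by rewrite /al /be; split => //; lra.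
have ab1 t : 1 <= t -> 1 <= al t /\ 1 <= be t.
  move=> t1; have h : 1 + d <= (1 + d) * t by rewrite ler_peMr // ltW.
  by rewrite /al /be; split; lra.
pose rho t x := (G x (be t) - G x (al t)) / d.
pose v t x := (1 + d) * ((sigma (be t) x - sigma (al t) x) / d).
pose S t := (1 + d) * ((SE (be t) - SE (al t)) / d).
pose e t := (1 + d) ^+ 2 * ((E (be t) - E (al t)) / d).
have dn0 : d != 0 by rewrite gt_eqF.
have Gcst x c t : (forall u, al t <= u <= be t -> sigma u x = c) -> rho t x = c.
  move=> h; rewrite /rho (primitive_cst (ab t) (Gd x) h) -abE.
  by field.
have Scst c t : (forall u, al t <= u <= be t -> E u = c) -> S t = (1 + d) * c.
  move=> h; rewrite /S (primitive_cst (ab t) SEd h) -abE.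
  by field.
have S0 t : t <= 0 -> S t = (1 + d) * E 0.
  move=> /ab0 [a0 b0]; apply: Scst => u /andP[_ ub].
  by rewrite (weak_energy_left weak) // (le_trans ub).
have S1 t : 1 <= t -> S t = (1 + d) * E 1.
  move=> /ab1 [a1 b1]; apply: Scst => u /andP[au _].
  by rewrite (weak_energy_right weak) // (le_trans a1).
exists rho, v, S, e; split; last by rewrite (S1 1 (lexx _)) (S0 0 (lexx _)) -mulrBr.
split.
- move=> t /ab0 [a0 b0]; apply/funext => x; apply: Gcst => u /andP[_ ub].
  by rewrite (weak_left weak) // (le_trans ub).
- move=> t /ab1 [a1 b1]; apply/funext => x; apply: Gcst => u /andP[au _].
  by rewrite (weak_right weak) // (le_trans a1).
- move=> t; split => [x|].
    rewrite /rho divr_ge0 ?(ltW d0) // subr_ge0.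
    by apply: (is_derive_ge0_homo (Gd x)) => // u; exact: s_ge0.
  pose M u := \sum_x G x u * pi x.
  have Md (u : R) : is_derive u 1 M 1.
    have h : is_derive u 1 M (\sum_x sigma u x * pi x).
      rewrite /M; apply: is_derive_lam_sum => x.
      by have h := Gd x u; deriv; ring.
    exact: (is_derive_eq h (proj2 (weak_density weak u))).
  have : M (be t) - M (al t) = 1 * (be t - al t).
    by apply: (primitive_cst (f := fun=> 1) (ab t) Md).
  rewrite -abE mul1r [al t + d]addrC addrK => h.
  transitivity ((M (d + al t) - M (al t)) / d); last by rewrite h mulfV.
  rewrite /M -sumrB big_distrl /rho -abE [al t + d]addrC; apply: eq_bigr => x _ /=; ring.
- move=> t x; rewrite /rho /v.
  have h1 := is_derive_lam_comp (Gd x _) (beD t).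
  have h2 := is_derive_lam_comp (Gd x _) (alD t).
  by deriv; field.
- move=> t x; apply: cvgM; first exact: cvg_cst.
  apply: cvgM; last exact: cvg_cst.
  have c1 : sigma s x @[s --> be t] --> sigma (be t) x by exact: (weak_cont weak).
  have c2 : sigma s x @[s --> al t] --> sigma (al t) x by exact: (weak_cont weak).
  apply: cvgB.
    exact: (cvg_lam_comp (is_derive_cvg (beD t)) c1).
  exact: (cvg_lam_comp (is_derive_cvg (alD t)) c2).
- move=> t x /orP[/ab0 [a0 b0]|/ab1 [a1 b1]]; rewrite /v.
    by rewrite !(weak_left weak) // subrr mul0r mulr0.
  by rewrite !(weak_right weak) // subrr mul0r mulr0.
- move=> t; rewrite /S /e.
  have h1 := is_derive_lam_comp (SEd _) (beD t).
  have h2 := is_derive_lam_comp (SEd _) (alD t).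
  by deriv; field.
- by move=> t t0; rewrite !S0.
- by move=> t t1; rewrite !S1.
- move=> t; apply: dual_leZ => // phi.
  have /primitive_exists[F Fd] (u : R) : D (sigma s) phi phi @[s --> u] --> D (sigma u) phi phi.
    by apply: dirichlet_cvg => // x; exact: (weak_cont weak).
  have h1 := weak_dual weak Fd (ab t).
  have h2 := dirichlet_average (al t) d0 s_ge0 Gd Fd.
  rewrite abE in h2; rewrite -/(rho t) in h2.
  have -> : pairing pi (fun x => (sigma (be t) x - sigma (al t) x) / d) phi =
      d^-1 * pairing pi (fun x => sigma (be t) x - sigma (al t) x) phi.
    by rewrite -pairingZl; apply: eq_bigr => x _; rewrite [_ / d]mulrC.
  rewrite ler_pdivlMr // mulrBl -mulrA [d^-1 * _ * d]mulrAC mulVf // mul1r.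
  by rewrite [_ * d]mulrC; lra.
Qed.

End WeakCurves.

Lemma within_cvg_clamp {R : realType} (f : R -> R) (a b t : R) : a <= b ->
  {within `[a, b], continuous f} -> f (clamp a b s) @[s --> t] --> f (clamp a b t).
Proof.
move=> ab fc; have cl s : `[a, b]%classic (clamp a b s).
  by rewrite /= in_itv /=; exact: clamp_itv.
have h : clamp a b s @[s --> t] --> within `[a, b] (nbhs (clamp a b t)).
  move=> A hA.
  have : nbhs t (clamp a b @^-1` [set s | `[a, b]%classic s -> A s]).
    exact: (@clamp_cvg R a b t _ hA).
  by apply: filterS => s; apply; exact: cl.
have := fc (clamp a b t); rewrite /continuous_at => fct.
have FF : Filter (clamp a b s @[s --> t]) by exact: fmap_filter.
have h' := (subspace_cvgP FF (cl t)).2 h.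
by move=> A hA; exact: h' (fct A hA).
Qed.

Section FiniteAction.
Context {R : realType} {X : finType}.
Variables (Q : X -> X -> R) (pi : X -> R).
Hypothesis Q_ge0 : forall x y, 0 <= Q x y.
Hypothesis pi_gt0 : forall x, 0 < pi x.
Hypothesis pi_sum : \sum_x pi x = 1.
Hypothesis Q_rev : forall x y, Q x y * pi x = Q y x * pi y.
Hypothesis Q_irr : forall phi : X -> R, (forall x y, 0 < Q x y -> phi x = phi y) ->
  forall x y, phi x = phi y.
Local Notation mu := (@lebesgue_measure R).
Local Notation D := (dirichlet Q pi).

(** Testing the continuity equation with a fixed function phi eliminates the potential, which is
    only measurable; it survives in the integrated action [E] alone. *)
Lemma weak_of_admissible r0 r1 rho psi (C : R) : admissible Q pi r0 r1 rho psi ->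
  (action Q pi rho psi < C%:E)%E ->
  exists sigma E, weak_path Q pi r0 r1 sigma E /\ 0 <= E 1 - E 0 < C.
Proof.
move=> [[rho0 rho1] rhod rhoc psim cont] act.
pose cl := clamp (0 : R) 1.
have clI t : 0 <= cl t <= 1 by exact: clamp_itv.
pose sigma t := rho (cl t).
have sd t : density pi (sigma t) by exact: rhod.
have s_ge0 t x : 0 <= sigma t x by have [] := sd t.
have sc (t : R) x : sigma s x @[s --> t] --> sigma t x.
  by have [rc _ _] := rhoc x; exact: (@within_cvg_clamp _ (rho^~ x) 0 1 t ler01 rc).
pose a t := D (rho t) (psi t) (psi t).
have a0 t : 0 <= a t by exact: dirichlet_ge0.
have am : measurable_fun (`[0, 1] : set R) a.
  apply: measurable_funM; first exact: measurable_cst.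
  apply: measurable_sum => x; apply: measurable_sum => y.
  apply: measurable_funM; last exact: measurable_cst.
  apply: measurable_funM; last exact: measurable_cst.
  apply: measurable_funM.
    by apply: measurable_funM; apply: measurable_funB; exact: psim.
  apply: (@eq_measurable_fun _ _ _ _ _ (fun t => theta (sigma t x) (sigma t y))).
    by move=> t; rewrite inE /= in_itv /= => t01; rewrite /sigma /cl clamp_id.
  apply: measurable_funTS; apply: continuous_measurable_fun => t.
  by apply: theta_cvg => //; exact: sc.
have aC : (\int[mu]_(t in `[0%R, 1%R]) (a t)%:E < C%:E)%E.
  move: act; rewrite (actionE _ _ rho psi).
  have -> : (\int[mu]_(t in `[0%R, 1%R]) (2 * D (rho t) (psi t) (psi t))%:E =
      2%:E * \int[mu]_(t in `[0%R, 1%R]) (a t)%:E)%E.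
    rewrite -ge0_integralZl //; first exact/measurable_EFinP.
    by move=> t _; rewrite lee_fin.
  by rewrite muleA -EFinM mulVf // mul1e.
have ai : mu.-integrable `[0, 1] (EFin \o a).
  apply/integrableP; split; first exact/measurable_EFinP.
  under eq_integral do rewrite /= ger0_norm //.
  exact: lt_trans aC (ltry _).
pose E t : R := \int[mu]_(u in `[0, cl t]) a u.
have Ec (t : R) : E s @[s --> t] --> E t.
  have h := @parameterized_integral_continuous R 0 1 a ler01 ai.
  exact: (@within_cvg_clamp _ (fun t => parameterized_integral mu 0 t a) 0 1 t ler01 h).
have Eint s t : 0 <= s -> s <= t -> t <= 1 -> E t - E s = \int[mu]_(u in `[s, t]) a u.
  move=> s0 st t1; rewrite /E /cl !clamp_id; [|lra..].
  have ai' : mu.-integrable `[0, t] (EFin \o a).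
    by apply: integrableS ai => //; apply: subset_itv; rewrite bnd_simp.
  rewrite Rintegral_itvB //; [|by rewrite bnd_simp..].
  rewrite /Rintegral integral_itv_obnd_cbnd //; apply/measurable_EFinP.
  by apply: measurable_funS am => //; apply: subset_itv; rewrite bnd_simp.
exists sigma, E; split; last first.
  rewrite Eint //; apply/andP; split.
    by apply: fine_ge0; apply: integral_ge0 => t _; rewrite lee_fin.
  by rewrite -lte_fin /Rintegral fineK //; exact: integrable_fin_num.
split.
- by move=> t t0; rewrite /sigma /cl clamp_le.
- by move=> t t1; rewrite /sigma /cl clamp_ge.
- exact: sd.
- exact: sc.
- exact: Ec.
- by move=> t t0; rewrite /E /cl !clamp_le.
- by move=> t t1; rewrite /E /cl !clamp_ge.
move=> phi F Fd.
pose v t x := ((rho^~ x)^`())%classic t.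
(* The weak dual inequality says exactly that [H] is nonincreasing. *)
pose H t := 2 * pairing pi (sigma t) phi - F t - E t.
have Hc (t : R) : H s @[s --> t] --> H t.
  apply: cvgB; last exact: Ec.
  apply: cvgB; last exact: is_derive_cvg (Fd t).
  apply: cvgM; first exact: cvg_cst.
  apply: cvg_lam_sum => x; apply: cvgM; last exact: cvg_cst.
  by apply: cvgM; [exact: sc|exact: cvg_cst].
have inner s t : 0 < s -> s <= t -> t < 1 -> H t <= H s.
  move=> s0; rewrite le_eqVlt => /predU1P[-> //|st] t1.
  pose g u := 2 * pairing pi (v u) phi - D (sigma u) phi phi.
  pose H0 u := 2 * pairing pi (sigma u) phi - F u.
  have H0d (u : R) : 0 < u < 1 -> is_derive u 1 H0 (g u).
    move=> u01; have sdu x : is_derive u 1 (fun s => sigma s x) (v u x).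
      have [_ rd _] := rhoc x.
      apply: (@near_is_derive _ (rho^~ x)); last by rewrite /v derive1E; split=> //; exact: rd.
      apply: filterS (near_itv01 u01) => w /andP[w0 w1].
      by rewrite /sigma /cl clamp_id // !ltW.
    have hp : is_derive u 1 (fun s => pairing pi (sigma s) phi) (pairing pi (v u) phi).
      by apply: is_derive_lam_sum => x; have h := sdu x; deriv; ring.
    have hF := Fd u.
    by rewrite /H0; deriv; rewrite /g; ring.
  have gc (u : R) : 0 < u < 1 -> g w @[w --> u] --> g u.
    move=> u01; apply: cvgB; last by apply: dirichlet_cvg => // x; exact: sc.
    apply: cvgM; first exact: cvg_cst.
    apply: cvg_lam_sum => x; apply: cvgM; last exact: cvg_cst.
    by apply: cvgM; [have [_ _] := rhoc x; exact|exact: cvg_cst].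
  (* Expands the nonnegative energy of phi - psi. *)
  have ga u : 0 < u < 1 -> g u <= a u.
    move=> u01; have su : sigma u = rho u by rewrite /sigma /cl clamp_id //; lra.
    have ru0 x : 0 <= rho u x by rewrite -su.
    have vE : v u = fun x => \sum_y (psi u x - psi u y) * theta (rho u x) (rho u y) * Q x y.
      apply/funext => x; rewrite /v; have /eqP := cont x u u01; rewrite addr_eq0 => /eqP ->.
      by rewrite -sumrN; apply: eq_bigr => y _; ring.
    rewrite /g /a vE pairing_flux // su.
    have := dirichlet_ge0 Q_ge0 pi_gt0 (rho u) (fun x => phi x + -1 * psi u x).
    rewrite dirichletDl !dirichletDr !dirichletZl !dirichletZr.
    by rewrite (dirichletC _ _ _ phi (psi u)); lra.
  have gi : mu.-integrable `[s, t] (EFin \o g).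
    by apply: continuous_itv_integrable => u hu; apply: gc; lra.
  have ais : mu.-integrable `[s, t] (EFin \o a).
    by apply: integrableS ai => //; apply: subset_itv; rewrite bnd_simp; lra.
  have H0c (u : R) : 0 < u < 1 -> H0 w @[w --> u] --> H0 u.
    by move=> u01; exact: is_derive_cvg (H0d u u01).
  have ftc : \int[mu]_(u in `[s, t]) g u = H0 t - H0 s.
    rewrite /Rintegral (@continuous_FTC2 R g H0 s t st) //.
    - by apply: within_itv_cvg => u hu; apply: gc; lra.
    - split.
        move=> u; rewrite in_itv /= => hu; have u01 : 0 < u < 1 by lra.
        by have [] := H0d u u01.
        by apply: cvg_at_right_filter; apply: H0c; lra.
      by apply: cvg_at_left_filter; apply: H0c; lra.
    - move=> u; rewrite in_itv /= => hu; rewrite derive1E.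
      have u01 : 0 < u < 1 by lra.
      by have [] := H0d u u01.
  have : \int[mu]_(u in `[s, t]) g u <= \int[mu]_(u in `[s, t]) a u.
    apply: le_Rintegral => // u; rewrite /= in_itv /= => hu; apply: ga; lra.
  rewrite ftc -Eint; [|lra..].
  by rewrite /H /H0; lra.
have closed s t : 0 <= s -> s <= t -> t <= 1 -> H t <= H s.
  move=> s0; rewrite le_eqVlt => /predU1P[-> //|st] t1.
  have c1 : H (t - h) @[h --> (0 : R)^'+] --> H (t - 0).
    apply: cvg_at_right_filter; apply: cvg_lam_comp; last exact: Hc.
    by apply: cvgB; [exact: cvg_cst|exact: cvg_id].
  have c2 : H (s + h) @[h --> (0 : R)^'+] --> H (s + 0).
    apply: cvg_at_right_filter; apply: cvg_lam_comp; last exact: Hc.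
    by apply: cvgD; [exact: cvg_cst|exact: cvg_id].
  rewrite subr0 in c1; rewrite addr0 in c2; apply: ler_cvg_to c1 c2 _.
  near=> h; have h0 : 0 < h by [].
  have h1 : h < (t - s) / 2 by near: h; apply: nbhs_right_lt; lra.
  by apply: inner; lra.
move=> s t st.
have Fh : {homo F : x y / x <= y}.
  exact: (is_derive_ge0_homo Fd (fun u => dirichlet_ge0 Q_ge0 pi_gt0 _ _)).
(* Outside [0, 1] the curve and [E] are frozen, while [F] keeps increasing and only helps. *)
have HE u : H u = H (cl u) + F (cl u) - F u.
  by rewrite /H /E /sigma /cl (clamp_id (clI u)); ring.
suff : H t <= H s.
  rewrite /H; have -> : pairing pi (fun x => sigma t x - sigma s x) phi =
      pairing pi (sigma t) phi - pairing pi (sigma s) phi.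
    by rewrite /pairing -sumrB; apply: eq_bigr => x _; ring.
  lra.
have clh : cl s <= cl t by rewrite /cl /clamp; apply: le_min2 => //; exact: le_max2.
have := closed (cl s) (cl t) (proj1 (andP (clI s))) clh (proj2 (andP (clI t))).
rewrite (HE t) (HE s).
suff : F (cl t) - F (cl s) <= F t - F s by lra.
have [t0|t0] := leP t 0.
  have s0 := le_trans st t0.
  by rewrite /cl !clamp_le // subrr subr_ge0 Fh.
have [s1|s1] := leP 1 s.
  have t1 := le_trans s1 st.
  by rewrite /cl !clamp_ge // subrr subr_ge0 Fh.
apply: lerB; apply: Fh.
  have [t1|t1] := leP t 1; first by rewrite /cl clamp_id // t1 ltW.
  by rewrite /cl clamp_ge // ltW.
have [s0|s0] := leP 0 s; first by rewrite /cl clamp_id // s0 ltW.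
by rewrite /cl clamp_le // ltW.
Unshelve. all: by end_near. Qed.

Lemma transportable_of_W r0 r1 (C : R) : (W Q pi r0 r1 ^+ 2 < C%:E)%E ->
  transportable Q pi r0 r1 C.
Proof.
rewrite W_sqrE // => /ereal_inf_lt [_ [rho [psi [adm ->]]] act].
have [sigma [E [weak /andP[c0 cC]]]] := weak_of_admissible adm act.
move: (E 1 - E 0) (@transportable_of_weak _ _ _ _ Q_ge0 pi_gt0 r0 r1 sigma E) c0 cC => c h c0 cC.
(* With this window length the regularized energy (1 + d) c is still at most [C]; the denominator c
   + 1 allows c = 0. *)
have d0 : 0 < (C - c) / (c + 1) by rewrite divr_gt0 ?subr_gt0 ?ltr_wpDl.
have [p [v [S [e [P SC]]]]] := h _ weak d0.
exists p, v, S, e; split => //; apply: le_trans SC _; clear act.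
have -> : (1 + (C - c) / (c + 1)) * c = c + (C - c) * (c / (c + 1)) by field; lra.
have : c / (c + 1) <= 1 by rewrite ler_pdivrMr ?ltr_wpDl // mul1r lerDl.
have : 0 <= C - c by lra.
by move=> h1 h2; have := ler_wpM2l h1 h2; lra.
Qed.

End FiniteAction.

(** * Geodesic convexity from Bochner's inequality *)

Section Convexity.
Context {R : realType} {X : finType}.
Variables (Q : X -> X -> R) (pi : X -> R).
Hypothesis Q_ge0 : forall x y, 0 <= Q x y.
Hypothesis pi_gt0 : forall x, 0 < pi x.
Hypothesis pi_sum : \sum_x pi x = 1.
Hypothesis Q_rev : forall x y, Q x y * pi x = Q y x * pi y.
Hypothesis Q_irr : forall phi : X -> R, (forall x y, 0 < Q x y -> phi x = phi y) ->
  forall x y, phi x = phi y.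

Lemma transportable_sym r0 r1 C : transportable Q pi r0 r1 C -> transportable Q pi r1 r0 C.
Proof.
move=> [rho [v [S [e [P SC]]]]].
pose rev (t : R) := 1 - t.
have revD (t : R) : is_derive t 1 rev (-1) by rewrite /rev; deriv; ring.
exists (fun t => rho (rev t)), (fun t x => - v (rev t) x), (fun t => - S (rev t)),
  (fun t => e (rev t)); split; last by rewrite /rev subrr subr0; lra.
split.
- by move=> t t0; apply: (path_right P); rewrite /rev; lra.
- by move=> t t1; apply: (path_left P); rewrite /rev; lra.
- by move=> t; exact: (path_density P).
- move=> t x; rewrite -mulrN1; exact: (is_derive_lam_comp (path_derive P _ x) (revD t)).
- move=> t x; apply: cvgN.
  have c1 : v s x @[s --> rev t] --> v (rev t) x by exact: (path_cont P).
  exact: (cvg_lam_comp (is_derive_cvg (revD t)) c1).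
- move=> t x t01; rewrite (path_flat P) ?oppr0 // /rev.
  by move: t01 => /orP[h|h]; apply/orP; [right|left]; lra.
- move=> t; have h := is_derive_lam_comp (path_energy P _) (revD t).
  by deriv; ring.
- by move=> t t0; congr (- _); rewrite !(path_energy_right P) // /rev; lra.
- by move=> t t1; congr (- _); rewrite !(path_energy_left P) // /rev; lra.
- move=> t; have := dual_leZ Q_ge0 pi_gt0 (-1) (path_dual P (rev t)).
  rewrite sqrrN expr1n mul1r; congr dual_le; apply/funext => x; exact: mulN1r.
Qed.

(** The first path is run during [0, s] and the second during [s, 1]; squared speeds scale like the
    inverse squared durations, so costs scale like 1 / s and 1 / (1 - s). *)
Lemma transportable_trans r0 r r1 C1 C2 (s : R) : 0 < s < 1 ->
  transportable Q pi r0 r C1 -> transportable Q pi r r1 C2 ->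
  transportable Q pi r0 r1 (C1 / s + C2 / (1 - s)).
Proof.
move=> s01 [rho1 [v1 [S1 [e1 [P1 SC1]]]]] [rho2 [v2 [S2 [e2 [P2 SC2]]]]].
have s0 : 0 < s by lra.
have s1 : 0 < 1 - s by lra.
have sn0 : s != 0 by rewrite gt_eqF.
have sn1 : 1 - s != 0 by rewrite gt_eqF.
pose al (t : R) := t / s; pose be (t : R) := (t - s) / (1 - s).
have alD (t : R) : is_derive t 1 al s^-1 by rewrite /al; deriv; ring.
have beD (t : R) : is_derive t 1 be (1 - s)^-1 by rewrite /be; deriv; ring.
have al1 t : s <= t -> 1 <= al t by move=> st; rewrite /al ler_pdivlMr // mul1r.
have be0 t : t <= s -> be t <= 0.
  by move=> st; rewrite /be ler_pdivrMr // mul0r subr_le0.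
have al0 t : t <= 0 -> al t <= 0 by move=> t0; rewrite /al ler_pdivrMr // mul0r.
have be1 t : 1 <= t -> 1 <= be t by move=> t1; rewrite /be ler_pdivlMr // mul1r; lra.
(* One of the two paths rests at the intermediate density at each time, so a sum replaces a
   definition by cases and smoothness at s is automatic. *)
pose rho t x := rho1 (al t) x + rho2 (be t) x - r x.
pose v t x := v1 (al t) x / s + v2 (be t) x / (1 - s).
pose S t := S1 (al t) / s + S2 (be t) / (1 - s).
pose e t := e1 (al t) / s ^+ 2 + e2 (be t) / (1 - s) ^+ 2.
have rhoL t : t <= s -> rho t = rho1 (al t).
  by move=> ts; apply/funext => x; rewrite /rho (path_left P2 (be0 t ts)) addrK.
have rhoR t : s <= t -> rho t = rho2 (be t).
  by move=> ts; apply/funext => x; rewrite /rho (path_right P1 (al1 t ts)) addrC addKr.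
exists rho, v, S, e; split; last first.
  rewrite /S (path_energy_right P1 (al1 1 _)); last lra.
  rewrite (path_energy_right P2 (be1 1 _)) // (path_energy_left P1 (al0 0 _)) //.
  rewrite (path_energy_left P2 (be0 0 _)); last lra.
  have i0 : 0 <= s^-1 by rewrite invr_ge0 ltW.
  have i1 : 0 <= (1 - s)^-1 by rewrite invr_ge0 ltW.
  have := ler_wpM2r i0 SC1; have := ler_wpM2r i1 SC2; lra.
split.
- by move=> t t0; rewrite rhoL; [rewrite (path_left P1) // al0|lra].
- by move=> t t1; rewrite rhoR; [rewrite (path_right P2) // be1|lra].
- move=> t; have [ts|/ltW ts] := leP t s; first by rewrite rhoL //; exact: (path_density P1).
  by rewrite rhoR //; exact: (path_density P2).
- move=> t x; rewrite /rho /v.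
  have h1 := is_derive_lam_comp (path_derive P1 _ x) (alD t).
  have h2 := is_derive_lam_comp (path_derive P2 _ x) (beD t).
  by deriv; ring.
- move=> t x.
  have c1 : v1 s x @[s --> al t] --> v1 (al t) x by exact: (path_cont P1).
  have c2 : v2 s x @[s --> be t] --> v2 (be t) x by exact: (path_cont P2).
  apply: cvgD; (apply: cvgM; last exact: cvg_cst).
    exact: (cvg_lam_comp (is_derive_cvg (alD t)) c1).
  exact: (cvg_lam_comp (is_derive_cvg (beD t)) c2).
- move=> t x t01; rewrite /v (path_flat P1); last first.
    by move: t01 => /orP[h|h]; apply/orP; [left; exact: al0|right; apply: al1; lra].
  rewrite (path_flat P2) ?mul0r ?addr0 //.
  by move: t01 => /orP[h|h]; apply/orP; [left; apply: be0; lra|right; exact: be1].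
- move=> t; rewrite /S /e.
  have h1 := is_derive_lam_comp (path_energy P1 _) (alD t).
  have h2 := is_derive_lam_comp (path_energy P2 _) (beD t).
  by deriv; field; rewrite sn0 sn1.
- move=> t t0; rewrite /S !(path_energy_left P1) ?al0 // !(path_energy_left P2) //.
    by apply: be0; lra.
  by apply: be0; lra.
- move=> t t1; rewrite /S !(path_energy_right P2) ?be1 // !(path_energy_right P1) //.
    by apply: al1; lra.
  by apply: al1; lra.
- have e1_ge0 u := dual_le_ge0 (path_dual P1 u).
  have e2_ge0 u := dual_le_ge0 (path_dual P2 u).
  have i0 : 0 <= (s ^+ 2)^-1 by rewrite invr_ge0 sqr_ge0.
  have i1 : 0 <= ((1 - s) ^+ 2)^-1 by rewrite invr_ge0 sqr_ge0.
  move=> t; have [ts|/ltW ts] := leP t s.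
    have vE : v t = fun x => s^-1 * v1 (al t) x.
      by apply/funext => x; rewrite /v (path_flat P2) ?mul0r ?addr0 1?mulrC // be0.
    rewrite rhoL // vE; apply: dual_le_mono (dual_leZ Q_ge0 pi_gt0 _ (path_dual P1 (al t))).
    by rewrite exprVn mulrC /e lerDl mulr_ge0.
  have vE : v t = fun x => (1 - s)^-1 * v2 (be t) x.
    by apply/funext => x; rewrite /v (path_flat P1) ?mul0r ?add0r 1?mulrC // al1 ?orbT.
  rewrite rhoR // vE; apply: dual_le_mono (dual_leZ Q_ge0 pi_gt0 _ (path_dual P2 (be t))).
  by rewrite exprVn mulrC /e lerDr mulr_ge0.
Qed.

(** The linear interpolation is slowed down at both ends by [b] = 3 t^2 - 2 t^3 and mixed with the
    constant density 1 with weight [c] = [a]^2. The velocity is of order [a], hence its squared norm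
    divided by [c] stays bounded. *)
Lemma W_finite r0 r1 : density pi r0 -> density pi r1 ->
  exists C : R, (W Q pi r0 r1 ^+ 2 <= C%:E)%E.
Proof.
move=> d0 d1; have [K K0 hK] := dual_le_uniform Q_ge0 pi_gt0 pi_sum Q_rev Q_irr.
pose B := \sum_y (pi y)^-1.
have [r00 r0m] := d0; have [r10 r1m] := d1.
have r0B x : r0 x <= B by exact: density_le.
have r1B x : r1 x <= B by exact: density_le.
pose a (t : R) := t * (1 - t).
pose b (t : R) := 3 * (t * t) - 2 * (t * (t * t)).
pose c (t : R) := a t * a t.
pose db (t : R) := 6 * a t.
pose dc (t : R) := 2 * a t * (1 - 2 * t).
pose lin (t : R) x := (1 - b t) * r0 x + b t * r1 x.
pose rho (t : R) x := (1 - c t) * lin t x + c t.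
pose v (t : R) x := (1 - c t) * (db t * (r1 x - r0 x)) + dc t * (1 - lin t x).
pose M := 6 * B + 2 * (1 + B).
have bD (t : R) : is_derive t 1 b (db t) by rewrite /b; deriv; rewrite /db /a; ring.
have cD (t : R) : is_derive t 1 c (dc t) by rewrite /c /a; deriv; rewrite /dc /a; ring.
have a01 t : 0 <= t <= 1 -> 0 <= a t <= 1.
  by rewrite /a => t01; apply/andP; split; nra.
have b01 t : 0 <= t <= 1 -> 0 <= b t <= 1.
  move=> /andP[t0 t1]; have -> : b t = t * t * (1 + 2 * (1 - t)) by rewrite /b; ring.
  apply/andP; split; first by rewrite !mulr_ge0 //; lra.
  have -> : t * t * (1 + 2 * (1 - t)) = 1 - (1 - t) ^+ 2 * (1 + 2 * t) by ring.
  by rewrite gerBl mulr_ge0 ?sqr_ge0 //; lra.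
have c01 t : 0 <= t <= 1 -> 0 <= c t <= 1.
  by move=> /a01 /andP[h0 h1]; rewrite /c (mulr_ge0 h0 h0) (mulr_ile1 h0 h0 h1 h1).
have c_gt0 t : 0 < t < 1 -> 0 < c t.
  by case/andP => t0 t1; rewrite /c /a !mulr_gt0 // subr_gt0.
have linD t : 0 <= t <= 1 -> density pi (lin t).
  move=> /b01 /andP[b0 b1]; split.
    by move=> x; rewrite /lin addr_ge0 // mulr_ge0 // subr_ge0.
  transitivity ((1 - b t) * (\sum_x r0 x * pi x) + b t * \sum_x r1 x * pi x).
    by rewrite !big_distrr -big_split; apply: eq_bigr => x _ /=; rewrite /lin; ring.
  by rewrite r0m r1m; ring.
have rho_dens t : 0 <= t <= 1 -> density pi (rho t).
  move=> t01; have /andP[c0 c1] := c01 t t01; have [l0 l1] := linD t t01; split.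
    by move=> x; rewrite /rho addr_ge0 // mulr_ge0 // subr_ge0.
  transitivity ((1 - c t) * (\sum_x lin t x * pi x) + c t * \sum_x pi x).
    by rewrite !big_distrr -big_split; apply: eq_bigr => x _ /=; rewrite /rho; ring.
  by rewrite l1 pi_sum; ring.
have rhoD (t : R) x : is_derive t 1 (rho^~ x) (v t x).
  by have h1 := bD t; have h2 := cD t; rewrite /rho /lin; deriv; rewrite /v /lin; ring.
have vc (t : R) x : v s x @[s --> t] --> v t x.
  by have h1 := bD t; have h2 := cD t; apply: (@is_derive_cvg _ (v^~ x)).
have rho_gt0 t x : 0 < t < 1 -> 0 < rho t x.
  move=> t01; have c0 := c_gt0 t t01.
  have t01' : 0 <= t <= 1 by lra.
  have /andP[_ c1] := c01 t t01'; have [l0 _] := linD t t01'.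
  by rewrite /rho ltr_wpDl // mulr_ge0 // subr_ge0.
have m0 t : 0 <= t <= 1 -> \sum_x v t x * pi x = 0.
  move=> /linD [_ l1].
  transitivity ((1 - c t) * (db t * (\sum_x r1 x * pi x - \sum_x r0 x * pi x)) +
      dc t * (\sum_x pi x - \sum_x lin t x * pi x)).
    rewrite -!sumrB !big_distrr -big_split; apply: eq_bigr => x _ /=.
    by rewrite /v; ring.
  by rewrite r0m r1m l1 pi_sum; ring.
have vB t x : 0 <= t <= 1 -> `|v t x| <= M * a t.
  move=> t01; have /andP[a0 a1] := a01 t t01; have /andP[c0 c1] := c01 t t01.
  have [l0 l1] := linD t t01; have lB := density_le pi_gt0 x (linD t t01); rewrite -/B in lB.
  apply: le_trans (ler_normD _ _) _.
  have h1 : `|r1 x - r0 x| <= B.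
    rewrite ler_norml; have := r00 x; have := r10 x; have := r0B x; have := r1B x; lra.
  have h2 : `|1 - lin t x| <= 1 + B.
    rewrite ler_norml; have := l0 x; lra.
  have h3 : `|1 - 2 * t| <= 1 by rewrite ler_norml; lra.
  have -> : M * a t = 6 * a t * B + 2 * a t * (1 + B) by rewrite /M; ring.
  have B0 : 0 <= B by apply: le_trans (normr_ge0 _) h1.
  have db0 : 0 <= db t by rewrite /db mulr_ge0.
  have c1' : 0 <= 1 - c t by rewrite subr_ge0.
  apply: lerD.
    rewrite normrM (ger0_norm c1') normrM (ger0_norm db0).
    apply: le_trans (ler_wpM2l db0 h1).
    by rewrite ler_piMl ?gerBl // mulr_ge0.
  have a20 : 0 <= 2 * a t by rewrite mulr_ge0.
  rewrite normrM; apply: ler_pM => //.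
  rewrite /dc normrM (ger0_norm a20) -[leRHS]mulr1; exact: ler_wpM2l.
have dual t : 0 < t < 1 -> dual_le Q pi (rho t) (v t) (K * M ^+ 2).
  move=> t01; have t01' : 0 <= t <= 1 by lra.
  have c0 := c_gt0 t t01; have c01' := c01 t t01'; have [l0 _] := linD t t01'.
  have cn0 : c t != 0 by rewrite gt_eqF.
  (* The whole velocity is attributed to the constant component of the mixture, where the dual norm
     is under control, and none to the possibly degenerate one. *)
  have n0 : dual_le Q pi (lin t) (fun=> 0) 0.
    move=> phi; rewrite /pairing big1; last by move=> x _; rewrite !mul0r.
    by rewrite mulr0 sub0r oppr_le0; exact: dirichlet_ge0.
  have n1 : dual_le Q pi (fun=> 1) (fun x => v t x / c t) (K * (M * a t / c t) ^+ 2).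
    apply: hK => [|x].
      under eq_bigr do rewrite mulrAC.
      by rewrite -big_distrl /= m0 // mul0r.
    by rewrite normrM normfV (gtr0_norm c0) ler_wpM2r ?invr_ge0 ?(ltW c0) // vB.
  have rho0 x := rho_gt0 t x t01.
  have := dual_le_mix Q_ge0 pi_gt0 rho0 l0 (fun=> ler01) c01' _ _ n0 n1.
  move=> /(_ (v t)) m; apply: dual_le_mono (m _ _); first last.
  - by move=> x; field.
  - by move=> x; rewrite /rho mulr1.
  rewrite mulr0 add0r le_eqVlt; apply/orP; left; apply/eqP.
  have an0 : a t != 0 by apply/eqP => h; move: cn0; rewrite /c h mul0r eqxx.
  by rewrite /c; field.
have rho0E : rho 0 = r0.
  by apply/funext => x; rewrite /rho /lin /c /a /b; ring.
have rho1E : rho 1 = r1.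
  by apply/funext => x; rewrite /rho /lin /c /a /b; ring.
have rhoc x : {within `[0, 1], continuous (rho^~ x)}.
  by apply: within_itv_cvg => t _; exact: is_derive_cvg (rhoD t x).
have SD (t : R) : 0 < t < 1 -> is_derive t 1 (fun t => K * M ^+ 2 * t) (K * M ^+ 2).
  by move=> _; deriv; ring.
have Sc : {within `[0, 1], continuous (fun t => K * M ^+ 2 * t)}.
  by apply: within_itv_cvg => t _; apply: (cvgM (cvg_cst _)); exact: cvg_id.
exists (K * M ^+ 2 * 1 - K * M ^+ 2 * 0).
exact: (W_sqr_le_curve Q_ge0 pi_gt0 pi_sum Q_rev Q_irr rho0E rho1E rho_dens rhoc
  (fun t x _ => rhoD t x) (fun t x _ => vc t x) rho_gt0 Sc SD dual).
Qed.

End Convexity.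

(** * From the evolution variational inequality to convexity of the entropy *)

Section RicciCriterion.
Context {R : realType} {X : finType}.
Variables (Q : X -> X -> R) (pi : X -> R).
Hypothesis Q_ge0 : forall x y, 0 <= Q x y.
Hypothesis pi_gt0 : forall x, 0 < pi x.
Hypothesis pi_sum : \sum_x pi x = 1.
Hypothesis Q_rev : forall x y, Q x y * pi x = Q y x * pi y.
Hypothesis Q_irr : forall phi : X -> R, (forall x y, 0 < Q x y -> phi x = phi y) ->
  forall x y, phi x = phi y.
Variable kappa : R.
Hypothesis kappa_ge0 : 0 <= kappa.
Hypothesis bochner_ge : forall rho psi, (forall x, 0 < rho x) ->
  2 * kappa * dirichlet Q pi rho psi psi <= bochner Q pi rho psi.

(** The absolute value expresses the limit from the right on a punctured neighbourhood and keeps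
    every density nonnegative. *)
Lemma cvg_heat0 (r : X -> R) : density pi r ->
  entropy pi (heat Q `|h| r) @[h --> (0 : R)^'] --> entropy pi r.
Proof.
move=> [r0 _]; rewrite -{2}(heat0 Q r).
have hc x : heat Q `|h| r x @[h --> (0 : R)^'] --> heat Q 0 r x.
  have n0 : `|h| @[h --> (0 : R)^'] --> (0 : R).
    rewrite -[X in _ --> X](@normr0 _ R).
    by apply: cvg_norm; exact: cvg_within.
  exact: (cvg_lam_comp n0 (is_derive_cvg (is_derive_heat Q_ge0 0 r x))).
apply: cvg_entropy => // [h x|x]; first exact: heat_ge0.
by rewrite heat0.
Qed.

(** The flow is applied to the curves from both ends to [r]; they then meet at the same density and
    can be concatenated at time s. This is where the triangle inequality enters. *)
Lemma W_flow_concat r0 r r1 (s h w C1 C2 : R) : 0 < s < 1 -> 0 <= h -> kappa * h <= 1 ->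
  W Q pi r0 r1 = w%:E -> 0 <= w ->
  (W Q pi r0 r ^+ 2 <= C1%:E)%E -> (W Q pi r1 r ^+ 2 <= C2%:E)%E ->
  w ^+ 2 <= (expR (- (kappa * h)) * C1
      - 2 * h * (entropy pi (heat Q h r) - entropy pi r0)) / s
    + (expR (- (kappa * h)) * C2
      - 2 * h * (entropy pi (heat Q h r) - entropy pi r1)) / (1 - s).
Proof.
move=> /andP[s0 s1] h0 hk wE w0 c1 c2; apply/ler_addgt0Pr => d d0.
have s1' : 0 < 1 - s by rewrite subr_gt0.
have i0 : 0 < s^-1 by rewrite invr_gt0.
have i1 : 0 < (1 - s)^-1 by rewrite invr_gt0.
(* Curves exist only for costs strictly above the infimum, so each half loses [eta] before the flow
   and [eta] after it; the weights 1 / s and 1 / (1 - s) add these losses up to at most d. *)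
pose eta := d / (2 * (s^-1 + (1 - s)^-1)).
have eta0 : 0 < eta by rewrite /eta divr_gt0 // mulr_gt0 // addr_gt0.
have lt_eta (C : R) : (C%:E < (C + eta)%:E)%E by rewrite lte_fin ltrDl.
have step r' C' : (W Q pi r' r ^+ 2 <= C'%:E)%E ->
    transportable Q pi r' (heat Q h r) (expR (- (kappa * h)) * (C' + eta)
      - 2 * h * (entropy pi (heat Q h r) - entropy pi r') + eta).
  move=> c'; have t' := transportable_of_W Q_ge0 pi_gt0 Q_rev (le_lt_trans c' (lt_eta C')).
  apply: transportable_of_W => //.
  apply: le_lt_trans (lt_eta _).
  exact: (W_flow Q_ge0 pi_gt0 pi_sum Q_rev Q_irr kappa_ge0 bochner_ge t').
have := transportable_trans Q_ge0 pi_gt0 (s := s) _ (step _ _ c1)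
  (transportable_sym Q_ge0 pi_gt0 (step _ _ c2)).
rewrite s0 s1 => /(_ isT) t01.
have k0 : kappa * 0 <= 1 by rewrite mulr0.
(* At time 0 the flow estimate says that a transport cost bounds the squared distance. *)
have := W_flow Q_ge0 pi_gt0 pi_sum Q_rev Q_irr kappa_ge0 bochner_ge t01 (lexx 0) k0.
rewrite heat0 wE -EFin_expe lee_fin mulr0 oppr0 expR0 mul1r !mulr0 mul0r subr0.
move/le_trans; apply.
have e1 : expR (- (kappa * h)) <= 1 by rewrite expR_le1 oppr_le0 mulr_ge0.
have e2 : expR (- (kappa * h)) * eta <= eta by rewrite ler_piMl // ltW.
have dE : d = 2 * eta * s^-1 + 2 * eta * (1 - s)^-1.
  by rewrite /eta; field; rewrite !gt_eqF //; lra.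
clear wE c1 c2 lt_eta step t01; move: eta dE e2 eta0 => x dE e2 x0.
have := ler_wpM2r (ltW i0) e2; have := ler_wpM2r (ltW i1) e2; lra.
Qed.

Lemma Ric_ge_of_bochner kappa' : kappa' <= kappa -> Ric_ge Q pi kappa'.
Proof.
move=> kk rho [dens geo] s s01.
have d0 : density pi (rho 0) by apply: dens; rewrite lexx ler01.
have d1 : density pi (rho 1) by apply: dens; rewrite lexx ler01.
have [C WC] := W_finite Q_ge0 pi_gt0 pi_sum Q_rev Q_irr d0 d1.
have W0 : (0 <= W Q pi (rho 0%R) (rho 1%R))%E by exact: sqrte_ge0.
have [w wE] : exists w : R, W Q pi (rho 0) (rho 1) = w%:E.
  move: W0 WC; case: (W _ _ _ _) => [w _ _| _ |]; [by exists w| |by []].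
  by rewrite expe2 /= mulyy.
have w0 : 0 <= w by move: W0; rewrite wE lee_fin.
rewrite wE -EFin_expe -EFinM -EFinB lee_fin.
have [->|s0] := eqVneq s 0; first by rewrite !(mulr0, mul0r, subr0) mul1r addr0.
have [->|s1] := eqVneq s 1; first by rewrite subrr !(mulr0, mul0r, subr0) mul1r add0r.
have s01' : 0 < s < 1.
  by rewrite !lt_neqAle eq_sym s0 s1 /=; move: s01.
have n1 : `|0 - s| = s by rewrite sub0r normrN ger0_norm //; lra.
have n2 : `|1 - s| = 1 - s by rewrite ger0_norm //; lra.
have c1 : (W Q pi (rho 0%R) (rho s) ^+ 2 <= ((s * w) ^+ 2)%:E)%E.
  rewrite geo // ?lexx ?ler01 // wE n1 -EFinM -EFin_expe.
  exact: lexx.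
have c2 : (W Q pi (rho 1%R) (rho s) ^+ 2 <= (((1 - s) * w) ^+ 2)%:E)%E.
  rewrite geo // ?lexx ?ler01 // wE n2 -EFinM -EFin_expe.
  exact: lexx.
set H0 := entropy pi (rho 0); set H1 := entropy pi (rho 1).
have key h : 0 < h -> kappa * h <= 1 -> s * (1 - s) * kappa * w ^+ 2 / (1 + kappa * h) <=
    2 * ((1 - s) * H0 + s * H1 - entropy pi (heat Q h (rho s))).
  move=> h0 hk.
  have := W_flow_concat s01' (ltW h0) hk wE w0 c1 c2; rewrite -/H0 -/H1.
  set Hh := entropy pi (heat Q h (rho s)) => ineq.
  have hk0 : 0 <= kappa * h by rewrite mulr_ge0 // ltW.
  have k1 : 0 < 1 + kappa * h by rewrite ltr_wpDr.
  (* This rational bound makes the difference quotient explicit: (1 - 1 / (1 + kappa h)) / h = kappa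
     / (1 + kappa h). *)
  have ex : expR (- (kappa * h)) <= (1 + kappa * h)^-1.
    rewrite expRN lef_pV2 ?posrE ?expR_gt0 //; exact: expR_ge1Dx.
  have p0 : 0 < s * (1 - s) by rewrite mulr_gt0; lra.
  have w2 := sqr_ge0 w.
  have := ler_wpM2l (ltW p0) ineq.
  (* The squared lengths of the two pieces of the geodesic, divided by s and 1 - s, add up to w^2,
     so the terms of order 0 in h cancel. *)
  have -> : s * (1 - s) * ((expR (- (kappa * h)) * (s * w) ^+ 2 - 2 * h * (Hh - H0)) / s +
      (expR (- (kappa * h)) * ((1 - s) * w) ^+ 2 - 2 * h * (Hh - H1)) / (1 - s)) =
      s * (1 - s) * w ^+ 2 * expR (- (kappa * h))
      + h * (2 * ((1 - s) * H0 + s * H1 - Hh)).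
    by field; rewrite !gt_eqF //; lra.
  have := ler_wpM2l (mulr_ge0 (ltW p0) w2) ex.
  move=> h1 h2; rewrite -(ler_pM2l h0).
  have -> : h * (s * (1 - s) * kappa * w ^+ 2 / (1 + kappa * h)) =
      s * (1 - s) * w ^+ 2 - s * (1 - s) * w ^+ 2 / (1 + kappa * h) by field; lra.
  by lra.
have lim0 : 1 + kappa * `|h| @[h --> (0 : R)^'] --> (1 : R).
  have n0 : `|h| @[h --> (0 : R)^'] --> (0 : R).
    rewrite -[X in _ --> X](@normr0 _ R).
    by apply: cvg_norm; exact: cvg_within.
  have h1 : 1 + kappa * `|h| @[h --> (0 : R)^'] --> 1 + kappa * 0.
    apply: cvgD; first exact: cvg_cst.
    by apply: cvgM; [exact: cvg_cst|exact: n0].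
  by rewrite mulr0 addr0 in h1.
have lim1 : s * (1 - s) * kappa * w ^+ 2 / (1 + kappa * `|h|) @[h --> (0 : R)^'] -->
    s * (1 - s) * kappa * w ^+ 2 / 1.
  by apply: cvgM; [exact: cvg_cst|exact: (cvgV (oner_neq0 R) lim0)].
have lim2 : 2 * ((1 - s) * H0 + s * H1 - entropy pi (heat Q `|h| (rho s))) @[h --> (0 : R)^'] -->
    2 * ((1 - s) * H0 + s * H1 - entropy pi (rho s)).
  apply: cvgM; first exact: cvg_cst.
  by apply: cvgB; [exact: cvg_cst|apply: cvg_heat0; exact: dens].
have lim : s * (1 - s) * kappa * w ^+ 2 / 1 <=
    2 * ((1 - s) * H0 + s * H1 - entropy pi (rho s)).
  apply: (ler_cvg_to lim1 lim2); near=> h.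
  have hn0 : h != 0 by near: h; exact: nbhs_dnbhs_neq.
  have h1 : `|h| < (1 + kappa)^-1.
    by near: h; apply: dnbhs0_lt; rewrite invr_gt0 ltr_wpDr.
  apply: key; first by rewrite normr_gt0.
  have k1 : 0 < 1 + kappa by rewrite ltr_wpDr.
  have : (1 + kappa) * `|h| <= 1 by rewrite mulrC -ler_pdivlMr // div1r ltW.
  by have := normr_ge0 h; lra.
rewrite divr1 in lim.
have : s * (1 - s) * w ^+ 2 * kappa' <= s * (1 - s) * w ^+ 2 * kappa.
  by rewrite ler_wpM2l // mulr_ge0 ?sqr_ge0 // mulr_ge0; lra.
lra.
Unshelve. all: by end_near. Qed.

End RicciCriterion.

(** * Bochner's inequality for spin flips *)

Section RealInequalities.
Context {R : realType}.
Implicit Types a b c d : R.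

(* Here U, V are the increments along two parallel edges of a square, S, T those
   along the two other edges. *)
Lemma square_ge0 a b c d (U V S T : R) : 0 < a -> 0 < b -> 0 < c -> 0 < d ->
  U + T = S + V ->
  0 <= (U ^+ 2 * theta1 a b * (c - a) + 2 * U * S * theta a b)
     + (U ^+ 2 * theta1 b a * (d - b) - 2 * U * T * theta b a)
     + (V ^+ 2 * theta1 c d * (a - c) - 2 * V * S * theta c d)
     + (V ^+ 2 * theta1 d c * (b - d) + 2 * V * T * theta d c).
Proof.
move=> a0 b0 c0 d0 e.
(* Each parallel edge is compared with the tangent plane at the other one; what remains is (theta(a,
   b) + theta(c, d)) (U - V)^2. *)
have h1 := theta_le_tangent a0 b0 (ltW c0) (ltW d0).
have h2 := theta_le_tangent c0 d0 (ltW a0) (ltW b0).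
rewrite (theta_sym (ltW b0) (ltW a0)) (theta_sym (ltW d0) (ltW c0)).
have e1 := thetaE a0 b0; have e2 := thetaE c0 d0.
have t1 := theta_ge0 a b; have t2 := theta_ge0 c d.
have {e}-> : T = S + V - U by rewrite -e; ring.
move: h1 h2 e1 e2 t1 t2.
move: (theta a b) (theta c d) (theta1 a b) (theta1 b a) (theta1 c d) (theta1 d c).
move=> t1 t2 p q p' q' h1 h2 e1 e2 t1_ge0 t2_ge0.
have := ler_wpM2l (sqr_ge0 U) h1; have := ler_wpM2l (sqr_ge0 V) h2.
have := mulr_ge0 (addr_ge0 t1_ge0 t2_ge0) (sqr_ge0 (U - V)).
have f1 : U ^+ 2 * t1 = U ^+ 2 * (p * a + q * b) by rewrite e1.
have f2 : V ^+ 2 * t2 = V ^+ 2 * (p' * c + q' * d) by rewrite e2.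
by clear h1 h2 e1 e2; lra.
Qed.

(** The coefficient of the squared increment in the diagonal Bochner term at the flipped point.
    Added to the off-diagonal term, it moves the argument of the tangent plane from (c - a, 0) to (c
    + a, a + b). *)
Definition edge_weight a b : R := 2 * theta1 a b * a + theta1 b a * (a + b).

(** By the tangent planes at (a, b) and (a, c), the squares have coefficient at least theta(c + a, a
    + b). By superadditivity this dominates theta(a, b) + theta(a, c), and a multiple of (U + V)^2
    remains. *)
Lemma cross_ge0 a b c (U V : R) : 0 < a -> 0 < b -> 0 < c ->
  0 <= (U ^+ 2 * theta1 a b * (c - a) + 2 * U * V * theta a b)
     + (V ^+ 2 * theta1 a c * (b - a) + 2 * V * U * theta a c)
     + (U ^+ 2 * edge_weight a b + V ^+ 2 * edge_weight a c).
Proof.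
move=> a0 b0 c0; rewrite /edge_weight.
have ac0 : 0 < c + a by rewrite addr_gt0.
have ab0 : 0 < a + b by rewrite addr_gt0.
have h1 := theta_le_tangent a0 b0 (ltW ac0) (ltW ab0).
have h2 := theta_le_tangent a0 c0 (ltW ab0) (ltW ac0).
rewrite (theta_sym (ltW ab0) (ltW ac0)) in h2.
have h3 := theta_le_tangent ac0 ab0 (ltW a0) (ltW b0).
have h4 := theta_le_tangent ac0 ab0 (ltW c0) (ltW a0).
rewrite (theta_sym (ltW c0) (ltW a0)) in h4.
have h5 := thetaE ac0 ab0.
have t1 := theta_ge0 a b; have t2 := theta_ge0 a c.
(* Superadditivity of [theta], from its concavity and homogeneity. *)
have sup : theta a b + theta a c <= theta (c + a) (a + b).
  rewrite h5; apply: le_trans (lerD h3 h4) _.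
  by rewrite le_eqVlt; apply/orP; left; apply/eqP; ring.
have k1 := ler_wpM2l (sqr_ge0 U) h1; have k2 := ler_wpM2l (sqr_ge0 V) h2.
have k3 := mulr_ge0 (addr_ge0 t1 t2) (sqr_ge0 (U + V)).
have k4 := ler_wpM2l (addr_ge0 (sqr_ge0 U) (sqr_ge0 V)) sup.
clear h1 h2 h3 h4 h5 sup t1 t2; move: k1 k2 k3 k4.
move: (theta a b) (theta a c) (theta (c + a) (a + b)) => t1 t2 t3.
move: (theta1 a b) (theta1 b a) (theta1 a c) (theta1 c a) => p q p' q'.
clear; lra.
Qed.

Lemma edge_weightE a b : 0 < a -> 0 < b ->
  edge_weight a b = theta a b + theta a b ^+ 2 / b.
Proof.
move=> a0 b0; rewrite -(theta1_add a0 b0) {1}(thetaE a0 b0) /edge_weight.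
by field; rewrite gt_eqF.
Qed.

Lemma edge_weight_ge0 a b : 0 < a -> 0 < b -> 0 <= edge_weight a b.
Proof.
move=> a0 b0; rewrite edge_weightE // addr_ge0 ?theta_ge0 // divr_ge0 ?(ltW b0) //.
exact: sqr_ge0.
Qed.

(** Written as theta + theta^2 / b, the weight yields two equal shares: u^2 + v^2 >= 2 u v, and u^2
    / b + v^2 / a >= 2 u v / sqrt (a b) with theta >= sqrt (a b). *)
Lemma edge_weight_amgm a b (u v : R) : 0 < a -> 0 < b -> 0 <= u -> 0 <= v ->
  4 * (u * v * theta a b) <= u ^+ 2 * edge_weight a b + v ^+ 2 * edge_weight b a.
Proof.
move=> a0 b0 u0 v0; rewrite !edge_weightE // (theta_sym (ltW b0) (ltW a0)).
have t0 := theta_ge0 a b; have ts := theta_sqr_ge a0 b0.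
move: t0 ts; move: (theta a b) => t t0 ts.
have ab0 : 0 < a * b by rewrite mulr_gt0.
pose Y := a * u ^+ 2 + b * v ^+ 2.
have Y0 : 0 <= Y by rewrite addr_ge0 // mulr_ge0 ?sqr_ge0 // ltW.
have uv0 : 0 <= u * v by rewrite mulr_ge0.
(* Both sides are compared after squaring, so that sqrt (a b) does not appear. *)
have hY : 2 * (u * v) * (a * b) <= t * Y.
  rewrite -ler_sqr ?nnegrE ?mulr_ge0 ?(ltW a0) ?(ltW b0) //.
  have : 4 * (a * b) * (u * v) ^+ 2 <= Y ^+ 2.
    have -> : Y ^+ 2 = 4 * (a * b) * (u * v) ^+ 2 + (a * u ^+ 2 - b * v ^+ 2) ^+ 2.
      by rewrite /Y; ring.
    by rewrite lerDl sqr_ge0.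
  move=> h; rewrite !exprMn.
  have q : 0 <= 4 * (a * b) * (u * v) ^+ 2.
    by apply: mulr_ge0; [rewrite mulr_ge0 // ltW|exact: sqr_ge0].
  have := ler_pM (ltW ab0) q ts h.
  by apply: le_trans; rewrite le_eqVlt; apply/orP; left; apply/eqP; ring.
have -> : u ^+ 2 * (t + t ^+ 2 / b) + v ^+ 2 * (t + t ^+ 2 / a) =
    (u ^+ 2 + v ^+ 2) * t + t * (t * Y / (a * b)).
  by rewrite /Y; field; rewrite !gt_eqF.
have : 2 * (u * v) <= t * Y / (a * b) by rewrite ler_pdivlMr.
move=> /(ler_wpM2l t0) h.
have := mulr_ge0 t0 (sqr_ge0 (u - v)); lra.
Qed.

End RealInequalities.

Section Flip.
Context {n : nat}.
Implicit Types (x y : config n) (i j : 'I_n).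

Definition flip i x : config n := [ffun k => if k == i then ~~ x k else x k].

Lemma flipK i : involutive (flip i).
Proof. by move=> x; apply/ffunP => k; rewrite !ffunE; case: eqP => // _; rewrite negbK. Qed.

Lemma flipC i j x : flip i (flip j x) = flip j (flip i x).
Proof. by apply/ffunP => k; rewrite !ffunE; case: eqP => _; case: eqP. Qed.

Lemma flip_inj x : injective (flip^~ x).
Proof.
move=> i j /ffunP /(_ i); rewrite !ffunE eqxx; case: eqP => // _.
by case: (x i).
Qed.

Lemma differ_in_oneP x y : reflect (exists i, y = flip i x) (differ_in_one x y).
Proof.
apply: (iffP cards1P) => [[i /setP e]|[i ->]]; exists i.
  apply/ffunP => k; rewrite ffunE; have := e k; rewrite !inE.
  by case: (k == i); case: (x k); case: (y k).
apply/setP => k; rewrite !inE ffunE; case: (k == i); last by rewrite eqxx.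
by case: (x k).
Qed.

Lemma sum_flip (R : nmodType) (i : 'I_n) (f : config n -> R) :
  \sum_x f (flip i x) = \sum_x f x.
Proof. by rewrite [RHS](reindex_inj (inv_inj (flipK i))). Qed.

End Flip.

(** * Bochner's formula on the hypercube *)

Section FlipBochner.
Context {R : realType} {n : nat}.
Variables (Q : config n -> config n -> R) (w : config n -> R) (ep : R).
Let pi x : R := w x ^+ 2.
Hypothesis w_gt0 : forall x, 0 < w x.
Hypothesis Q_rev : forall x y, Q x y * pi x = Q y x * pi y.
Hypothesis Q_sum : forall (f : config n -> R) x,
  \sum_y Q x y * f y = \sum_i w (flip i x) / w x * f (flip i x).

(* The part of the coefficient of the (i, j) term that is not constant on the
   square spanned by the flips i and j. *)
Definition excess x i j : R := w (flip i x) * w (flip j x) -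
  Num.min (w (flip i x) * w (flip j x)) (w x * w (flip i (flip j x))).

Hypothesis excess_le : forall x i, \sum_(j | j != i) excess x i j <= ep * pi x.
Hypothesis ep_le1 : ep <= 1.

Variables (rho psi : config n -> R).
Hypothesis rho_gt0 : forall x, 0 < rho x.

Let U i x : R := psi (flip i x) - psi x.
Let p i x : R := theta1 (rho x) (rho (flip i x)).
Let th i x : R := theta (rho x) (rho (flip i x)).
Let ew i x : R := edge_weight (rho x) (rho (flip i x)).
(** The contribution of the ordered pair of flips (i, j) at x, to be weighted by pi(x) Q(x, x^i)
    Q(x, x^j). *)
Let E i j x : R := U i x ^+ 2 * p i x * (rho (flip j x) - rho x) + 2 * U i x * U j x * th i x.

Let wn0 x : w x != 0. Proof. by rewrite gt_eqF. Qed.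

Let UN i x : U i (flip i x) = - U i x.
Proof. by rewrite /U flipK opprB. Qed.

Let laplacianE f x : laplacian Q f x = \sum_i w (flip i x) / w x * (f (flip i x) - f x).
Proof. by rewrite /laplacian (Q_sum (fun y => f y - f x)). Qed.

Let sum_edges (f : config n -> R) x :
  \sum_y f y * Q x y * pi x = \sum_i w x * w (flip i x) * f (flip i x).
Proof.
transitivity (pi x * \sum_y Q x y * f y).
  by rewrite big_distrr; apply: eq_bigr => y _ /=; ring.
rewrite Q_sum big_distrr; apply: eq_bigr => i _ /=.
by rewrite /pi; field.
Qed.

Let dirichletE : dirichlet Q pi rho psi psi =
  2^-1 * \sum_i \sum_x w x * w (flip i x) * (U i x ^+ 2 * th i x).
Proof.
rewrite exchange_big; congr (_ * _); apply: eq_bigr => x _.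
rewrite (sum_edges (fun y => (psi x - psi y) * (psi x - psi y) * theta (rho x) (rho y))).
by apply: eq_bigr => i _; rewrite /U /th; ring.
Qed.

(** Exchanging the two ends of each edge turns the second [theta1] term into the first, which uses
    up the factor 1/2. *)
Let bochner_first : 2^-1 * (\sum_x \sum_y (psi x - psi y) ^+ 2 *
    (theta1 (rho x) (rho y) * laplacian Q rho x + theta1 (rho y) (rho x) * laplacian Q rho y)
     * Q x y * pi x) =
  \sum_i \sum_j \sum_x w (flip i x) * w (flip j x) *
    (U i x ^+ 2 * p i x * (rho (flip j x) - rho x)).
Proof.
pose G i x := w x * w (flip i x) * (U i x ^+ 2 * p i x * laplacian Q rho x).
transitivity (\sum_i \sum_x G i x).
  transitivity (2^-1 * \sum_i (\sum_x G i x + \sum_x G i (flip i x))).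
    congr (_ * _); under [RHS]eq_bigr do rewrite -big_split.
    rewrite [RHS]exchange_big; apply: eq_bigr => x _.
    rewrite (sum_edges (fun y => (psi x - psi y) ^+ 2 *
      (theta1 (rho x) (rho y) * laplacian Q rho x + theta1 (rho y) (rho x) * laplacian Q rho y))).
    by apply: eq_bigr => i _; rewrite /G UN /p !flipK /U /=; ring.
  under eq_bigr do rewrite sum_flip.
  by rewrite big_distrr; apply: eq_bigr => i _ /=; field.
apply: eq_bigr => i _; rewrite [RHS]exchange_big; apply: eq_bigr => x _.
rewrite /G laplacianE !big_distrr; apply: eq_bigr => j _ /=.
by field.
Qed.

Let bochner_second : dirichlet Q pi rho psi (laplacian Q psi) =
  - \sum_i \sum_j \sum_x w (flip i x) * w (flip j x) * (U i x * U j x * th i x).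
Proof.
rewrite -(pairing_flux Q_rev); last by move=> x; exact: ltW.
transitivity (\sum_x (\sum_i w x * w (flip i x) * - (U i x * th i x)) *
    \sum_j w (flip j x) / w x * U j x).
  apply: eq_bigr => x _; rewrite mulrAC laplacianE; congr (_ * _).
  rewrite big_distrl (sum_edges (fun y => (psi x - psi y) * theta (rho x) (rho y))).
  by apply: eq_bigr => i _; rewrite /U /th /=; ring.
rewrite -sumrN; under [RHS]eq_bigr do rewrite exchange_big -sumrN /=.
rewrite [RHS]exchange_big; apply: eq_bigr => x _; rewrite big_distrl; apply: eq_bigr => i _ /=.
by rewrite big_distrr -sumrN; apply: eq_bigr => j _ /=; field.
Qed.

Let bochnerE : bochner Q pi rho psi =
  \sum_i \sum_j \sum_x w (flip i x) * w (flip j x) * E i j x.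
Proof.
rewrite /bochner bochner_first bochner_second mulrN opprK big_distrr -big_split.
apply: eq_bigr => i _ /=; rewrite big_distrr -big_split; apply: eq_bigr => j _ /=.
rewrite big_distrr -big_split; apply: eq_bigr => x _ /=.
by rewrite /E; ring.
Qed.

Let m x i j : R := Num.min (w (flip i x) * w (flip j x)) (w x * w (flip i (flip j x))).

Let mN x i j : m (flip i x) i j = m x i j.
Proof. by rewrite /m flipK (flipC i j) flipK minC (flipC j i). Qed.

Let mC x i j : m x i j = m x j i.
Proof. by rewrite /m [w (flip i x) * _]mulrC (flipC i j). Qed.

Let m_ge0 x i j : 0 <= m x i j.
Proof. by rewrite /m le_min !mulr_ge0 // ltW. Qed.

Let excessC x i j : excess x i j = excess x j i.
Proof. by rewrite /excess [w (flip i x) * _]mulrC (flipC i j). Qed.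

Let excess_ge0 x i j : 0 <= excess x i j.
Proof. by rewrite /excess subr_ge0 ge_min lexx. Qed.

(** As [m] takes the same value at the four corners of a square, the sum can be averaged over the
    group generated by the two flips; [square_ge0] then applies on every square. *)
Let invariant_part i j : 0 <= \sum_x m x i j * E i j x.
Proof.
have S4 (f : config n -> R) : \sum_x (f x + f (flip i x) + f (flip j x) + f (flip i (flip j x)))
    = 4 * \sum_x f x.
  have sij : \sum_x f (flip i (flip j x)) = \sum_x f x.
    by rewrite (sum_flip j (fun x => f (flip i x))) sum_flip.
  by rewrite !big_split /= sij !sum_flip; ring.
rewrite -(pmulr_rge0 _ (_ : 0 < 4)) // -S4; apply: sumr_ge0 => x _.
have m1 : m (flip i x) i j = m x i j := mN x i j.
have m2 : m (flip j x) i j = m x i j by rewrite mC mN mC.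
have m3 : m (flip i (flip j x)) i j = m x i j by rewrite mN.
have dist (k e1 e2 e3 e4 : R) : k * e1 + k * e2 + k * e3 + k * e4 = k * (e1 + e2 + e3 + e4).
  by ring.
rewrite m1 m2 m3 dist; apply: mulr_ge0; first exact: m_ge0.
have e : U i x + U j (flip i x) = U j x + U i (flip j x).
  by rewrite /U (flipC j i); ring.
have E2 : E i j (flip i x) = U i x ^+ 2 * theta1 (rho (flip i x)) (rho x) *
    (rho (flip i (flip j x)) - rho (flip i x)) - 2 * U i x * U j (flip i x) * theta (rho (flip i x)) (rho x).
  by rewrite /E UN /p /th flipK (flipC j i x); ring.
have E3 : E i j (flip j x) = U i (flip j x) ^+ 2 *
    theta1 (rho (flip j x)) (rho (flip i (flip j x))) * (rho x - rho (flip j x))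
    - 2 * U i (flip j x) * U j x * theta (rho (flip j x)) (rho (flip i (flip j x))).
  by rewrite /E UN /p /th flipK; ring.
have E4 : E i j (flip i (flip j x)) = U i (flip j x) ^+ 2 *
    theta1 (rho (flip i (flip j x))) (rho (flip j x)) * (rho (flip i x) - rho (flip i (flip j x)))
    + 2 * U i (flip j x) * U j (flip i x) * theta (rho (flip i (flip j x))) (rho (flip j x)).
  have Uj : U j (flip i (flip j x)) = - U j (flip i x) by rewrite (flipC i j) UN.
  have fj : flip j (flip i (flip j x)) = flip i x by rewrite (flipC i j) flipK.
  by rewrite /E UN Uj /p /th flipK fj; ring.
rewrite E2 E3 E4.
exact: (square_ge0 (rho_gt0 x) (rho_gt0 (flip i x)) (rho_gt0 (flip j x))
  (rho_gt0 (flip i (flip j x))) e).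
Qed.

(** The substitution x -> x^i turns the weight pi(x^i) into pi(x), and the summand becomes an
    [edge_weight]. *)
Let diagonal_part : \sum_i \sum_x w (flip i x) * w (flip i x) * E i i x =
  \sum_i \sum_x pi x * (U i x ^+ 2 * ew i x).
Proof.
apply: eq_bigr => i _; rewrite -(sum_flip i); apply: eq_bigr => x _.
rewrite /E UN flipK /p /th flipK /ew /edge_weight (theta_sym (ltW (rho_gt0 _)) (ltW (rho_gt0 x))).
by rewrite (thetaE (rho_gt0 x) (rho_gt0 (flip i x))) /pi; ring.
Qed.

(** No sign is available for a single pair: (i, j) and (j, i) are taken together at the same x, with
    a share of the diagonal weight added to each. *)
Let excess_part : 0 <= \sum_i \sum_(j | j != i) \sum_x
  excess x i j * (E i j x + U i x ^+ 2 * ew i x).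
Proof.
under eq_bigr do rewrite big_mkcond.
rewrite sum_symmetrize mulr_ge0 //; apply: sumr_ge0 => i _; apply: sumr_ge0 => j _.
rewrite (eq_sym i j); case: ifP => _; last by rewrite addr0.
rewrite -big_split; apply: sumr_ge0 => x _ /=.
rewrite (excessC x j i) -mulrDr mulr_ge0 //.
rewrite addrACA; exact: cross_ge0.
Qed.

(** The two orientations of each edge are combined, and [edge_weight_amgm] is used with the square
    roots of pi at its two ends. *)
Let edge_part : 4 * dirichlet Q pi rho psi psi <=
  \sum_i \sum_x pi x * (U i x ^+ 2 * ew i x).
Proof.
rewrite dirichletE mulrA (_ : 4 / 2 = 2 :> R); last by field.
rewrite big_distrr; apply: ler_sum => i _ /=.
have -> : \sum_x pi x * (U i x ^+ 2 * ew i x) = 2^-1 * \sum_x (pi x * (U i x ^+ 2 * ew i x)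
    + pi (flip i x) * (U i (flip i x) ^+ 2 * ew i (flip i x))).
  rewrite big_split /= (sum_flip i (fun x => pi x * (U i x ^+ 2 * ew i x))).
  by field.
rewrite !big_distrr; apply: ler_sum => x _ /=.
have := edge_weight_amgm (rho_gt0 x) (rho_gt0 (flip i x)) (ltW (w_gt0 x)) (ltW (w_gt0 (flip i x))).
move=> /(ler_wpM2l (sqr_ge0 (U i x))).
rewrite UN /ew flipK /pi /th sqrrN; lra.
Qed.

Lemma bochner_flip : 4 * (1 - ep) * dirichlet Q pi rho psi psi <= bochner Q pi rho psi.
Proof.
rewrite mulrAC; have ep0 : 0 <= 1 - ep by rewrite subr_ge0.
apply: (le_trans (ler_wpM2r ep0 edge_part)).
(* Each off-diagonal coefficient is [m] plus the excess; the diagonal weights lent to the excess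
   terms are subtracted again in the last sum. *)
have split : bochner Q pi rho psi =
   \sum_i \sum_x pi x * (U i x ^+ 2 * ew i x)
   + \sum_i \sum_(j | j != i) \sum_x m x i j * E i j x
   + \sum_i \sum_(j | j != i) \sum_x excess x i j * (E i j x + U i x ^+ 2 * ew i x)
   - \sum_i \sum_x (U i x ^+ 2 * ew i x) * \sum_(j | j != i) excess x i j.
  rewrite bochnerE -diagonal_part -!big_split -sumrB; apply: eq_bigr => i _ /=.
  rewrite (bigD1 i) //= -addrA -addrA; congr (_ + _).
  have -> : \sum_x U i x ^+ 2 * ew i x * \sum_(j | j != i) excess x i j =
      \sum_(j | j != i) \sum_x U i x ^+ 2 * ew i x * excess x i j.
    by rewrite exchange_big; apply: eq_bigr => x _; rewrite big_distrr.
  rewrite -big_split -sumrB; apply: eq_bigr => j _ /=.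
  rewrite -big_split -sumrB; apply: eq_bigr => x _ /=.
  by rewrite /excess -/(m x i j); ring.
have inv : 0 <= \sum_i \sum_(j | j != i) \sum_x m x i j * E i j x.
  by apply: sumr_ge0 => i _; apply: sumr_ge0 => j _; exact: invariant_part.
have exc : \sum_i \sum_x (U i x ^+ 2 * ew i x) * \sum_(j | j != i) excess x i j <=
    ep * \sum_i \sum_x pi x * (U i x ^+ 2 * ew i x).
  rewrite big_distrr; apply: ler_sum => i _; rewrite big_distrr; apply: ler_sum => x _ /=.
  rewrite [leRHS](_ : _ = U i x ^+ 2 * ew i x * (ep * pi x)); last by ring.
  apply: ler_wpM2l => //; apply: mulr_ge0; first exact: sqr_ge0.
  exact: edge_weight_ge0.
rewrite split; have := excess_part; move: inv exc.
by lra.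
Qed.

End FlipBochner.

(** * Glauber dynamics *)

Section Glauber.
Context {R : realType} {n : nat}.
Variables (k : 'M[R]_n) (beta : R).
Implicit Types (x y : config n) (i j : 'I_n).

Lemma partition_function_gt0 : 0 < partition_function k beta.
Proof.
rewrite /partition_function (bigD1 [ffun=> false]) //= ltr_pwDl ?expR_gt0 //.
by apply: sumr_ge0 => x _; exact: expR_ge0.
Qed.

Lemma gibbs_gt0 x : 0 < gibbs k beta x.
Proof. by rewrite /gibbs mulr_gt0 ?expR_gt0 // invr_gt0 partition_function_gt0. Qed.

Lemma gibbs_sum : \sum_x gibbs k beta x = 1.
Proof.
by rewrite /gibbs -big_distrr /= mulVf // gt_eqF // partition_function_gt0.
Qed.

Definition sqrt_gibbs x : R := Num.sqrt (gibbs k beta x).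

Lemma sqrt_gibbs_gt0 x : 0 < sqrt_gibbs x.
Proof. by rewrite sqrtr_gt0 gibbs_gt0. Qed.

Lemma gibbsE : gibbs k beta = fun x => sqrt_gibbs x ^+ 2.
Proof. by apply/funext => x; rewrite sqr_sqrtr // ltW // gibbs_gt0. Qed.

Lemma glauberE x y : differ_in_one x y -> glauber k beta x y = sqrt_gibbs y / sqrt_gibbs x.
Proof.
by move=> xy; rewrite /glauber xy sqrtrM ?sqrtrV ?(ltW (gibbs_gt0 _)).
Qed.

Lemma glauber_ge0 x y : 0 <= glauber k beta x y.
Proof. by rewrite /glauber; case: ifP => // _; exact: sqrtr_ge0. Qed.

Lemma differ_in_one_sym x y : differ_in_one x y = differ_in_one y x.
Proof.
by rewrite /differ_in_one; congr (_ == _); apply: eq_card => i; rewrite !inE eq_sym.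
Qed.

Lemma glauber_rev x y :
  glauber k beta x y * sqrt_gibbs x ^+ 2 = glauber k beta y x * sqrt_gibbs y ^+ 2.
Proof.
case: (boolP (differ_in_one x y)) => xy; last first.
  by rewrite /glauber -(differ_in_one_sym x y) (negbTE xy) !mul0r.
rewrite !glauberE // -?(differ_in_one_sym x y) //.
by field; rewrite !gt_eqF // sqrt_gibbs_gt0.
Qed.

Lemma glauber_irreducible (phi : config n -> R) :
  (forall x y, 0 < glauber k beta x y -> phi x = phi y) -> forall x y, phi x = phi y.
Proof.
move=> h x y.
have hflip i z : phi (flip i z) = phi z.
  apply/esym/h; have zi : differ_in_one z (flip i z) by apply/differ_in_oneP; exists i.
  by rewrite glauberE // divr_gt0 // sqrt_gibbs_gt0.
(* Induction on the Hamming distance from x to y. *)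
have [N] := ubnP #|[set i | x i != y i]%SET|; elim: N x => // N ih x.
have [/eqP|/set0Pn[i]] := boolP ([set i | x i != y i]%SET == finset.set0).
  move=> /setP e _; congr phi; apply/ffunP => i; have := e i.
  by rewrite !inE => /negbFE/eqP.
rewrite inE => xi hN; rewrite -(hflip i x); apply: ih.
rewrite ltnS in hN; apply: leq_trans hN.
apply: proper_card; apply/properP; split; last first.
  by exists i; rewrite inE // ffunE eqxx; move: xi; case: (x i); case: (y i).
apply/fintype.subsetP => j; rewrite !inE ffunE; have [->|_ //] := eqVneq j i.
by move: xi; case: (x i); case: (y i).
Qed.

Lemma glauber_sum (f : config n -> R) x : \sum_y glauber k beta x y * f y =
  \sum_i sqrt_gibbs (flip i x) / sqrt_gibbs x * f (flip i x).
Proof.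
transitivity (\sum_(y in [set flip i x | i : 'I_n]%SET) sqrt_gibbs y / sqrt_gibbs x * f y).
  rewrite [RHS]big_mkcond; apply: eq_bigr => y _.
  case: imsetP => [[i _ ->]|ny].
    by rewrite glauberE //; apply/differ_in_oneP; exists i.
  rewrite /glauber ifF ?mul0r //; apply/negbTE/negP => /differ_in_oneP[i yi].
  by apply: ny; exists i.
by rewrite big_imset //= => i j _ _; exact: flip_inj.
Qed.

Lemma min_rate_le1 : (0 < n)%N -> min_rate k beta <= 1.
Proof.
move=> n0; pose x : config n := [ffun=> false]; pose y := flip (Ordinal n0) x.
have xy : differ_in_one x y by apply/differ_in_oneP; exists (Ordinal n0).
have yx : differ_in_one y x by rewrite differ_in_one_sym.
have lb u v : differ_in_one u v -> min_rate k beta <= glauber k beta u v.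
  move=> uv; apply: ge_inf; last by exists u, v.
  by exists 0 => _ [a [b [_ ->]]]; exact: glauber_ge0.
have p : glauber k beta x y * glauber k beta y x = 1.
  by rewrite !glauberE //; field; rewrite !gt_eqF // sqrt_gibbs_gt0.
have := lb _ _ xy; have := lb _ _ yx; rewrite [_ <= 1]leNgt.
move=> h1 h2; apply/negP => h.
have g1 := lt_le_trans h h1; have g2 := lt_le_trans h h2.
by have := mulr_egt1 g1 g2; rewrite mulrC p ltxx.
Qed.

Definition local_field x i : R := \sum_m k i m * spin x i * spin x m.

Lemma spin_flip x i j : spin (flip i x) j = (1 - 2 * (j == i)%:R) * spin x j :> R.
Proof.
rewrite /spin ffunE; case: eqP => _; case: (x j); rewrite /= ?expr0 ?expr1; ring.
Qed.

Lemma sum_delta (f : 'I_n -> R) i : \sum_j (j == i)%:R * f j = f i.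
Proof.
rewrite (bigD1 i) //= eqxx mul1r big1 ?addr0 // => j /negbTE ->.
by rewrite mul0r.
Qed.

Hypothesis k_sym : forall i j, k i j = k j i.
Hypothesis k_diag : forall i, k i i = 0.
Hypothesis beta_gt0 : 0 < beta.

(** A flip reverses the terms in row i and in column i, which agree by symmetry of [k]; each
    reversal counts twice, hence the factor 4. *)
Lemma hamiltonian_flip x i : hamiltonian k (flip i x) = hamiltonian k x + 4 * local_field x i.
Proof.
rewrite /hamiltonian; set s := spin x.
have -> : \sum_a \sum_b k a b * spin (flip i x) a * spin (flip i x) b =
    \sum_a \sum_b k a b * s a * s b
    - 2 * (\sum_a (a == i)%:R * \sum_b k a b * s a * s b)
    - 2 * (\sum_b (b == i)%:R * \sum_a k a b * s a * s b)
    + 4 * (\sum_a (a == i)%:R * \sum_b (b == i)%:R * (k a b * s a * s b)).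
  have -> : \sum_b (b == i)%:R * (\sum_a k a b * s a * s b) =
      \sum_a \sum_b (b == i)%:R * (k a b * s a * s b).
    by rewrite exchange_big; apply: eq_bigr => b _; rewrite big_distrr.
  rewrite !big_distrr -!sumrB -big_split; apply: eq_bigr => a _ /=.
  rewrite !big_distrr -!sumrB -big_split; apply: eq_bigr => b _ /=.
  by rewrite !spin_flip -/s; ring.
rewrite !sum_delta k_diag.
have -> : \sum_a k a i * s a * s i = local_field x i.
  by apply: eq_bigr => a _; rewrite k_sym mulrAC.
by rewrite -/(local_field x i); ring.
Qed.

Lemma sqrt_gibbs_flip x i :
  sqrt_gibbs (flip i x) = sqrt_gibbs x * expR (- (2 * beta * local_field x i)).
Proof.
rewrite /sqrt_gibbs.
have -> : gibbs k beta (flip i x) = gibbs k beta x * expR (- (2 * beta * local_field x i)) ^+ 2.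
  rewrite /gibbs hamiltonian_flip -[RHS]mulrA expr2 -!expRD; congr (_ * expR _); ring.
by rewrite sqrtrM ?sqrtr_sqr ?ger0_norm ?expR_ge0 // ltW // gibbs_gt0.
Qed.

Lemma local_field_flip x i j : i != j ->
  local_field (flip j x) i = local_field x i - 2 * (k i j * spin x i * spin x j).
Proof.
move=> /negbTE ij; rewrite /local_field.
have -> : 2 * (k i j * spin x i * spin x j) =
    \sum_m (m == j)%:R * (2 * (k i m * spin x i * spin x m)) by rewrite sum_delta.
rewrite -sumrB; apply: eq_bigr => m _; rewrite !spin_flip ij mulr0n.
by ring.
Qed.

Lemma norm_spin x i : `|spin x i : R| = 1.
Proof. by rewrite /spin normrX normrN1 expr1n. Qed.

(** The two products in [excess] are pi(x) e^A and pi(x) e^(A + B), so the excess is either 0 or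
    pi(x) e^(A + B) (e^(-B) - 1). *)
Lemma excess_le_term x i j : j != i -> excess sqrt_gibbs x i j <= sqrt_gibbs x ^+ 2 *
  (expR (2 * beta * \sum_(m | (m != i) && (m != j)) (`|k i m| + `|k j m|))
     * (expR (4 * beta * `|k i j|) - 1)).
Proof.
move=> ji; have ij : i != j by rewrite eq_sym.
set t := k i j * spin x i * spin x j.
set A := - (2 * beta * (local_field x i + local_field x j)).
(* The coupling of i and j enters both local fields; adding [B] removes it, so that A + B only
   involves the other spins, while |B| is at most 4 beta |k_ij|. *)
set B := 4 * beta * t.
set w2 := sqrt_gibbs x ^+ 2.
have w20 : 0 <= w2 by exact: sqr_ge0.
have e1 : sqrt_gibbs (flip i x) * sqrt_gibbs (flip j x) = w2 * expR A.
  rewrite !sqrt_gibbs_flip /A mulrDr opprD expRD /w2; ring.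
have e2 : sqrt_gibbs x * sqrt_gibbs (flip i (flip j x)) = w2 * expR (A + B).
  rewrite !sqrt_gibbs_flip local_field_flip // -/t.
  have -> : A + B = - (2 * beta * local_field x j) + - (2 * beta * (local_field x i - 2 * t)).
    by rewrite /A /B; ring.
  by rewrite expRD /w2; ring.
set rhs := w2 * _.
have tB : - B <= 4 * beta * `|k i j|.
  rewrite /B -mulrN ler_wpM2l ?mulr_ge0 ?(ltW beta_gt0) //.
  apply: le_trans (ler_norm _) _.
  by rewrite normrN /t !normrM !norm_spin !mulr1.
have AB : A + B <= 2 * beta * \sum_(m | (m != i) && (m != j)) (`|k i m| + `|k j m|).
  have sE (a b : 'I_n) : a != b -> local_field x a = k a b * spin x a * spin x b +
      \sum_(m | (m != a) && (m != b)) k a m * spin x a * spin x m.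
    move=> ab; rewrite /local_field (bigD1 a) //= k_diag !mul0r add0r (bigD1 b) //=.
    by rewrite eq_sym.
  have -> : A + B = 2 * beta * \sum_(m | (m != i) && (m != j))
      - (k i m * spin x i * spin x m + k j m * spin x j * spin x m).
    rewrite /A /B (sE i j ij) (sE j i ji) -/t sumrN big_split /=.
    rewrite (eq_bigl (fun m => (m != i) && (m != j)) (fun m => k j m * _ * _)); last first.
      by move=> m; rewrite andbC.
    have -> : k j i * spin x j * spin x i = t by rewrite /t k_sym mulrAC.
    by ring.
  apply: ler_wpM2l; first by rewrite mulr_ge0 // ltW.
  apply: ler_sum => m _; apply: le_trans (ler_norm _) _.
  rewrite normrN; apply: le_trans (ler_normD _ _) _.
  by rewrite !normrM !norm_spin !mulr1.
have rhs0 : 0 <= rhs.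
  rewrite mulr_ge0 // mulr_ge0 ?expR_ge0 // subr_ge0 -expR0 ler_expR.
  by rewrite !mulr_ge0 // ltW.
rewrite /excess e1 e2; have [h|h] := leP (w2 * expR A) (w2 * expR (A + B)).
  by rewrite subrr.
have -> : w2 * expR A - w2 * expR (A + B) = w2 * (expR (A + B) * (expR (- B) - 1)).
  have : expR (A + B) * expR (- B) = expR A by rewrite -expRD addrK.
  by move=> <-; ring.
apply: ler_wpM2l => //; apply: (@le_trans _ _ (expR (A + B) * (expR (4 * beta * `|k i j|) - 1))).
  by rewrite ler_wpM2l ?expR_ge0 // lerB // ler_expR.
rewrite ler_wpM2r ?ler_expR // subr_ge0 -expR0 ler_expR.
by rewrite !mulr_ge0 // ltW.
Qed.

Lemma excess_le_eps x i :
  \sum_(j | j != i) excess sqrt_gibbs x i j <= eps k beta * sqrt_gibbs x ^+ 2.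
Proof.
apply: (@le_trans _ _ (\sum_(j | j != i) sqrt_gibbs x ^+ 2 *
  (expR (2 * beta * \sum_(m | (m != i) && (m != j)) (`|k i m| + `|k j m|))
     * (expR (4 * beta * `|k i j|) - 1)))).
  by apply: ler_sum => j; exact: excess_le_term.
rewrite -big_distrr /= mulrC ler_wpM2r ?sqr_ge0 //.
exact: (le_bigmax _ (fun i => \sum_(j | j != i)
    (expR (2 * beta * \sum_(m | (m != i) && (m != j)) (`|k i m| + `|k j m|))
     * (expR (4 * beta * `|k i j|) - 1)))).
Qed.

End Glauber.

(* The couplings are symmetric, as usual for an Ising model.  As eps only sees
   the rows of k, the statement fails without this hypothesis: if k i 0 = K for
   i > 0, the other entries vanish and expR (4 * beta * K) = 2, then eps = 1 for
   every n, while the chain has an exponentially small bottleneck. *)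
Theorem theorem4p1 (R : realType) (n : nat) (k : 'M[R]_n) (beta : R)
    (n_gt0 : (0 < n)%N)
    (k_sym : forall i j, k i j = k j i)
    (k_diag : forall i, k i i = 0)
    (beta_gt0 : 0 < beta)
    (eps_le1 : eps k beta <= 1) :
  Ric_ge (glauber k beta) (gibbs k beta)
    ((1 - eps k beta) * 2 * min_rate k beta).
Proof.
have pi_gt0 x : 0 < sqrt_gibbs k beta x ^+ 2.
  by apply: exprn_gt0; exact: sqrt_gibbs_gt0.
have pi_sum : \sum_x sqrt_gibbs k beta x ^+ 2 = 1.
  by rewrite -(gibbs_sum k beta) gibbsE.
have e0 : 0 <= 1 - eps k beta by rewrite subr_ge0.
have kappa_ge0 : 0 <= 2 * (1 - eps k beta) by rewrite mulr_ge0.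
rewrite gibbsE; apply: (Ric_ge_of_bochner (@glauber_ge0 R n k beta) pi_gt0 pi_sum
  (@glauber_rev R n k beta) (@glauber_irreducible R n k beta) kappa_ge0).
  move=> rho psi rho_gt0; rewrite (_ : 2 * (2 * _) = 4 * (1 - eps k beta)); last by ring.
  exact: (bochner_flip (@sqrt_gibbs_gt0 R n k beta) (@glauber_rev R n k beta)
    (@glauber_sum R n k beta) (excess_le_eps k_sym k_diag beta_gt0) eps_le1 psi rho_gt0).
rewrite [X in X * _]mulrC ler_piMr //; exact: min_rate_le1.
Qed.
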